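(* Let $N\ge 3$, let $\lambda_1,\dots,\lambda_N>0$ with $\sum_{i=1}^N\lambda_i=1$, let $S,Y\subseteq\mathbb R^n$ be compact, and let $\rho\in\mathcal P_{\mathrm{ac}}(S)\cap L^\infty(S)$. Then there exists a constant $C>0$, depending only on $\lambda_1$, $N$, $\operatorname{diam}(S\cup Y)$, $n$ and $\|\rho\|_{L^\infty}$, such that for any $\mu_2,\dots,\mu_N\in\mathcal P(Y)$ and any $\tilde\mu_2,\dots,\tilde\mu_N\in\mathcal P(Y)$, $$\sum_{i=2}^N\lambda_i\|T_i-\tilde T_i\|_{L^2(\rho)}\le C\Big(\sum_{i=2}^N\lambda_iW_1(\mu_i,\tilde\mu_i)\Big)^{1/4},$$ where $(T_2,\dots,T_N)$ and $(\tilde T_2,\dots,\tilde T_N)$ are the multi-marginal optimal transport maps associated with $(\rho,\mu_2,\dots,\mu_N)$ and $(\rho,\tilde\mu_2,\dots,\tilde\mu_N)$ respectively. Moreover, the exponent $\frac14$ is optimal in dimension $n\ge2$: for every $n\ge 2$, $N\ge3$ and $\alpha>\frac14$, the assertion obtained by replacing the exponent $\frac14$ by $\alpha$ (with a constant depending only on $\lambda_1$, $N$, $\operatorname{diam}(S\cup Y)$, $n$ and $\|\rho\|_{L^\infty}$, and valid for all weights $\lambda_1,\dots,\lambda_N>0$ with $\sum_{i=1}^N\lambda_i=1$, all compact sets $S,Y\subseteq\mathbb R^n$, all $\rho\in\mathcal P_{\mathrm{ac}}(S)\cap L^\infty(S)$ and all $\mu_2,\dots,\mu_N,\tilde\mu_2,\dots,\tilde\mu_N\in\mathcal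 P(Y)$) is false.
   Context: $\mathcal P(E)$ is the set of Borel probability measures on $E$; $\mathcal P_{\mathrm{ac}}(S)$ is the set of probability measures on $S$ absolutely continuous with respect to the Lebesgue measure $\mathcal L^n$; $\rho\in L^\infty(S)$ means that its density is essentially bounded, with $\|\rho\|_{L^\infty}$ the essential supremum of the density. $W_1$ is the 1-Wasserstein distance for the Euclidean distance. The barycentric quadratic cost is $c(x_1,\dots,x_N)=\inf_{y\in\mathbb R^n}\sum_{i=1}^N\frac{\lambda_i}{2}|x_i-y|^2=\frac12\sum_{1\le i<j\le N}\lambda_i\lambda_j|x_i-x_j|^2$. Given $\rho\in\mathcal P_{\mathrm{ac}}(S)$ and $\mu_2,\dots,\mu_N\in\mathcal P(Y)$, the multi-marginal optimal transport maps associated with $(\rho,\mu_2,\dots,\mu_N)$ are the ($\rho$-a.e. unique, by a theorem of Gangbo and Święch) minimizers $(T_2,\dots,T_N)$ of $\int_S c(x_1,T_2(x_1),\dots,T_N(x_1))\,d\rho(x_1)$ among maps $T_i:S\to Y$ with $(T_i)_\#\rho=\mu_i$, $i=2,\dots,N$. *)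

(* Defs.v *)
From HB Require Import structures.
From mathcomp Require Import all_boot all_order all_algebra.
From mathcomp Require Import all_classical all_reals all_analysis.
From mathcomp Require Import measurable_realfun.

Set Implicit Arguments.
Unset Strict Implicit.
Unset Printing Implicit Defensive.

Import Order.TTheory GRing.Theory Num.Theory.
Import numFieldNormedType.Exports.

Local Open Scope classical_set_scope.
Local Open Scope ring_scope.

(** R^n is ['rV[R]_n] with its product topology and its Borel sigma-algebra. *)

HB.instance Definition _ (R : realType) (n : nat) :=
  @isMeasurable.Build (sigma_display (@open 'rV[R]_n)) 'rV[R]_n
    <<s (@open 'rV[R]_n) >> (@sigma_algebra0 _ setT _)
    (@sigma_algebraC 'rV[R]_n _) (@sigma_algebra_bigcup _ setT _).

Section rV_measurable.
Context (R : realType).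

Lemma measurable_coord n (i : 'I_n) :
  measurable_fun setT (fun x : 'rV[R]_n => x ord0 i).
Proof.
apply: (measurability _ (RGenOInfty.measurableE R)) => _ [_ [a ->] <-].
rewrite setTI; apply: sub_sigma_algebra.
by apply: open_comp; [move=> x _; exact: coord_continuous|exact: interval_open].
Qed.

Lemma measurable_rV d (T : measurableType d) n (f : T -> 'rV[R]_n) :
  (forall i, measurable_fun setT (fun x => f x ord0 i)) ->
  measurable_fun setT f.
Proof.
move=> mf.
apply: (@measurability _ _ _ _ _ f (@open (matrix R 1 n)) erefl) => _ [U oU <-].
rewrite setTI.
pose eps k : R := k.+1%:R^-1.
pose P (p : 'rV[rat]_n * nat) :=
  ball (map_mx ratr p.1 : 'rV[R]_n) (eps p.2) `<=` U.
have -> : f @^-1` U = \bigcup_(p : 'rV[rat]_n * nat)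
    (if `[< P p >] then \bigcap_(i : 'I_n)
       [set x | ball (ratr (p.1 ord0 i) : R) (eps p.2) (f x ord0 i)] else set0).
  apply/seteqP; split=> [x Ux|x [p _]]; last first.
    case: asboolP => // Pp bx; apply: Pp; split; first by rewrite invr_gt0.
    by move=> j i; rewrite mxE [j]ord1; exact: bx.
  have /nbhs_ballP[e /= e0 sU] : nbhs (f x) U by apply: open_nbhs_nbhs.
  have [k ke] : exists k, eps k < e / 2.
    have e20 : 0 < e / 2 by rewrite divr_gt0.
    have [k _ /(_ k (leqnn k)) h] := near_infty_natSinv_lt (PosNum e20).
    by exists k.
  have ek : 0 < eps k by rewrite invr_gt0.
  have /choice[q hq] : forall i, exists q : rat, ball (f x ord0 i) (eps k) (ratr q).
    move=> i; have [|q] := @rat_in_itvoo R (f x ord0 i) (f x ord0 i + eps k).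
      by rewrite ltrDl.
    rewrite in_itv/= => /andP[h1 h2]; exists q.
    by rewrite /ball/= ltr_distlC; apply/andP; split; [rewrite ltrBlDr (lt_trans h1)// ltrDl|].
  exists (\row_i q i, k) => //.
  case: asboolP => [_ i _ /=|]; first by rewrite mxE; exact/ball_sym.
  case=> y [_ /= hy]; apply: sU; split=> // j i.
  have := hy j i; rewrite [j]ord1 !mxE => hy'.
  apply: (@ball_splitr R R (ratr (q i) : R)).
    exact: (@le_ball R R _ _ _ (ltW ke)) (ball_sym (hq i)).
  exact: (@le_ball R R _ _ _ (ltW ke)) hy'.
apply: countable_bigcupT_measurable => // p.
case: ifPn => // _; apply: fin_bigcap_measurable => // i _.
rewrite -[X in measurable X]setTI; apply: mf => //; exact: measurable_ball.
Qed.

Definition cons_rV n (p : R * 'rV[R]_n) : 'rV[R]_n.+1 :=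
  row_mx (p.1%:M : 'rV[R]_1) p.2.

Definition uncons_rV n (x : 'rV[R]_n.+1) : R * 'rV[R]_n :=
  (x ord0 ord0, @rsubmx R 1 1 n x).

Lemma uncons_rVK n : cancel (@uncons_rV n) (@cons_rV n).
Proof.
move=> x; apply/rowP => i; rewrite /cons_rV.
case: (@split_ordP 1 n i) => j ->.
  rewrite (@row_mxEl _ 1 1 n) [j]ord1 mxE eqxx mulr1n.
  by congr (x _ _); exact/val_inj.
by rewrite (@row_mxEr _ 1 1 n) mxE.
Qed.

Lemma cons_rVK n : cancel (@cons_rV n) (@uncons_rV n).
Proof.
move=> [a x]; rewrite /uncons_rV /cons_rV row_mxKr/=; congr pair.
have -> : (ord0 : 'I_n.+1) = lshift n (ord0 : 'I_1) by exact/val_inj.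
by rewrite (@row_mxEl _ 1 1 n) mxE eqxx mulr1n.
Qed.

Lemma measurable_cons_rV n : measurable_fun setT (@cons_rV n).
Proof.
apply: measurable_rV => i; rewrite /cons_rV.
case: (@split_ordP 1 n i) => j ->.
  under [X in measurable_fun _ X]funext => p do
    rewrite (@row_mxEl _ 1 1 n) [j]ord1 mxE eqxx mulr1n.
  exact: measurable_fst.
under [X in measurable_fun _ X]funext => p do rewrite (@row_mxEr _ 1 1 n).
exact: measurableT_comp (measurable_coord j) measurable_snd.
Qed.

Lemma measurable_uncons_rV n : measurable_fun setT (@uncons_rV n).
Proof.
apply/measurable_fun_pairP; split; first exact: measurable_coord.
apply: measurable_rV => i /=.
by under [X in measurable_fun _ X]funext do rewrite mxE; exact: measurable_coord.
Qed.

End rV_measurable.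

Section lebesgue_cons.
Context (R : realType) (n : nat).
Variable mu : {sigma_finite_measure set 'rV[R]_n -> \bar R}.

Definition lebesgue_cons : set 'rV[R]_n.+1 -> \bar R :=
  pushforward (@lebesgue_measure R \x mu)%E (@cons_rV R n).

HB.instance Definition _ := Measure.copy lebesgue_cons
  (measure_function_pushforward__canonical__measure_function_Measure
    (@lebesgue_measure R \x mu)%E (@measurable_cons_rV R n)).

Let lebesgue_cons_sigma_finite : sigma_finite setT lebesgue_cons.
Proof.
have /sigma_finiteP[F [TF ndF Foo]] := sigma_finiteT (@lebesgue_measure R).
have /sigma_finiteP[G [TG ndG Goo]] := sigma_finiteT mu.
exists (fun k => @uncons_rV R n @^-1` (F k `*` G k)).
  apply/seteqP; split=> // x _.
  have [i _ Fi] : (\bigcup_i F i) (uncons_rV x).1 by rewrite -TF.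
  have [j _ Gj] : (\bigcup_j G j) (uncons_rV x).2 by rewrite -TG.
  exists (maxn i j) => //; split.
    by move: Fi; exact/subsetPset/ndF/leq_maxl.
  by move: Gj; exact/subsetPset/ndG/leq_maxr.
move=> k; have [mF Fk] := Foo k; have [mG Gk] := Goo k; split.
  rewrite -[X in measurable X]setTI; apply: measurable_uncons_rV => //.
  exact: measurableX.
rewrite /lebesgue_cons /pushforward -comp_preimage.
have -> : @uncons_rV R n \o @cons_rV R n = id.
  by apply/funext => p; exact: cons_rVK.
by rewrite preimage_id product_measure1E// lte_mul_pinfty// ge0_fin_numE.
Qed.

HB.instance Definition _ := Measure_isSigmaFinite.Build _ _ _ lebesgue_cons
  lebesgue_cons_sigma_finite.

End lebesgue_cons.

Fixpoint lebesgue_rV (R : realType) (n : nat) :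
    {sigma_finite_measure set 'rV[R]_n -> \bar R} :=
  match n with
  | 0 => dirac (0 : 'rV[R]_0)
  | n.+1 => lebesgue_cons (lebesgue_rV R n)
  end.

Lemma lebesgue_rV_box (R : realType) (n : nat) (A : 'I_n -> set R) :
  (forall i, measurable (A i)) ->
  lebesgue_rV R n [set x | forall i, A i (x ord0 i)] =
  (\prod_(i < n) lebesgue_measure (A i))%E.
Proof.
elim: n => [|n IHn] in A *; move=> mA.
  by rewrite big_ord0 /= diracE mem_set// => -[].
rewrite big_ord_recl -IHn//= /lebesgue_cons /pushforward.
have mB : measurable [set x : 'rV[R]_n | forall i, A (lift ord0 i) (x ord0 i)].
  rewrite (_ : mkset _ = \bigcap_(i : 'I_n)
      (fun x : 'rV[R]_n => x ord0 i) @^-1` A (lift ord0 i)).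
    apply: fin_bigcap_measurable => // i _; rewrite -[X in measurable X]setTI.
    exact: measurable_coord.
  by apply/seteqP; split=> [x xA i _|x xA i]; [exact: xA|exact: xA i I].
rewrite -product_measure1E//; last exact: mA.
congr (product_measure1 _ _ _); apply/seteqP; split=> -[a x] /=.
  move=> xA; split=> [|i] /=.
    have := xA ord0; rewrite /cons_rV.
    have -> : (ord0 : 'I_n.+1) = lshift n (ord0 : 'I_1) by exact/val_inj.
    by rewrite (@row_mxEl _ 1 1 n) mxE eqxx mulr1n.
  have := xA (lift ord0 i); rewrite /cons_rV.
  have -> : lift ord0 i = rshift 1 i by exact/val_inj.
  by rewrite (@row_mxEr _ 1 1 n).
move=> [aA xA] i; rewrite /cons_rV /=; case: (@split_ordP 1 n i) => j ->.
  rewrite (@row_mxEl _ 1 1 n) [j]ord1 mxE eqxx mulr1n.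
  by have <- : (ord0 : 'I_n.+1) = lshift n (ord0 : 'I_1) by exact/val_inj.
rewrite (@row_mxEr _ 1 1 n).
by have <- : lift ord0 j = rshift 1 j by exact/val_inj.
Qed.

Section optimal_transport.
Context (R : realType) (n : nat).
Local Notation E := 'rV[R]_n.

Definition enorm (x : E) : R := Num.sqrt (\sum_i x ord0 i ^+ 2).

Definition ediam (A : set E) : R :=
  sup [set enorm (x - y) | x in A & y in A].

(** A member of P(A) is a Borel probability measure on R^n of mass 1 on A. *)
Definition carried_by (mu : probability E R) (A : set E) := mu A = 1%E.

(** [Radon_Nikodym] is a density of [rho] only if [rho `<< lebesgue_rV R n]. *)
Definition Linf_norm (rho : probability E R) : \bar R :=
  'N[lebesgue_rV R n]_+oo
    [Radon_Nikodym (charge_of_finite_measure rho) (lebesgue_rV R n)].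

Definition coupling (mu nu : probability E R) (g : probability (E * E)%type R) :=
  (forall A, measurable A -> g (fst @^-1` A) = mu A) /\
  (forall A, measurable A -> g (snd @^-1` A) = nu A).

Definition wasserstein1 (mu nu : probability E R) : \bar R :=
  ereal_inf [set (\int[g]_z (enorm (z.1 - z.2))%:E)%E | g in coupling mu nu].

Definition bary_cost N (lambda : 'I_N -> R) (x : 'I_N -> E) : R :=
  inf [set \sum_i lambda i / 2 * enorm (x i - y) ^+ 2 | y in [set: E]].

Definition transport_map (S Y : set E) (rho mu : probability E R) (T : E -> E) :=
  [/\ measurable_fun S T, T @` S `<=` Y
    & forall A, measurable A -> mu A = rho (S `&` T @^-1` A)].

(** There are [N = m.+1] marginals: [ord0] is the first one, and
    [i : 'I_m] stands for the marginal [lift ord0 i]. *)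
Definition family_of m (x : E) (t : 'I_m -> E) : 'I_m.+1 -> E :=
  fun i => if unlift ord0 i is Some j then t j else x.

Definition multi_cost m (lambda : 'I_m.+1 -> R) (S : set E)
    (rho : probability E R) (T : 'I_m -> E -> E) : \bar R :=
  (\int[rho]_(x in S) (bary_cost lambda (family_of x (T ^~ x)))%:E)%E.

Definition multi_ot_maps m (lambda : 'I_m.+1 -> R) (S Y : set E)
    (rho : probability E R) (mu : 'I_m -> probability E R)
    (T : 'I_m -> E -> E) :=
  (forall i, transport_map S Y rho (mu i) (T i)) /\
  (forall T' : 'I_m -> E -> E,
    (forall i, transport_map S Y rho (mu i) (T' i)) ->
    (multi_cost lambda S rho T <= multi_cost lambda S rho T')%E).

Definition L2_dist (S : set E) (rho : probability E R) (T T' : E -> E) : \bar R :=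
  'N[rho]_2%:E [(fun x => (enorm (T x - T' x))%:E) \_ S].

Definition stability_estimate m (lambda : 'I_m.+1 -> R) (S Y : set E)
    (rho : probability E R) (alpha C : R) : Prop :=
  forall mu mu' : 'I_m -> probability E R,
  (forall i, carried_by (mu i) Y) -> (forall i, carried_by (mu' i) Y) ->
  forall T T' : 'I_m -> E -> E,
  multi_ot_maps lambda S Y rho mu T -> multi_ot_maps lambda S Y rho mu' T' ->
  (\sum_(i < m) (lambda (lift ord0 i))%:E * L2_dist S rho (T i) (T' i) <=
   C%:E * (\sum_(i < m) (lambda (lift ord0 i))%:E *
             wasserstein1 (mu i) (mu' i)) `^ alpha)%E.

(** The constant depends on [l = lambda ord0], [D = ediam (S `|` Y)] and
    [M = Linf_norm rho] only, besides [n] and [m]. *)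
Definition uniform_stability (m : nat) (alpha : R) : Prop :=
  forall l D M : R, exists2 C : R, 0 < C &
  forall (lambda : 'I_m.+1 -> R) (S Y : set E) (rho : probability E R),
  (forall i, 0 < lambda i) -> \sum_i lambda i = 1 -> lambda ord0 = l ->
  compact S -> compact Y -> ediam (S `|` Y) = D ->
  carried_by rho S -> rho `<< lebesgue_rV R n -> Linf_norm rho = M%:E ->
  stability_estimate lambda S Y rho alpha C.

End optimal_transport.

(* Main.v *)
From HB Require Import structures.
Require Import Defs.
From mathcomp Require Import all_boot all_order all_algebra.
From mathcomp Require Import all_classical all_reals all_analysis.
From mathcomp Require Import measurable_realfun ess_sup_inf ring lra.

(** Fix a point [p] and put [b x y = lam0 (x - p) + sum_i lam_i (y_i - p)].
    Expanding squares shows that the barycentric cost is a sum of functions of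
    the single entries minus [2^-1 |b x y|^2] ([bary_costE]); as the marginals
    are prescribed, an optimal family is one that maximizes the integral of
    [|b|^2].  The dual objects are potentials [f_i] on [Y] with the conjugate
    [F = pconj f]: the gap [F x + sum_i f_i (y_i) - 2^-1 |b x y|^2] is
    nonnegative, and its integral along a family of maps is the dual value of
    [f], which depends on the marginals only, minus half the integral of [|b|^2].

    Stability.  Two pointwise facts carry the estimate.  First, [F] lies above
    the tangent planes of the convex functions [2^-1 |b x y|^2] of [x], so two
    families [y], [z] of small gap at [x] have
    [lam0 t |<b x y - b x z, e_k>|] bounded by the second difference of [F] at
    [x] with step [t e_k], plus the gaps ([gap_sdiff]).  Second, exchanging the
    [i]-th entries of [y] and [z] bounds [lam_i^2 |y_i - z_i|^2] by
    [|b x y - b x z|^2] plus the gaps ([gap_swap]).  Over a cube the second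
    differences of a Lipschitz function integrate to [O(t^2)], because they
    telescope to slabs along two faces ([integral_sdiff_le]); a measure of
    bounded density inherits this.  If the family [T] has zero gap and [T']
    has integrated gap [delta] for the same potentials, then [lam_i^2] times the
    square of the distance of [T_i] and [T'_i] in [L^2] is at most a constant
    times [t + delta / t] ([gap_stability]).  Taking the potentials of [T] and those
    of [T'], the sum of the two crossed gaps is a sum of integrals of Lipschitz
    functions against [mu_i - mu'_i], so [delta] is at most a constant times
    [W = sum_i lam_i W_1(mu_i, mu'_i)] ([gap_sum_le]).  The choice [t = sqrt W]
    gives [W^(1/2)] for the square, hence the exponent 1/4.

    That an optimal family has zero gap for some potentials is a duality
    statement.  A minimizer [f] of the dual functional exists in a compact class
    of Lipschitz potentials ([dual_minimizer]).  At almost every [x] the second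
    differences of [F] are [o(t)], so by the two pointwise facts the maximizing
    family is unique and stable, and perturbing one potential by [t h] lowers
    [F x] at the rate [h (T_i x)].  Minimality of [f] then says that the map
    [T_i] sends [rho] to [mu_i] ([optimal_map_exists]).  So there are transport
    maps of zero gap, and any optimal family must do equally well.

    Sharpness.  Let [rho] be uniform on the two boxes [|x_0| <= 1/4],
    [1 <= |x_1| <= 2], [0 <= x_k <= 1], with equal weights and with all other
    marginals but one equal to the Dirac mass at the origin.  The maps [switch th] send
    [x] to one of the four points [(+-1, +-eps)]: the second sign is that of [x_1],
    the first one that of [x_0 - th eps sgn x_1].  For [0 <= th <= 1] explicit
    potentials show that they are optimal ([switch_optimal]).  The maps for
    [th = 0] and [th = 1] are at distance 2 on a strip of mass [2 eps], so their
    distance in [L^2] is [sqrt (8 eps)].  Yet mass [eps] leaves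
    [(1, eps)] for [(-1, eps)] while the same mass leaves [(-1, -eps)] for
    [(1, -eps)], which can be rearranged as two moves of length [2 eps]: the
    image measures are at distance at most [4 eps^2].  Letting [eps] tend to 0
    excludes every exponent above 1/4. *)

Set Implicit Arguments.
Unset Strict Implicit.
Unset Printing Implicit Defensive.

Import Order.TTheory GRing.Theory Num.Theory.
Import numFieldNormedType.Exports.

Local Open Scope classical_set_scope.
Local Open Scope ring_scope.

(** * Euclidean geometry and integrals of bounded functions *)

Section euclidean.
Context (R : realType) (n : nat).
Local Notation E := 'rV[R]_n.
Implicit Types (u v w : E) (a : R).

Definition dot u v : R := \sum_k u ord0 k * v ord0 k.

Lemma dotC u v : dot u v = dot v u.
Proof. by apply: eq_bigr => k _; rewrite mulrC. Qed.

Lemma dotDl u v w : dot (u + v) w = dot u w + dot v w.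
Proof. by rewrite -big_split; apply: eq_bigr => k _; rewrite mxE mulrDl. Qed.

Lemma dotZl a u v : dot (a *: u) v = a * dot u v.
Proof. by rewrite mulr_sumr; apply: eq_bigr => k _; rewrite mxE mulrA. Qed.

Lemma dotNl u v : dot (- u) v = - dot u v.
Proof. by rewrite -scaleN1r dotZl mulN1r. Qed.

Lemma dotDr u v w : dot u (v + w) = dot u v + dot u w.
Proof. by rewrite dotC dotDl !(dotC u). Qed.

Lemma dotZr a u v : dot u (a *: v) = a * dot u v.
Proof. by rewrite dotC dotZl dotC. Qed.

Lemma dotNr u v : dot u (- v) = - dot u v.
Proof. by rewrite dotC dotNl dotC. Qed.

Lemma dot0l u : dot 0 u = 0.
Proof. by rewrite -(scale0r u) dotZl mul0r. Qed.

Lemma dot_suml I (r : seq I) (P : pred I) (F : I -> E) v :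
  dot (\sum_(i <- r | P i) F i) v = \sum_(i <- r | P i) dot (F i) v.
Proof.
by apply: (big_morph (dot^~ v)) => [x y|]; rewrite ?dotDl ?dot0l.
Qed.

Lemma dot_delta u k : dot u (delta_mx ord0 k) = u ord0 k.
Proof.
rewrite /dot (bigD1 k)//= big1 ?addr0 => [|j jk]; rewrite mxE eqxx/=.
  by rewrite eqxx mulr1.
by rewrite (negbTE jk) mulr0.
Qed.

Lemma dot_ge0 u : 0 <= dot u u.
Proof. by apply: sumr_ge0 => k _; rewrite -expr2 sqr_ge0. Qed.

Lemma sqr_enorm u : enorm u ^+ 2 = dot u u.
Proof.
rewrite /enorm sqr_sqrtr; first by apply: eq_bigr => k _; rewrite expr2.
by apply: sumr_ge0 => k _; rewrite sqr_ge0.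
Qed.

Lemma enorm_ge0 u : 0 <= enorm u. Proof. exact: sqrtr_ge0. Qed.

Lemma enorm_le u a : 0 <= a -> (enorm u <= a) = (dot u u <= a ^+ 2).
Proof. by move=> a0; rewrite -sqr_enorm ler_pXn2r// nnegrE enorm_ge0. Qed.

Lemma dot_eq0 u : dot u u = 0 -> u = 0.
Proof.
move=> /eqP; rewrite psumr_eq0 => [/allP u0|k _]; last by rewrite -expr2 sqr_ge0.
apply/rowP => k; have := u0 k (mem_index_enum _).
by rewrite mulf_eq0 orbb mxE => /eqP.
Qed.

Lemma enorm_eq0 u : enorm u = 0 -> u = 0.
Proof. by move=> u0; apply: dot_eq0; rewrite -sqr_enorm u0 expr0n. Qed.

Lemma enorm0 : enorm (0 : E) = 0.
Proof. by apply/eqP; rewrite -sqrf_eq0 sqr_enorm dot0l. Qed.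

Lemma enormZ a u : enorm (a *: u) = `|a| * enorm u.
Proof.
apply/eqP; rewrite -(@eqrXn2 _ 2)// ?enorm_ge0 ?mulr_ge0 ?enorm_ge0//.
by rewrite exprMn !sqr_enorm dotZl dotZr mulrA real_normK ?num_real.
Qed.

Lemma enormN u : enorm (- u) = enorm u.
Proof. by rewrite -scaleN1r enormZ normrN1 mul1r. Qed.

Lemma enormB u v : enorm (u - v) = enorm (v - u).
Proof. by rewrite -enormN opprB. Qed.

Lemma dot_le_enorm u v : dot u v <= enorm u * enorm v.
Proof.
have := enorm_ge0 u; rewrite le_eqVlt => /orP[/eqP/esym/enorm_eq0 ->|u0].
  by rewrite dot0l enorm0 mul0r.
have := enorm_ge0 v; rewrite le_eqVlt => /orP[/eqP/esym/enorm_eq0 ->|v0].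
  by rewrite dotC dot0l enorm0 mulr0.
have := dot_ge0 (enorm v *: u - enorm u *: v).
rewrite dotDl !dotDr !dotNl !dotNr !dotZl !dotZr -!sqr_enorm (dotC v u).
have := mulr_gt0 u0 v0; nra.
Qed.

Lemma normr_dot_le u v : `|dot u v| <= enorm u * enorm v.
Proof.
rewrite ler_norml dot_le_enorm andbT lerNl -dotNl -(enormN u).
exact: dot_le_enorm.
Qed.

Lemma ler_enormD u v : enorm (u + v) <= enorm u + enorm v.
Proof.
rewrite enorm_le ?addr_ge0 ?enorm_ge0//.
rewrite dotDl !dotDr -!sqr_enorm (dotC v u).
have := dot_le_enorm u v; lra.
Qed.

Lemma ler_enorm_sum I (r : seq I) (P : pred I) (F : I -> E) :
  enorm (\sum_(i <- r | P i) F i) <= \sum_(i <- r | P i) enorm (F i).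
Proof.
elim/big_ind2 : _ => [|x a y b xa yb|//]; first by rewrite enorm0.
exact: le_trans (ler_enormD _ _) (lerD xa yb).
Qed.

Lemma coord_le_enorm u k : `|u ord0 k| <= enorm u.
Proof.
rewrite -sqrtr_sqr ler_sqrt ?sqr_ge0//; last first.
  by apply: sumr_ge0 => j _; rewrite sqr_ge0.
by rewrite (bigD1 k)//= lerDl sumr_ge0// => j _; rewrite sqr_ge0.
Qed.

Lemma enorm_le_sum u : enorm u <= \sum_k `|u ord0 k|.
Proof.
rewrite {1}(row_sum_delta u); apply: (le_trans (ler_enorm_sum _ _ _)).
apply: ler_sum => k _; rewrite enormZ ler_piMr//.
by rewrite enorm_le// dot_delta mxE !eqxx expr1n.
Qed.

Lemma ler_enorm_dist u v w : enorm (u - w) <= enorm (u - v) + enorm (v - w).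
Proof. by apply: le_trans (ler_enormD _ _); rewrite addrA subrK. Qed.

Lemma continuous_enorm : continuous (@enorm R n).
Proof.
suff cS : continuous (fun x : E => \sum_i x ord0 i ^+ 2).
  by move=> x; apply: continuous_comp; [exact: cS|exact: sqrt_continuous].
elim: (index_enum _) => [|i r IH].
  rewrite (_ : (fun _ => _) = cst 0); first exact: cst_continuous.
  by apply/funext => x; rewrite big_nil.
rewrite (_ : (fun _ => _) =
  (fun x : E => x ord0 i * x ord0 i + \sum_(j <- r) x ord0 j ^+ 2)).
  move=> x; have h := @coord_continuous R 1 n ord0 i x.
  exact: (cvgD (cvgM h h) (IH x)).
by apply/funext => x; rewrite big_cons expr2.
Qed.

(** Lipschitz for [enorm]; the norm of the topology on ['rV] is the supremum norm. *)
Definition elip (L : R) (f : E -> R) :=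
  forall u v, `|f u - f v| <= L * enorm (u - v).

Lemma elip_continuous L f : elip L f -> continuous f.
Proof.
move=> fL; suff cf (x : E) : f y @[y --> nbhs x] --> f x by exact: cf.
apply/cvgrPdist_le => /= e e0.
have L1 : 0 < `|L| + 1 by rewrite ltr_wpDl.
have : enorm (y - x) @[y --> nbhs x] --> enorm (x - x).
  apply: (cvg_comp (fun y : E => y - x) (@enorm R n)).
    by apply: cvgB; [exact: cvg_id|exact: cvg_cst].
  exact: continuous_enorm.
rewrite subrr enorm0 => /cvgrPdist_lt /(_ _ (divr_gt0 e0 L1)).
apply: filterS => y; rewrite sub0r normrN ger0_norm ?enorm_ge0// => ye.
apply: le_trans (fL _ _) _; rewrite enormB.
move: ye; rewrite ltr_pdivlMr// => /ltW/(le_trans _); apply.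
rewrite mulrC ler_wpM2l ?enorm_ge0// (le_trans (ler_norm _))// lerDl//.
Qed.

Lemma continuous_measurable_rV (f : E -> R) :
  continuous f -> measurable_fun setT f.
Proof.
move=> cf; apply: (measurability _ (RGenOInfty.measurableE R)) => _ [_ [a ->] <-].
rewrite setTI; apply: sub_sigma_algebra.
by apply: open_comp; [move=> x _; exact: cf|exact: interval_open].
Qed.

Lemma compact_measurable_rV (A : set E) : compact A -> measurable A.
Proof.
move=> /(compact_closed (@norm_hausdorff _ _)) cA.
rewrite -(setCK A); apply: measurableC; apply: sub_sigma_algebra.
exact: closed_openC.
Qed.

End euclidean.

Section extension.
Context d d' (T : measurableType d) (T' : measurableType d') (S : set T).
Hypothesis mS : measurable S.

Lemma setI_mem_set : setT `&` (fun x => x \in S) @^-1` [set true] = S.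
Proof.
by rewrite setTI; apply/seteqP; split=> x /= h; [exact: set_mem|exact: mem_set].
Qed.

Lemma measurable_mem_set : measurable_fun setT (fun x => x \in S).
Proof. by apply: (measurable_fun_bool true); rewrite setI_mem_set. Qed.

Lemma measurable_extend (f : T -> T') (c : T') : measurable_fun S f ->
  measurable_fun setT (fun x => if x \in S then f x else c).
Proof.
move=> mf; apply: measurable_fun_if => //; first exact: measurable_mem_set.
by rewrite setI_mem_set.
Qed.

End extension.

Lemma prob_lty d (T : measurableType d) (R : realType) (P : probability T R) A :
  measurable A -> (P A < +oo)%E.
Proof. by move=> mA; apply: le_lt_trans (probability_le1 _ mA) (ltry 1). Qed.

Section integrable.
Context d (T : measurableType d) (R : realType).
Variable mu : {measure set T -> \bar R}.

Lemma le_bound_integrable (A : set T) (f : T -> R) (B : R) : measurable A ->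
  (mu A < +oo)%E -> measurable_fun A f -> (forall x, A x -> `|f x| <= B) ->
  mu.-integrable A (EFin \o f).
Proof.
move=> mA Aoo mf fB; apply: measurable_bounded_integrable => //.
exists B; split; first exact: num_real.
by move=> a /ltW Ba x Ax; exact: le_trans (fB _ Ax) Ba.
Qed.

Lemma Rintegral_split (A B : set T) (f : T -> R) : measurable A -> measurable B ->
  mu.-integrable A (EFin \o f) ->
  \int[mu]_(x in A) f x = \int[mu]_(x in A `&` B) f x + \int[mu]_(x in A `\` B) f x.
Proof.
move=> mA mB fi; rewrite -{1}(setUIDK A B) Rintegral_setU//.
- exact: measurableI.
- exact: measurableD.
- by rewrite setUIDK.
- by apply/disj_setPS => x [[_ Bx] [_]].
Qed.

Lemma normr_Rintegral_le (A : set T) (f : T -> R) (B c : R) : measurable A ->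
  measurable_fun A f -> (mu A <= c%:E)%E -> 0 <= B ->
  (forall x, A x -> `|f x| <= B) -> `|\int[mu]_(x in A) f x| <= B * c.
Proof.
move=> mA mf Ac B0 fB; have Aoo : (mu A < +oo)%E by apply: le_lt_trans Ac (ltry _).
have iG := le_bound_integrable mA Aoo mf fB.
apply: (le_trans (le_normr_Rintegral mA iG)).
apply: (@le_trans _ _ (\int[mu]_(x in A) B)).
  apply: le_Rintegral => //.
  - exact: (integrable_abse iG).
  - by apply: (@le_bound_integrable _ _ B) => // x _; rewrite ger0_norm.
rewrite Rintegral_cst// ler_wpM2l//.
by rewrite -lee_fin fineK// ge0_fin_numE.
Qed.

Lemma integrableD_EFin (A : set T) (f g : T -> R) : measurable A ->
  mu.-integrable A (EFin \o f) -> mu.-integrable A (EFin \o g) ->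
  mu.-integrable A (EFin \o (fun x => f x + g x)).
Proof. by move=> mA fi gi; exact: (integrableD mA fi gi). Qed.

Lemma integrableZl_EFin (A : set T) (f : T -> R) (c : R) : measurable A ->
  mu.-integrable A (EFin \o f) -> mu.-integrable A (EFin \o (fun x => c * f x)).
Proof. by move=> mA fi; exact: (integrableZl mA c fi). Qed.

Lemma integrable_sum_EFin I (r : seq I) (A : set T) (f : I -> T -> R) :
  measurable A -> (forall i, mu.-integrable A (EFin \o f i)) ->
  mu.-integrable A (EFin \o (fun x => \sum_(i <- r) f i x)).
Proof.
move=> mA fi; elim: r => [|i r IH].
  rewrite (_ : _ \o _ = cst 0%E); first exact: integrable0.
  by apply/funext => x /=; rewrite big_nil.
rewrite (_ : _ \o _ = EFin \o (fun x => f i x + \sum_(j <- r) f j x)).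
  exact: integrableD_EFin.
by apply/funext => x /=; rewrite big_cons.
Qed.

Lemma Rintegral_sum I (r : seq I) (A : set T) (f : I -> T -> R) :
  measurable A -> (forall i, mu.-integrable A (EFin \o f i)) ->
  \int[mu]_(x in A) (\sum_(i <- r) f i x) = \sum_(i <- r) \int[mu]_(x in A) f i x.
Proof.
move=> mA fi; elim: r => [|i r IH].
  rewrite big_nil (_ : (fun _ => _) = cst 0); last first.
    by apply/funext => x; rewrite big_nil.
  by rewrite /Rintegral integral0.
rewrite big_cons -IH -RintegralD//; last exact: integrable_sum_EFin.
by congr Rintegral; apply/funext => x; rewrite big_cons.
Qed.

End integrable.

(** * The dual gap *)

Section dual_gap.
Context (R : realType) (n m : nat).
Local Notation E := 'rV[R]_n.
Variables (lam : 'I_m.+1 -> R) (p : E).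
Implicit Types (x u v : E) (y z : 'I_m -> E) (F : E -> R) (f : 'I_m -> E -> R).
Local Notation l i := (lam (lift ord0 i)).

(** When the weights add up to 1, this is the barycentre minus [p]. *)
Definition bary_sum x y : E :=
  lam ord0 *: (x - p) + \sum_i l i *: (y i - p).

(** With [w = p + bary_sum x y], the sum of squares at [v] is its minimum plus
    [2^-1 |v - w|^2].  In the minimum only the last term couples the marginals. *)
Lemma bary_costE x y : \sum_j lam j = 1 ->
  bary_cost lam (family_of x y) =
  2^-1 * (lam ord0 * dot (x - p) (x - p) +
          \sum_i l i * dot (y i - p) (y i - p)) - 2^-1 * dot (bary_sum x y) (bary_sum x y).
Proof.
move=> lam1; set A := (X in 2^-1 * X - _); set B := dot _ _.
have key w : \sum_i lam i / 2 * enorm (family_of x y i - w) ^+ 2 =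
    2^-1 * A - 2^-1 * B + 2^-1 * dot (bary_sum x y - (w - p)) (bary_sum x y - (w - p)).
  have -> : \sum_i lam i / 2 * enorm (family_of x y i - w) ^+ 2 =
      \sum_i (lam i / 2 * dot (family_of x y i - p) (family_of x y i - p)
        - dot (lam i *: (family_of x y i - p)) (w - p) +
        lam i * (2^-1 * dot (w - p) (w - p))).
    apply: eq_bigr => i _; rewrite sqr_enorm.
    have -> : family_of x y i - w = (family_of x y i - p) - (w - p).
      by rewrite opprB addrA subrK.
    move: (family_of x y i - p) (w - p) => u v.
    rewrite !(dotDl, dotDr, dotNl, dotNr, dotZl) (dotC v u); lra.
  rewrite !big_split/= -mulr_suml lam1 mul1r.
  rewrite sumrN -dot_suml.
  have -> : \sum_i lam i *: (family_of x y i - p) = bary_sum x y.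
    rewrite big_ord_recl /family_of unlift_none; congr (_ + _).
    by apply: eq_bigr => i _; rewrite liftK.
  have -> : \sum_i lam i / 2 * dot (family_of x y i - p) (family_of x y i - p)
      = 2^-1 * A.
    rewrite /A mulrDr [X in _ = _ + X]mulr_sumr big_ord_recl /family_of unlift_none.
    congr (_ + _); first by rewrite [_ / 2]mulrC -mulrA.
    by apply: eq_bigr => i _; rewrite liftK [_ / 2]mulrC -mulrA.
  rewrite /B; move: (bary_sum x y) (w - p) => b v.
  rewrite !(dotDl b, dotDr, dotNl, dotNr, dotDl) (dotC v b); lra.
apply/eqP; rewrite eq_le /bary_cost; apply/andP; split.
  apply: ge_inf.
    exists (2^-1 * A - 2^-1 * B) => _ [w _ <-].
    by rewrite key lerDl mulr_ge0 ?dot_ge0// invr_ge0.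
  exists (p + bary_sum x y) => //.
  by rewrite key [p + _]addrC addrK subrr dot0l mulr0 addr0.
apply: lb_le_inf; first by exists (\sum_i lam i / 2 * enorm (family_of x y i - 0) ^+ 2); exists 0.
by move=> _ [w _ <-]; rewrite key lerDl mulr_ge0 ?dot_ge0// invr_ge0.
Qed.

(** The defect of [F] and [f] in the dual constraint; by [bary_costE] the square
    [2^-1 |b|^2] takes the place of the cost, with the opposite sign. *)
Definition dual_gap F f x y :=
  F x + \sum_i f i (y i) - 2^-1 * dot (bary_sum x y) (bary_sum x y).

Lemma bar_shift x x' y : bary_sum x' y = bary_sum x y + lam ord0 *: (x' - x).
Proof.
rewrite /bary_sum addrAC -scalerDr; congr (_ *: _ + _).
by rewrite [RHS]addrC addrA subrK.
Qed.

(** The function [2^-1 |b x' y|^2] of [x'] is convex with gradient [lam0 b x y]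
    at [x], and [F] plus the potentials stays above it. *)
Lemma gap_first_order F f x x' y : 0 <= dual_gap F f x' y ->
  F x + lam ord0 * dot (bary_sum x y) (x' - x) - dual_gap F f x y <= F x'.
Proof.
rewrite /dual_gap (bar_shift x x'); move: (bary_sum x y) (x' - x) => b v.
rewrite !(dotDl, dotDr, dotZl, dotZr) (dotC v b).
have := mulr_ge0 (sqr_ge0 (lam ord0)) (dot_ge0 v); lra.
Qed.

Definition upd y i v : 'I_m -> E := fun j => if j == i then v else y j.

Lemma sum_upd (V : zmodType) (g : 'I_m -> E -> V) y i v :
  \sum_j g j (upd y i v j) = \sum_j g j (y j) + (g i v - g i (y i)).
Proof.
rewrite (bigD1 i)//= [in RHS](bigD1 i)//= /upd eqxx.
rewrite (eq_bigr (fun j => g j (y j))); last by move=> j /negbTE ->.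
by rewrite [RHS]addrC addrA subrK.
Qed.

Lemma bar_upd x y i v : bary_sum x (upd y i v) = bary_sum x y + l i *: (v - y i).
Proof.
rewrite /bary_sum (sum_upd (fun j u => l j *: (u - p))) addrA; congr (_ + _).
by rewrite -scalerBr opprB addrA subrK.
Qed.

(** The exchange of the [i]-th entries of [y] and [z] keeps the sum of the
    potentials and moves the two barycentres by [-+ l_i v], where [v = y_i - z_i].
    Nonnegative gaps after the exchange give
    [l_i^2 |v|^2 <= <l_i v, b x y - b x z> + gaps]; Young's inequality concludes. *)
Lemma gap_swap F f x y z i :
  0 <= dual_gap F f x (upd y i (z i)) -> 0 <= dual_gap F f x (upd z i (y i)) ->
  l i ^+ 2 * dot (y i - z i) (y i - z i) <=
  dot (bary_sum x y - bary_sum x z) (bary_sum x y - bary_sum x z) + 2 * (dual_gap F f x y + dual_gap F f x z).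
Proof.
rewrite /dual_gap !sum_upd !bar_upd -(opprB (y i)) scalerN.
move: (bary_sum x y) (bary_sum x z) (y i - z i) => b c v.
have := dot_ge0 (b - c - l i *: v).
rewrite !(dotDl, dotDr, dotNl, dotNr, dotZl, dotZr).
rewrite (dotC c b) (dotC v b) (dotC v c); lra.
Qed.

Definition feasible (Y : set E) F f :=
  forall x y, (forall i, Y (y i)) -> 0 <= dual_gap F f x y.

Lemma upd_in (Y : set E) y z i : (forall i, Y (y i)) -> (forall i, Y (z i)) ->
  forall j, Y (upd y i (z i) j).
Proof. by move=> Yy Yz j; rewrite /upd; case: eqP. Qed.

Definition sdiff F (t : R) (k : 'I_n) x :=
  F (x + t *: delta_mx ord0 k) + F (x - t *: delta_mx ord0 k) - 2 * F x.

(** Apply [gap_first_order] with [y] at one of the points [x + t e_k], [x - t e_k]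
    and with [z] at the other, the choice depending on the sign of the coordinate. *)
Lemma gap_sdiff Y F f x y z t k : feasible Y F f ->
  (forall i, Y (y i)) -> (forall i, Y (z i)) ->
  lam ord0 * t * `|(bary_sum x y - bary_sum x z) ord0 k| <=
  sdiff F t k x + dual_gap F f x y + dual_gap F f x z.
Proof.
move=> fe Yy Yz; set e : E := delta_mx ord0 k.
have H s w (Yw : forall i, Y (w i)) :
    F x + lam ord0 * (s * (bary_sum x w) ord0 k) - dual_gap F f x w <= F (x + s *: e).
  have := @gap_first_order F f x (x + s *: e) w (fe _ _ Yw).
  by rewrite [x + s *: e]addrC addrK dotZr dot_delta.
have := H t y Yy; have := H t z Yz; have := H (- t) y Yy; have := H (- t) z Yz.
rewrite /sdiff -/e scaleNr; move: (bary_sum x y) (bary_sum x z) => b c; rewrite !mxE.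
by case: (ger0P (b ord0 k - c ord0 k)) => _; lra.
Qed.

(** A form of convexity: where almost zero gaps are available, [F] is a supremum
    of convex functions. *)
Lemma sdiff_ge0 Y F f x t k : feasible Y F f ->
  (forall e, 0 < e -> exists2 y, (forall i, Y (y i)) & dual_gap F f x y <= e) ->
  0 <= sdiff F t k x.
Proof.
move=> fe ha; apply/ler_addgt0Pl => e e0.
have [y Yy ge] : exists2 y, (forall i, Y (y i)) & dual_gap F f x y <= e / 2.
  by apply: ha; rewrite divr_gt0.
have := gap_sdiff x t k fe Yy Yy.
rewrite subrr mxE normr0 mulr0; lra.
Qed.

End dual_gap.

(** * The conjugate of a family of potentials *)

(** [p] is the origin from which barycentres are measured, and [D] the scale of the
    problem: it bounds the source set [S] as well in what follows. *)
Record bary_setting (R : realType) (n m : nat) (lam : 'I_m.+1 -> R) (p : 'rV[R]_n)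
  (D : R) (Y : set 'rV[R]_n) : Prop := BarySetting {
  bs_gt0 : forall i, 0 < lam i;
  bs_sum : \sum_i lam i = 1;
  bs_D : 0 <= D;
  bs_Y : forall v, Y v -> enorm (v - p) <= D;
  bs_neq0 : Y !=set0 }.

Section conj.
Context (R : realType) (n m : nat).
Local Notation E := 'rV[R]_n.
Variables (lam : 'I_m.+1 -> R) (p : E) (D : R) (Y : set E).
Hypothesis bs : bary_setting lam p D Y.
Let lam_gt0 := bs_gt0 bs.
Let lam_sum := bs_sum bs.
Let D_ge0 := bs_D bs.
Let YD := bs_Y bs.
Let Y_neq0 := bs_neq0 bs.
Implicit Types (x u v : E) (y : 'I_m -> E) (f : 'I_m -> E -> R).
Local Notation l i := (lam (lift ord0 i)).
Local Notation bar := (bary_sum lam p).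
Local Notation gap := (dual_gap lam p).

Lemma lam0_le1 : lam ord0 <= 1.
Proof.
by rewrite -lam_sum (bigD1 ord0)//= lerDl sumr_ge0// => i _; exact: ltW.
Qed.

Lemma suml : \sum_i l i = 1 - lam ord0.
Proof. by rewrite -lam_sum big_ord_recl addrAC subrr add0r. Qed.

Lemma suml_le (a : 'I_m -> R) (c : R) : (forall i, a i <= c) -> 0 <= c ->
  \sum_i l i * a i <= c.
Proof.
move=> ac c0; apply: (@le_trans _ _ (\sum_i l i * c)).
  by apply: ler_sum => i _; rewrite ler_wpM2l// ltW.
by rewrite -mulr_suml suml ler_piMl// lerBlDr lerDl ltW.
Qed.

Lemma enorm_bar x y : (forall i, Y (y i)) -> enorm (bar x y) <= enorm (x - p) + D.
Proof.
move=> Yy; apply: (le_trans (ler_enormD _ _)); apply: lerD.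
  by rewrite enormZ gtr0_norm// ler_piMl ?enorm_ge0// lam0_le1.
apply: (le_trans (ler_enorm_sum _ _ _)).
under eq_bigr do rewrite enormZ gtr0_norm//.
by apply: suml_le => // i; exact: YD.
Qed.

(** The least [F] for which the gap is nonnegative. *)
Definition pconj f x : R :=
  sup [set 2^-1 * dot (bar x y) (bar x y) - \sum_i f i (y i)
      | y in [set y | forall i, Y (y i)]].

Definition bounded_on f (B : R) := forall i v, Y v -> `|f i v| <= B.

Section bounded.
Variables (f : 'I_m -> E -> R) (B : R).
Hypothesis fB : bounded_on f B.

Lemma sum_bounded y : (forall i, Y (y i)) -> `|\sum_i f i (y i)| <= m%:R * B.
Proof.
move=> Yy; apply: (le_trans (ler_norm_sum _ _ _)).
apply: (@le_trans _ _ (\sum_(i < m) B)); first by apply: ler_sum => i _; exact: fB.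
by rewrite sumr_const card_ord mulr_natl.
Qed.

Lemma pconj_has_sup x : has_sup
  [set 2^-1 * dot (bar x y) (bar x y) - \sum_i f i (y i)
      | y in [set y | forall i, Y (y i)]].
Proof.
have [v Yv] := Y_neq0; split.
  by exists (2^-1 * dot (bar x (fun=> v)) (bar x (fun=> v)) - \sum_i f i v);
    exists (fun=> v).
exists (2^-1 * (enorm (x - p) + D) ^+ 2 + m%:R * B) => _ [y Yy <-].
apply: lerD; last by rewrite lerNl; move: (sum_bounded Yy); rewrite ler_norml => /andP[].
rewrite ler_pM2l ?invr_gt0// -sqr_enorm ler_pXn2r ?nnegrE ?enorm_ge0//.
  exact: enorm_bar.
by rewrite addr_ge0 ?enorm_ge0.
Qed.

Lemma pconj_feasible : feasible lam p Y (pconj f) f.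
Proof.
move=> x y Yy; rewrite /dual_gap subr_ge0 -lerBlDr.
by apply: sup_upper_bound; [exact: pconj_has_sup|exists y].
Qed.

Lemma pconj_near x e : 0 < e ->
  exists2 y, (forall i, Y (y i)) & gap (pconj f) f x y <= e.
Proof.
move=> e0; have [_ [y Yy <-] h] := sup_adherent e0 (pconj_has_sup x).
exists y => //; rewrite /dual_gap; move: h; rewrite -/(pconj f x); lra.
Qed.

Lemma pconj_le x a :
  (forall y, (forall i, Y (y i)) ->
     2^-1 * dot (bar x y) (bar x y) - \sum_i f i (y i) <= a) -> pconj f x <= a.
Proof.
move=> h; apply: ge_sup; first by case: (pconj_has_sup x).
by move=> _ [y Yy <-]; exact: h.
Qed.

(** By [gap_first_order], the slopes of [pconj f] are bounded by the norms of the
    barycentres, whatever the potentials. *)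
Lemma pconj_lip r x x' : enorm (x - p) <= r -> enorm (x' - p) <= r ->
  `|pconj f x - pconj f x'| <= (r + D) * enorm (x - x').
Proof.
suff H u v : enorm (u - p) <= r ->
    pconj f u - pconj f v <= (r + D) * enorm (u - v).
  by move=> xr xr'; rewrite ler_norml H// lerNl opprB enormB H.
move=> ur; apply/ler_addgt0Pl => e e0.
have [y Yy ge] := pconj_near u e0.
have := gap_first_order u (pconj_feasible v Yy).
have hd := dot_le_enorm (bar u y) (u - v).
have b1 := le_trans (enorm_bar u Yy) (lerD ur (lexx D)).
have b2 : lam ord0 * dot (bar u y) (u - v) <= (r + D) * enorm (u - v).
  apply: (@le_trans _ _ (lam ord0 * ((r + D) * enorm (u - v)))).
    apply: ler_wpM2l; first exact: ltW.
    apply: (le_trans hd); by rewrite ler_wpM2r// enorm_ge0.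
  rewrite ler_piMl ?lam0_le1// mulr_ge0 ?enorm_ge0//.
  by rewrite addr_ge0// (le_trans (enorm_ge0 _) ur).
by rewrite -(opprB u v) dotNr; lra.
Qed.

Lemma pconj_bounded x : enorm (x - p) <= D ->
  `|pconj f x| <= 2 * D ^+ 2 + m%:R * B.
Proof.
move=> xD; rewrite ler_norml; apply/andP; split.
  have [v Yv] := Y_neq0; have Yy (i : 'I_m) : Y ((fun=> v) i) by [].
  have := pconj_feasible x Yy; rewrite /dual_gap.
  have := dot_ge0 (bar x (fun=> v)); have := sum_bounded Yy.
  rewrite ler_norml => /andP[h1 h2]; have := sqr_ge0 D; lra.
apply: pconj_le => y Yy; have := sum_bounded Yy.
rewrite ler_norml => /andP[h1 h2].
have : dot (bar x y) (bar x y) <= (D + D) ^+ 2.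
  rewrite -enorm_le ?addr_ge0//; apply: (le_trans (enorm_bar x Yy)).
  by rewrite lerD2r.
rewrite -mulr2n exprMn_n; lra.
Qed.

Lemma pconj_continuous : continuous (pconj f).
Proof.
suff cf (x : E) : pconj f y @[y --> nbhs x] --> pconj f x by exact: cf.
set r := enorm (x - p) + 1.
have r0 : 0 <= r + D by rewrite !addr_ge0 ?enorm_ge0.
have cx : enorm (y - x) @[y --> nbhs x] --> (0 : R).
  rewrite -(@enorm0 R n) -(subrr x); apply: (cvg_comp (fun y : E => y - x) (@enorm R n)).
    by apply: cvgB; [exact: cvg_id|exact: cvg_cst].
  exact: continuous_enorm.
have cx' : (r + D) * enorm (y - x) @[y --> nbhs x] --> (0 : R).
  by rewrite -(mulr0 (r + D)); apply: cvgMr.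
apply/cvgrPdist_le => /= e e0.
move/cvgrPdist_lt : cx => /(_ _ ltr01); move/cvgrPdist_le : cx' => /(_ _ e0).
apply: filterS2 => y; rewrite !sub0r !normrN => y1 y2.
rewrite (ger0_norm (enorm_ge0 _)) in y2; rewrite ger0_norm in y1; last first.
  by rewrite mulr_ge0 ?enorm_ge0.
rewrite enormB in y1; apply: le_trans y1; apply: pconj_lip; first by rewrite lerDl.
by apply: (le_trans (ler_enorm_dist _ x _)); rewrite addrC lerD2l; exact: ltW.
Qed.

End bounded.

Lemma pconj_mono f g c : (exists B, bounded_on f B) -> (exists B, bounded_on g B) ->
  (forall y, (forall i, Y (y i)) -> \sum_i f i (y i) <= \sum_i g i (y i) + c) ->
  forall x, pconj g x <= pconj f x + c.
Proof.
move=> [B fB] [B' gB] fg x; apply: (pconj_le gB) => y Yy.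
have := pconj_feasible fB x Yy; rewrite /dual_gap; have := fg _ Yy; lra.
Qed.

End conj.

(** * Translation invariance of the Lebesgue measure *)

Section translation.
Context (R : realType).

Lemma lebesgue_translate (a : R) (A : set R) : measurable A ->
  lebesgue_measure ((fun x => x + a) @^-1` A) = lebesgue_measure A.
Proof.
move=> mA; have mt : measurable_fun setT
      ((fun x => x + a) : measurableTypeR R -> measurableTypeR R).
  exact: measurable_funD.
pose mu := measure_function_pushforward__canonical__measure_function_Measure
  (@lebesgue_measure R) mt.
rewrite [RHS](@lebesgue_measure_unique R mu)// => _ [[u v] _ <-].
rewrite /mu/= /pushforward.
have -> : (fun x : R => x + a) @^-1` `]u, v] = `]u - a, v - a]%classic.
  by apply/seteqP; split=> x /=; rewrite !in_itv/= ltrBlDr lerBrDr.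
by rewrite !lebesgue_measure_itv/= !lte_fin ltrD2r -!EFinB opprB addrA subrK.
Qed.

Lemma measurable_translate n (v : 'rV[R]_n) :
  measurable_fun setT (fun x : 'rV[R]_n => x + v).
Proof.
apply: measurable_rV => i.
under eq_fun do rewrite mxE.
by apply: measurable_funD => //; exact: measurable_coord.
Qed.

Lemma cons_rVD n (a b : R) (x y : 'rV[R]_n) :
  cons_rV (a, x) + cons_rV (b, y) = cons_rV (a + b, x + y).
Proof.
apply/rowP => i; rewrite /cons_rV mxE; case: (@split_ordP 1 n i) => j ->.
  by rewrite !(@row_mxEl _ 1 1 n) [j]ord1 !mxE eqxx !mulr1n.
by rewrite !(@row_mxEr _ 1 1 n) !mxE.
Qed.

(** The measure in dimension [n.+1] is a product, determined by its values on
    rectangles, and a translation acts on the two factors separately. *)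
Lemma lebesgue_rV_translate n (v : 'rV[R]_n) (A : set 'rV[R]_n) : measurable A ->
  lebesgue_rV R n ((fun x => x + v) @^-1` A) = lebesgue_rV R n A.
Proof.
elim: n v A => [|n IH] v A mA.
  by congr (lebesgue_rV R 0 _); apply/seteqP; split=> x /=; rewrite (thinmx0 v) addr0.
pose v0 := (uncons_rV v).1; pose v' := (uncons_rV v).2.
pose tr (q : R * 'rV[R]_n) := (q.1 + v0, q.2 + v').
have mt : measurable_fun setT (tr : measurableTypeR R * 'rV[R]_n -> measurableTypeR R * 'rV[R]_n).
  apply/measurable_fun_pairP; split => /=.
    by apply: measurable_funD => //; exact: measurable_fst.
  exact: measurableT_comp (measurable_translate _) measurable_snd.
rewrite /= /lebesgue_cons /pushforward.
have -> : (@cons_rV R n) @^-1` ((fun x => x + v) @^-1` A) =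
    tr @^-1` (@cons_rV R n @^-1` A).
  by apply/seteqP; split=> -[a x] /=;
    rewrite -[in cons_rV (a, x) + v](uncons_rVK v) cons_rVD.
have mC : measurable (@cons_rV R n @^-1` A).
  by rewrite -[X in measurable X]setTI; exact: measurable_cons_rV.
pose mu := measure_function_pushforward__canonical__measure_function_Measure
  (@lebesgue_measure R \x lebesgue_rV R n)%E mt.
rewrite [RHS](@product_measure_unique _ _ _ _ R _ _ mu)// => B C mB mC'.
rewrite /mu/= /pushforward.
have -> : tr @^-1` (B `*` C) = ((fun x => x + v0) @^-1` B) `*` ((fun x => x + v') @^-1` C) by [].
rewrite product_measure1E//.
- by congr (_ * _)%E; [exact: lebesgue_translate|exact: IH].
- rewrite -[X in measurable X]setTI.
  exact: (@measurable_funD _ _ _ _ id (cst v0)).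
- by rewrite -[X in measurable X]setTI; apply: measurable_translate.
Qed.

End translation.

(** * Second differences over a cube *)

Section second_difference.
Context (R : realType) (n : nat).
Local Notation E := 'rV[R]_n.
Local Notation L := (lebesgue_rV R n).
Variables (p : E) (r : R) (k : 'I_n).
Hypothesis r_ge0 : 0 <= r.
Local Notation e := (delta_mx ord0 k : E).

Definition cube : set E :=
  [set x | forall i, `[p ord0 i - r, p ord0 i + r]%classic (x ord0 i)].

Definition slab (c t : R) : set E :=
  [set x | forall i, (if i == k then `[c, c + t]
    else `[p ord0 i - r, p ord0 i + r])%classic (x ord0 i)].

Lemma measurable_box (A : 'I_n -> set R) : (forall i, measurable (A i)) ->
  measurable [set x : E | forall i, A i (x ord0 i)].
Proof.
move=> mA; rewrite (_ : mkset _ = \bigcap_(i : 'I_n)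
    (fun x : 'rV[R]_n => x ord0 i) @^-1` A i).
  apply: fin_bigcap_measurable => // i _; rewrite -[X in measurable X]setTI.
  exact: measurable_coord.
by apply/seteqP; split=> [x xA i _|x xA i]; [exact: xA|exact: xA i I].
Qed.

Lemma measurable_cube : measurable cube.
Proof.
exact: (@measurable_box (fun i => `[p ord0 i - r, p ord0 i + r]%classic)).
Qed.

Lemma measurable_slab c t : measurable (slab c t).
Proof.
apply: (@measurable_box (fun i => if i == k then `[c, c + t]%classic
  else `[p ord0 i - r, p ord0 i + r]%classic)) => i.
by case: ifP.
Qed.

Lemma lebesgue_slab c t : 0 <= t -> L (slab c t) = (t * (2 * r) ^+ n.-1)%:E.
Proof.
move=> t0; rewrite (@lebesgue_rV_box _ _ (fun i => if i == k then `[c, c + t]%classic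
  else `[p ord0 i - r, p ord0 i + r]%classic)); last by move=> i; case: ifP.
have itvE (a s : R) : 0 <= s -> lebesgue_measure `[a, a + s]%classic = s%:E.
  move=> s0; rewrite lebesgue_measure_itv/= lte_fin ltrDl.
  case: ltP => [_|s0']; first by rewrite -EFinB addrAC subrr add0r.
  by congr EFin; apply/eqP; rewrite eq_le s0 s0'.
rewrite (bigD1 k)//= eqxx itvE// (eq_bigr (fun=> (2 * r)%:E)); last first.
  move=> i /negbTE ->; rewrite -[p ord0 i + r](subrK (p ord0 i - r)).
  rewrite [X in `[_, X]](_ : _ = p ord0 i - r + 2 * r); last lra.
  by rewrite itvE ?mulr_ge0.
rewrite prodEFin -EFinM prodr_const; congr (_ * _ ^+ _)%:E.
by rewrite cardC1 card_ord.
Qed.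

Lemma lebesgue_cube_lty : (L cube < +oo)%E.
Proof.
have -> : cube = slab (p ord0 k - r) (2 * r).
  apply/seteqP; split=> x xQ i; have := xQ i; case: eqP => [->|]//=;
  by rewrite !in_itv/= (_ : p ord0 k - r + 2 * r = p ord0 k + r)//; lra.
by rewrite lebesgue_slab ?mulr_ge0// ltry.
Qed.

Variables (F : E -> R) (t K : R).
Hypothesis mF : measurable_fun setT F.
Hypothesis t_ge0 : 0 <= t.
Hypothesis K_ge0 : 0 <= K.
Hypothesis FK1 : forall x, cube x -> `|F (x + t *: e) - F x| <= K * t.
Hypothesis FK2 : forall x, cube x -> `|F x - F (x - t *: e)| <= K * t.

Let G x := F (x + t *: e) - F x.
Let Q' := (fun x => x + t *: e) @^-1` cube.

Let mQ' : measurable Q'.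
Proof.
by rewrite -[X in measurable X]setTI; apply: measurable_translate => //;
  exact: measurable_cube.
Qed.

Let mG : measurable_fun setT G.
Proof.
apply: measurable_funB => //; apply: measurableT_comp => //.
exact: measurable_translate.
Qed.

Let GK A : A `<=` cube \/ A `<=` Q' -> forall x, A x -> `|G x| <= K * t.
Proof.
move=> [] sA x Ax; first by apply: FK1; exact: sA.
by have := FK2 (sA _ Ax); rewrite addrK.
Qed.

Let Goo A : measurable A -> A `<=` cube \/ A `<=` Q' ->
  L.-integrable A (EFin \o G).
Proof.
move=> mA sA; apply: (@le_bound_integrable _ _ _ _ _ _ (K * t)) => //.
- apply: le_lt_trans lebesgue_cube_lty; case: sA => sA.
    by apply: le_measure => //; rewrite inE//; exact: measurable_cube.
  rewrite -(lebesgue_rV_translate (t *: e) measurable_cube).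
  by apply: le_measure => //; rewrite inE.
- exact: measurable_funTS.
- exact: GK.
Qed.

Let Gle A c : measurable A -> A `<=` cube \/ A `<=` Q' -> A `<=` slab c t ->
  `|\int[L]_(x in A) G x| <= K * t * (t * (2 * r) ^+ n.-1).
Proof.
move=> mA sA sl; apply: normr_Rintegral_le => //.
- exact: measurable_funTS.
- rewrite -(lebesgue_slab c t_ge0); apply: le_measure => //; rewrite inE//.
  exact: measurable_slab.
- exact: mulr_ge0.
- exact: GK.
Qed.

(** With [G x = F (x + t e) - F x], the second difference is [G x - G (x - t e)].
    By translation invariance the two integrals cancel except over two slabs of
    thickness [t] along the faces of the cube, where [|G| <= K t]. *)
Lemma integral_sdiff_le :
  (\int[L]_(x in cube) (sdiff F t k x)%:E <=
   (2 * K * t ^+ 2 * (2 * r) ^+ n.-1)%:E)%E.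
Proof.
have mQ := measurable_cube.
have iGQ : L.-integrable cube (EFin \o G) by apply: Goo => //; left.
have iGQ' : L.-integrable Q' (EFin \o G) by apply: Goo => //; right.
pose tau (x : E) := x - t *: e.
have mtau : measurable_fun setT tau by exact: measurable_translate.
have tauQ : tau @^-1` Q' = cube.
  by apply/seteqP; split=> x; rewrite /tau /Q' /= subrK.
pose Lt := measure_function_pushforward__canonical__measure_function_Measure L mtau.
have iGt : L.-integrable cube (EFin \o (G \o tau)).
  apply: (@le_bound_integrable _ _ _ _ _ _ (K * t)) => //.
  - exact: lebesgue_cube_lty.
  - by apply: measurable_funTS; exact: measurableT_comp.
  - by move=> x /FK2; rewrite /G /tau /= subrK.
have I2 : \int[L]_(x in cube) G (tau x) = \int[L]_(x in Q') G x.
  rewrite /Rintegral -{1}tauQ -(integral_pushforward mtau (f := EFin \o G))//.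
  - apply/congr1/eq_measure_integral => A mA AQ'.
    exact: lebesgue_rV_translate.
  - exact/measurable_EFinP.
  - by rewrite tauQ.
have sE x : sdiff F t k x = G x - G (tau x).
  by rewrite /sdiff /G /tau subrK; lra.
have isd : L.-integrable cube (EFin \o (fun x => G x - G (tau x))).
  by have := integrableB mQ iGQ iGt; apply: eq_integrable.
under eq_integral do rewrite sE.
rewrite -[leLHS]fineK; last exact: integrable_fin_num.
rewrite lee_fin -/(Rintegral _ _ _) RintegralB// I2.
rewrite (Rintegral_split mQ mQ' iGQ) (Rintegral_split mQ' mQ iGQ') setIC.
have h1 : `|\int[L]_(x in cube `\` Q') G x| <= K * t * (t * (2 * r) ^+ n.-1).
  apply: (@Gle _ (p ord0 k + r - t)); [exact: measurableD|by left => x []|].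
  move=> x [xQ nxQ'] i; have := xQ i; case: eqP => //= ->; rewrite !in_itv/= => /andP[h1 h2].
  apply/andP; split; last by rewrite subrK.
  rewrite leNgt; apply/negP => h; apply: nxQ' => j; have /= := xQ j.
  rewrite !in_itv/= !mxE eqxx/=; have [->|jk] := eqVneq j k; last by rewrite mulr0 addr0.
  move=> _; rewrite mulr1; apply/andP; split; first exact: ler_wpDr.
  by rewrite -lerBrDr ltW.
have h2 : `|\int[L]_(x in Q' `\` cube) G x| <= K * t * (t * (2 * r) ^+ n.-1).
  apply: (@Gle _ (p ord0 k - r - t)); [exact: measurableD|by right => x []|].
  move=> x [xQ nxQ] i; have := xQ i; rewrite /= !mxE eqxx/=.
  case: eqP => [->|_]; last by rewrite mulr0 addr0.
  rewrite /= mulr1 !in_itv/= => /andP[a1 a2].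
  apply/andP; split; first by lra.
  rewrite subrK leNgt; apply/negP => h; apply: nxQ => j; have /= := xQ j.
  rewrite !in_itv/= !mxE eqxx/=; have [->|jk] := eqVneq j k; last by rewrite mulr0 addr0.
  move=> _; apply/andP; split; first exact: ltW.
  by apply: le_trans a2; rewrite lerDl.
move: h1 h2; rewrite !ler_norml => /andP[_ h1] /andP[h2 _].
rewrite expr2; lra.
Qed.

End second_difference.

(** * Measures of bounded density *)

Section density.
Context (R : realType) (n : nat).
Local Notation E := 'rV[R]_n.
Local Notation L := (lebesgue_rV R n).
Variables (rho : probability E R) (M : R).

Lemma Linf_norm_le A : rho `<< L -> Linf_norm rho = M%:E -> measurable A ->
  (rho A <= M%:E * L A)%E.
Proof.
move=> rL LM mA.
(* over a space of measure zero the norm would be zero by convention *)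
have L0 : (0 < L setT)%E.
  rewrite lt0e measure_ge0 andbT; apply/eqP => L0.
  have : rho setT = 0%E.
    apply: (measure0_null_setP rho measurableT).1.
    exact: rL _ ((measure0_null_setP L measurableT).2 L0).
  by rewrite probability_setT => /eqP; rewrite onee_eq0.
rewrite /Linf_norm unlock L0 in LM.
have rL' : charge_of_finite_measure rho `<< L by [].
have -> : rho A = charge_of_finite_measure rho A by [].
rewrite (Radon_Nikodym_integral rL' mA).
have iRN := Radon_Nikodym_integrable rL'.
have M0 : (0 <= M%:E)%E.
  rewrite -LM; apply: ess_sup_gee => //.
  by apply: aeW => x /=; rewrite abse_ge0.
have iA : L.-integrable A (Radon_Nikodym (charge_of_finite_measure rho) L).
  exact: integrableS iRN.
apply: (le_trans (lee_abs _)); apply: (le_trans (le_abse_integral _ _ _)) => //.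
  exact: measurable_int iA.
rewrite -integral_cst//; apply: ae_ge0_le_integral => //.
- by apply: measurableT_comp => //; exact: measurable_int iA.
- have := ess_sup_ge L (abse \o Radon_Nikodym (charge_of_finite_measure rho) L).
  by rewrite LM; apply: filterS => x /= h _.
Qed.

Hypothesis rhoM : forall A, measurable A -> (rho A <= M%:E * L A)%E.
Hypothesis M_ge0 : 0 <= M.

(** The positive part [h] of [g] extends the integrand from [Q] to a nonnegative
    function on the whole space, to which the domination of measures applies. *)
Lemma integral_density_le (S Q : set E) (g : E -> R) : measurable S ->
  measurable Q -> S `<=` Q -> measurable_fun setT g ->
  (forall x, Q x -> 0 <= g x) ->
  (\int[rho]_(x in S) (g x)%:E <= M%:E * \int[L]_(x in Q) (g x)%:E)%E.
Proof.
move=> mS mQ SQ mg g0.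
pose h x := (Num.max (g x) 0)%:E.
have mh : measurable_fun setT h.
  by apply/measurable_EFinP; apply: measurable_maxr => //; exact: measurable_cst.
have h0 x : (0 <= h x)%E by rewrite lee_fin le_max lexx orbT.
have gh x : Q x -> (g x)%:E = h x by move=> Qx; rewrite /h max_l// g0.
rewrite (@eq_integral _ _ _ rho S h); last first.
  by move=> x; rewrite inE => /SQ/gh.
rewrite (@eq_integral _ _ _ L Q h); last by move=> x; rewrite inE => /gh.
pose k : {nonneg R} := NngNum M_ge0.
have ->: (M%:E * \int[L]_(x in Q) h x = \int[mscale k L]_(x in Q) h x)%E.
  by rewrite ge0_integral_mscale//; exact: measurable_funTS.
apply: (@le_trans _ _ (\int[mscale k L]_(x in S) h x)%E).
  by apply: ge0_le_measure_integral.
by apply: ge0_subset_integral => //; exact: measurable_funTS.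
Qed.

End density.

(** * The stability estimate in terms of gaps *)

Section measurable_dot.
Context d (T : measurableType d) (R : realType) (n : nat) (S : set T).

Lemma measurable_coord_comp (u : T -> 'rV[R]_n) (k : 'I_n) : measurable_fun S u ->
  measurable_fun S (fun x => u x ord0 k).
Proof. by move=> mu; exact: measurableT_comp (measurable_coord k) mu. Qed.

Lemma measurable_dot (u v : T -> 'rV[R]_n) :
  measurable_fun S u -> measurable_fun S v -> measurable_fun S (fun x => dot (u x) (v x)).
Proof.
move=> mu mv; apply: measurable_sum => k.
by apply: measurable_funM; exact: measurable_coord_comp.
Qed.

Lemma measurable_rV_on (u : T -> 'rV[R]_n) : measurable S ->
  (forall k, measurable_fun S (fun x => u x ord0 k)) -> measurable_fun S u.
Proof.
move=> mS mu; pose v x := if x \in S then u x else 0.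
have mv : measurable_fun setT v.
  apply: measurable_rV => k.
  rewrite (_ : (fun _ => _) = (fun x => if x \in S then u x ord0 k else 0)).
    exact: measurable_extend.
  by apply/funext => x; rewrite /v; case: ifP => // _; rewrite mxE.
by apply: (eq_measurable_fun v); [move=> x xS; rewrite /v xS|exact: measurable_funTS].
Qed.

End measurable_dot.

Section gap_stability.
Context (R : realType) (n m : nat).
Local Notation E := 'rV[R]_n.
Variables (lam : 'I_m.+1 -> R) (p : E) (D : R) (S Y : set E).
Variables (rho : probability E R) (M : R).
Hypothesis bs : bary_setting lam p D Y.
Let lam_gt0 := bs_gt0 bs.
Let D_ge0 := bs_D bs.
Let YD := bs_Y bs.
Hypothesis SD : forall v, S v -> enorm (v - p) <= D.
Hypothesis mS : measurable S.
Hypothesis M_ge0 : 0 <= M.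
Hypothesis rhoM : forall A, measurable A -> (rho A <= M%:E * lebesgue_rV R n A)%E.
Implicit Types (x v : E) (f : 'I_m -> E -> R).
Local Notation l i := (lam (lift ord0 i)).
Local Notation bar := (bary_sum lam p).
Local Notation gap := (dual_gap lam p).
Local Notation pconj := (pconj lam p Y).

Lemma S_cube : S `<=` cube p D.
Proof.
move=> x /SD xD i; rewrite /= in_itv/=.
have := le_trans (coord_le_enorm (x - p) i) xD; rewrite !mxE ler_norml => /andP[h1 h2].
by apply/andP; split; lra.
Qed.

Lemma cube_enorm x : cube p D x -> enorm (x - p) <= n%:R * D.
Proof.
move=> xQ; apply: (le_trans (enorm_le_sum _)).
apply: (@le_trans _ _ (\sum_(i < n) D)); last by rewrite sumr_const card_ord mulr_natl.
apply: ler_sum => i _; have := xQ i; rewrite /= in_itv/= => /andP[h1 h2].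
by rewrite !mxE ler_norml; apply/andP; split; lra.
Qed.

(** [M] times the constant of [integral_sdiff_le] over the cube of half-side [D],
    where [n D + 1 + D] is a Lipschitz constant of any conjugate around that cube. *)
Definition sd_cst := M * (2 * (n%:R * D + 1 + D) * (2 * D) ^+ n.-1).

Lemma sd_cst_ge0 : 0 <= sd_cst.
Proof. by rewrite !mulr_ge0 ?exprn_ge0 ?addr_ge0 ?mulr_ge0. Qed.

Section potential.
Variables (f : 'I_m -> E -> R) (B : R).
Hypothesis fB : bounded_on Y f B.
Hypothesis mf : forall i, measurable_fun setT (f i).

Lemma measurable_pconj : measurable_fun setT (pconj f).
Proof. by apply: continuous_measurable_rV; exact: (pconj_continuous bs fB). Qed.

Lemma measurable_sdiff t k : measurable_fun setT (sdiff (pconj f) t k).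
Proof.
have mF := measurable_pconj.
apply: measurable_funB; last exact: measurable_funM.
by apply: measurable_funD; apply: measurableT_comp => //; exact: measurable_translate.
Qed.

Lemma integral_sdiff_rho t k : 0 <= t -> t <= 1 ->
  (\int[rho]_(x in S) (sdiff (pconj f) t k x)%:E <= (sd_cst * t ^+ 2)%:E)%E.
Proof.
move=> t0 t1.
have te : enorm (t *: delta_mx ord0 k : E) <= t.
  rewrite enormZ ger0_norm// ler_piMr//.
  by rewrite enorm_le// dot_delta mxE !eqxx expr1n.
have lipK x s : cube p D x -> `|s| = t ->
    `|pconj f (x + s *: delta_mx ord0 k) - pconj f x| <= (n%:R * D + 1 + D) * t.
  move=> xQ st.
  have se : enorm (s *: delta_mx ord0 k : E) <= t.
    by move: te; rewrite !enormZ st ger0_norm.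
  have h := pconj_lip bs fB (r := n%:R * D + 1) (x := x + s *: delta_mx ord0 k) (x' := x).
  apply: (le_trans (h _ _)).
  - rewrite addrAC; apply: (le_trans (ler_enormD _ _)); apply: lerD.
      exact: cube_enorm.
    exact: le_trans se t1.
  - by apply: (le_trans (cube_enorm xQ)); rewrite lerDl.
  - rewrite [x + _]addrC addrK ler_wpM2l// !addr_ge0 ?mulr_ge0//.
apply: (le_trans (integral_density_le rhoM M_ge0 mS (measurable_cube p D) S_cube _ _)).
- exact: measurable_sdiff.
- move=> x _; apply: (sdiff_ge0 _ _ (pconj_feasible bs fB)).
  exact: (pconj_near bs fB).
- rewrite /sd_cst -mulrA EFinM lee_wpmul2l ?lee_fin//.
  apply: (le_trans (@integral_sdiff_le _ _ p D k D_ge0 (pconj f) t (n%:R * D + 1 + D) _ _ _ _ _)) => //.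
  + exact: measurable_pconj.
  + by rewrite !addr_ge0 ?mulr_ge0.
  + by move=> x xQ; apply: lipK => //; rewrite ger0_norm.
  + by move=> x xQ; rewrite distrC -scaleNr; apply: lipK => //; rewrite normrN ger0_norm.
  + by rewrite lee_fin mulrAC.
Qed.

Lemma integrable_sdiff t k : 0 <= t -> t <= 1 ->
  rho.-integrable S (EFin \o sdiff (pconj f) t k).
Proof.
move=> t0 t1; apply/integrableP; split.
  by apply/measurable_EFinP/measurable_funTS; exact: measurable_sdiff.
apply: le_lt_trans (ltry (sd_cst * t ^+ 2)); apply: le_trans (integral_sdiff_rho k t0 t1).
rewrite le_eqVlt; apply/orP; left; apply/eqP/eq_integral => x _ /=.
rewrite ger0_norm//; apply: (sdiff_ge0 _ _ (pconj_feasible bs fB)).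
exact: (pconj_near bs fB).
Qed.

Lemma Rintegral_sdiff t k : 0 <= t -> t <= 1 ->
  \int[rho]_(x in S) sdiff (pconj f) t k x <= sd_cst * t ^+ 2.
Proof.
move=> t0 t1; rewrite -lee_fin fineK; first exact: integral_sdiff_rho.
exact: (integrable_fin_num mS (integrable_sdiff k t0 t1)).
Qed.

Section map.
Variable U : E -> 'I_m -> E.
Hypothesis mU : forall i, measurable_fun S (fun x => U x i).
Hypothesis YU : forall x, S x -> forall i, Y (U x i).

Lemma measurable_bar : measurable_fun S (fun x => bar x (U x)).
Proof.
apply: measurable_rV_on => // k.
rewrite (_ : (fun _ => _) = (fun x => lam ord0 * (x ord0 k - p ord0 k) +
    \sum_i l i * (U x i ord0 k - p ord0 k))); last first.
  apply/funext => x; rewrite /bary_sum !mxE summxE; congr (_ + _).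
  by apply: eq_bigr => i _; rewrite !mxE.
apply: measurable_funD.
  apply: measurable_funM => //; apply: measurable_funB => //.
  exact: measurable_funTS (measurable_coord k).
apply: measurable_sum => i; apply: measurable_funM => //; apply: measurable_funB => //.
exact: measurable_coord_comp.
Qed.

Lemma enorm_bar2 x : S x -> enorm (bar x (U x)) <= 2 * D.
Proof.
move=> Sx; apply: (le_trans (enorm_bar bs _ (YU Sx))).
by rewrite mulr_natl mulr2n lerD2r; exact: SD.
Qed.

Lemma dot_bar_le x : S x -> dot (bar x (U x)) (bar x (U x)) <= (2 * D) ^+ 2.
Proof. by move=> Sx; rewrite -enorm_le ?mulr_ge0//; exact: enorm_bar2. Qed.

Lemma integrable_dot_bar :
  rho.-integrable S (EFin \o (fun x => dot (bar x (U x)) (bar x (U x)))).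
Proof.
apply: (@le_bound_integrable _ _ _ _ _ _ ((2 * D) ^+ 2)) => //.
- exact: prob_lty.
- by apply: measurable_dot; exact: measurable_bar.
- by move=> x Sx; rewrite ger0_norm ?dot_ge0//; exact: dot_bar_le.
Qed.

Lemma integrable_pconj : rho.-integrable S (EFin \o pconj f).
Proof.
apply: (@le_bound_integrable _ _ _ _ _ _ (2 * D ^+ 2 + m%:R * B)) => //.
- exact: prob_lty.
- by apply: measurable_funTS; exact: measurable_pconj.
- by move=> x Sx; apply: (pconj_bounded bs fB); exact: SD.
Qed.

Lemma integrable_fU i : rho.-integrable S (EFin \o (fun x => f i (U x i))).
Proof.
apply: (@le_bound_integrable _ _ _ _ _ _ B) => //.
- exact: prob_lty.
- exact: measurableT_comp.
- by move=> x Sx; apply: fB; exact: YU.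
Qed.

Lemma integrable_gap : rho.-integrable S (EFin \o (fun x => gap (pconj f) f x (U x))).
Proof.
apply: integrableD_EFin => //.
  apply: integrableD_EFin => //; first exact: integrable_pconj.
  by apply: integrable_sum_EFin => // i; exact: integrable_fU.
under eq_fun do rewrite -mulNr.
by apply: integrableZl_EFin => //; exact: integrable_dot_bar.
Qed.

Lemma Rintegral_gap : \int[rho]_(x in S) gap (pconj f) f x (U x) =
  \int[rho]_(x in S) pconj f x + \sum_i \int[rho]_(x in S) f i (U x i) -
  2^-1 * \int[rho]_(x in S) dot (bar x (U x)) (bar x (U x)).
Proof.
have i1 := integrable_pconj; have i2 := integrable_dot_bar.
have i3 := integrable_sum_EFin (index_enum 'I_m) mS integrable_fU.
rewrite /dual_gap RintegralB//; last exact: integrableZl_EFin.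
  by rewrite RintegralD// Rintegral_sum// ?RintegralZl//; exact: integrable_fU.
exact: integrableD_EFin.
Qed.

End map.

Lemma sum_cst (c : R) : \sum_(k < n) c = n%:R * c.
Proof. by rewrite sumr_const card_ord mulr_natl. Qed.

(** Pointwise, [gap_swap] reduces the distance of the [i]-th maps to
    [|b - b'|^2 <= 4 D sum_k |<b - b', e_k>|], and [gap_sdiff] bounds the coordinates by
    second differences, whose integrals are [O(t^2)]. *)
Lemma gap_stability (U V : E -> 'I_m -> E) t i :
  (forall i, measurable_fun S (fun x => U x i)) ->
  (forall x, S x -> forall i, Y (U x i)) ->
  (forall i, measurable_fun S (fun x => V x i)) ->
  (forall x, S x -> forall i, Y (V x i)) -> 0 <= t -> t <= 1 ->
  lam ord0 * t * l i ^+ 2 *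
    \int[rho]_(x in S) dot (U x i - V x i) (U x i - V x i) <=
  4 * D * n%:R * sd_cst * t ^+ 2 + (4 * D * n%:R + 2) *
   (\int[rho]_(x in S) gap (pconj f) f x (U x) +
    \int[rho]_(x in S) gap (pconj f) f x (V x)).
Proof.
move=> mU YU mV YV t0 t1.
have fe := pconj_feasible bs fB.
have pt x : S x -> lam ord0 * t * l i ^+ 2 * dot (U x i - V x i) (U x i - V x i) <=
    4 * D * \sum_k sdiff (pconj f) t k x +
    (4 * D * n%:R + 2) * (gap (pconj f) f x (U x) + gap (pconj f) f x (V x)).
  move=> Sx; have sw := @gap_swap _ _ _ lam p (pconj f) f x (U x) (V x) i
    (fe _ _ (upd_in i (YU _ Sx) (YV _ Sx))) (fe _ _ (upd_in i (YV _ Sx) (YU _ Sx))).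
  have gU := fe x _ (YU _ Sx); have gV := fe x _ (YV _ Sx).
  have lt0 : 0 <= lam ord0 * t by rewrite mulr_ge0// ltW.
  have lt1 : lam ord0 * t <= 1 by rewrite mulr_ile1 ?(lam0_le1 bs)// ltW.
  have := ler_wpM2l lt0 sw; rewrite mulrA => /le_trans; apply.
  set b := bar x (U x) - bar x (V x).
  have bk k : `|b ord0 k| <= 4 * D.
    apply: (le_trans (coord_le_enorm _ _)); apply: (le_trans (ler_enormD _ _)).
    by rewrite enormN; have := enorm_bar2 YU Sx; have := enorm_bar2 YV Sx; lra.
  have : lam ord0 * t * dot b b <= 4 * D * \sum_k (sdiff (pconj f) t k x +
      gap (pconj f) f x (U x) + gap (pconj f) f x (V x)).
    rewrite !mulr_sumr; apply: ler_sum => k _.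
    have hk := gap_sdiff x t k fe (YU _ Sx) (YV _ Sx).
    rewrite -/b in hk; apply: (@le_trans _ _ (4 * D * (lam ord0 * t * `|b ord0 k|))).
      have -> : b ord0 k * b ord0 k = `|b ord0 k| * `|b ord0 k|.
        by rewrite -!expr2 real_normK ?num_real.
      by rewrite mulrCA; apply: ler_wpM2r => //; exact: mulr_ge0.
    by rewrite ler_wpM2l// mulr_ge0.
  rewrite big_split/= big_split/= !sum_cst.
  have : lam ord0 * t * (2 * (gap (pconj f) f x (U x) + gap (pconj f) f x (V x))) <=
    2 * (gap (pconj f) f x (U x) + gap (pconj f) f x (V x)).
    by rewrite ler_piMl// mulr_ge0// addr_ge0.
  by rewrite mulrDr; lra.
have iK := fun k => integrable_sdiff k t0 t1.
have iS := integrable_sum_EFin (index_enum 'I_n) mS iK.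
have iU := integrable_gap mU YU; have iV := integrable_gap mV YV.
have iUV : rho.-integrable S (EFin \o (fun x => dot (U x i - V x i) (U x i - V x i))).
  apply: (@le_bound_integrable _ _ _ _ _ _ ((2 * D) ^+ 2)) => //.
  - exact: prob_lty.
  - have mUV : measurable_fun S (fun x => U x i - V x i).
      apply: measurable_rV_on => // k; under eq_fun do rewrite !mxE.
      by apply: measurable_funB; exact: measurable_coord_comp.
    exact: measurable_dot.
  - move=> x Sx; rewrite ger0_norm ?dot_ge0// -enorm_le ?mulr_ge0//.
    apply: (le_trans (ler_enorm_dist _ p _)); rewrite (enormB p).
    by have := YD (YU _ Sx i); have := YD (YV _ Sx i); lra.
rewrite -RintegralZl//.
have -> : 4 * D * n%:R * sd_cst * t ^+ 2 = 4 * D * \sum_(k < n) (sd_cst * t ^+ 2).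
  by rewrite sum_cst; ring.
apply: (@le_trans _ _ (4 * D * \int[rho]_(x in S) (\sum_k sdiff (pconj f) t k x) +
  (4 * D * n%:R + 2) * \int[rho]_(x in S)
    (gap (pconj f) f x (U x) + gap (pconj f) f x (V x)))).
  have iUV' := integrableD_EFin mS iU iV.
  rewrite -!RintegralZl// -RintegralD//; try exact: integrableZl_EFin.
  apply: le_Rintegral => //; try exact: integrableZl_EFin.
  by apply: integrableD_EFin => //; exact: integrableZl_EFin.
rewrite RintegralD// lerD2r ler_wpM2l ?mulr_ge0// Rintegral_sum//.
by apply: ler_sum => k _; exact: Rintegral_sdiff.
Qed.

End potential.
End gap_stability.

(** * The dual functional and its one-coordinate improvement *)

Section dual.
Context (R : realType) (n m : nat).
Local Notation E := 'rV[R]_n.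
Variables (lam : 'I_m.+1 -> R) (p : E) (D : R) (S Y : set E).
Variables (rho : probability E R) (mu : 'I_m -> probability E R).
Hypothesis bs : bary_setting lam p D Y.
Hypothesis SD : forall v, S v -> enorm (v - p) <= D.
Hypothesis mS : measurable S.
Hypothesis S_neq0 : S !=set0.
Hypothesis cY : compact Y.
Hypothesis muY : forall i, mu i Y = 1%E.
Implicit Types (x u v : E) (y : 'I_m -> E) (f g : 'I_m -> E -> R).
Local Notation l i := (lam (lift ord0 i)).
Local Notation bar := (bary_sum lam p).
Local Notation gap := (dual_gap lam p).
Local Notation pconj := (pconj lam p Y).
Let D_ge0 := bs_D bs.
Let mY : measurable Y := compact_measurable_rV cY.

Definition dual_value f := \int[rho]_(x in S) pconj f x +
  \sum_i \int[mu i]_(u in Y) f i u.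

Definition admissible f := (exists B, bounded_on Y f B) /\
  (forall i, measurable_fun setT (f i)).

Lemma admissible_integrable f i : admissible f -> (mu i).-integrable Y (EFin \o f i).
Proof.
move=> [[B fB] mf]; apply: (@le_bound_integrable _ _ _ _ _ _ B) => //.
- exact: prob_lty.
- exact: measurable_funTS.
- by move=> x Yx; exact: fB.
Qed.

Lemma admissible_pconj f : admissible f -> rho.-integrable S (EFin \o pconj f).
Proof. by move=> [[B fB] mf]; exact: (integrable_pconj rho bs SD mS fB). Qed.

Lemma prob_cst (P : probability E R) (A : set E) (c : R) : measurable A ->
  P A = 1%E -> \int[P]_(x in A) c = c.
Proof. by move=> mA PA; rewrite Rintegral_cst// [fine _](congr1 fine PA) mulr1. Qed.

Lemma dual_value_le f g (a : R) (c : 'I_m -> R) : admissible f -> admissible g -> rho S = 1%E ->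
  (forall x, S x -> pconj f x <= pconj g x + a) ->
  (forall i u, Y u -> f i u <= g i u + c i) ->
  dual_value f <= dual_value g + (a + \sum_i c i).
Proof.
move=> nf ng rS fga fgc; rewrite addrACA -big_split/=; apply: lerD.
  rewrite -[X in _ <= _ + X](prob_cst a mS rS) -RintegralD//; last 2 first.
  - exact: admissible_pconj.
  - apply: (@le_bound_integrable _ _ _ _ _ _ `|a|) => //.
    exact: prob_lty.
  apply: le_Rintegral => //; first exact: admissible_pconj.
  apply: integrableD_EFin => //; first exact: admissible_pconj.
  apply: (@le_bound_integrable _ _ _ _ _ _ `|a|) => //.
  exact: prob_lty.
apply: ler_sum => i _.
have ci : (mu i).-integrable Y (EFin \o (fun=> c i)).
  apply: (@le_bound_integrable _ _ _ _ _ _ `|c i|) => //.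
  exact: prob_lty.
have ig := admissible_integrable i ng.
rewrite -[X in _ <= _ + X](prob_cst (c i) mY (muY i)) -RintegralD//.
apply: le_Rintegral => //; first exact: admissible_integrable.
  exact: integrableD_EFin.
by move=> u; exact: fgc.
Qed.

Definition updf f (i : 'I_m) (h : E -> R) : 'I_m -> E -> R :=
  fun j => if j == i then h else f j.

Lemma sum_updf f i h y :
  \sum_j updf f i h j (y j) = \sum_j f j (y j) + (h (y i) - f i (y i)).
Proof.
rewrite (bigD1 i)//= [in RHS](bigD1 i)//= /updf eqxx.
rewrite (eq_bigr (fun j => f j (y j))); last by move=> j /negbTE ->.
by rewrite [RHS]addrC addrA subrK.
Qed.

Lemma admissible_updf f i (h : E -> R) : admissible f -> (exists B, forall u, Y u -> `|h u| <= B) ->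
  measurable_fun setT h -> admissible (updf f i h).
Proof.
move=> [[B fB] mf] [B' hB] mh; split; last by move=> j; rewrite /updf; case: eqP.
exists (Num.max B B') => j u Yu; rewrite /updf le_max; case: eqP => _.
  by rewrite hB ?orbT.
by rewrite fB.
Qed.

(** A Lipschitz constant of [2^-1 |b x y|^2] as a function of [y i] alone, for
    [x] in [S]. *)
Definition lip_cst i : R := l i * (2 * D).

Lemma lip_cst_ge0 i : 0 <= lip_cst i.
Proof. by rewrite !mulr_ge0// ltW// (bs_gt0 bs). Qed.

Lemma elip_bounded (L : R) (h : E -> R) : elip L h -> 0 <= L ->
  exists B, forall u, Y u -> `|h u| <= B.
Proof.
move=> hL L0; exists (`|h p| + L * D) => u Yu.
rewrite -[h u](subrK (h p)) addrC; apply: (le_trans (ler_normD _ _)).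
rewrite lerD2l; apply: (le_trans (hL _ _)); apply: ler_wpM2l => //.
exact: bs_Y bs _ Yu.
Qed.

Section transform.
Variables (f : 'I_m -> E -> R) (i : 'I_m).
Hypothesis nf : admissible f.

Let phi (u : E) (q : E * ('I_m -> E)) :=
  f i (q.2 i) - gap (pconj f) f q.1 q.2 - lip_cst i * enorm (u - q.2 i).

Let Z := [set q : E * ('I_m -> E) | S q.1 /\ forall j, Y (q.2 j)].

(** In [f i (y i) - gap (pconj f) f x y] the values of [f i] cancel, except through
    [pconj f]: this is the lower bound that the dual constraint at [(x, y)] puts on
    the value at [y i].  So [ctrans] is the least [lip_cst i]-Lipschitz function that
    satisfies all these constraints for the present [pconj f]. *)
Definition ctrans (u : E) : R := sup (phi u @` Z).

Let fe x y : (forall j, Y (y j)) -> 0 <= gap (pconj f) f x y.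
Proof. by case: nf => [[B fB] _]; exact: (pconj_feasible bs fB). Qed.

Let supZ u : has_sup (phi u @` Z).
Proof.
have [[B fB] _] := nf; have [s Ss] := S_neq0; have [v Yv] := bs_neq0 bs.
split; first by exists (phi u (s, fun=> v)); exists (s, fun=> v).
exists B => _ [[x y] /= [Sx Yy] <-]; rewrite /phi/=.
have := fe x Yy; have := fB i _ (Yy i); rewrite ler_norml => /andP[_].
have := mulr_ge0 (lip_cst_ge0 i) (enorm_ge0 (u - y i)); lra.
Qed.

Lemma ctrans_ge u x y : S x -> (forall j, Y (y j)) ->
  f i (y i) - gap (pconj f) f x y - lip_cst i * enorm (u - y i) <= ctrans u.
Proof.
by move=> Sx Yy; apply: sup_upper_bound; [exact: supZ|exists (x, y)].
Qed.

Lemma ctrans_le u a :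
  (forall x y, S x -> (forall j, Y (y j)) ->
  f i (y i) - gap (pconj f) f x y - lip_cst i * enorm (u - y i) <= a) -> ctrans u <= a.
Proof.
move=> h; apply: ge_sup; first by case: (supZ u).
by move=> _ [[x y] /= [Sx Yy] <-]; exact: h.
Qed.

Lemma ctrans_lip : elip (lip_cst i) ctrans.
Proof.
suff H u v : ctrans u <= ctrans v + lip_cst i * enorm (u - v).
  move=> u v; rewrite ler_norml; have := H u v; have := H v u.
  by rewrite (enormB v u) => h1 h2; apply/andP; split; lra.
apply: ctrans_le => x y Sx Yy; have := ctrans_ge v Sx Yy.
have := ler_wpM2l (lip_cst_ge0 i) (ler_enorm_dist v u (y i)).
rewrite (enormB v u) mulrDr; lra.
Qed.

(** Moving the entry [y i] to [u] lowers [2^-1 |b x y|^2] by at most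
    [lip_cst i * enorm (u - y i)], so the constraint at the moved family already
    bounds [f i u] from below by the Lipschitz extension of the one at [y]. *)
Lemma ctrans_le_id u : Y u -> ctrans u <= f i u.
Proof.
move=> Yu; apply: ctrans_le => x y Sx Yy.
have Yu' : forall j, Y (upd y i u j) by move=> j; rewrite /upd; case: eqP.
have := fe x Yu'; rewrite /dual_gap sum_upd bar_upd.
have b2 := enorm_bar bs x Yy; have xD := SD Sx.
have h : l i * `|dot (bar x y) (u - y i)| <= lip_cst i * enorm (u - y i).
  rewrite /lip_cst -mulrA; apply: ler_wpM2l; first exact: ltW (bs_gt0 bs _).
  apply: (le_trans (normr_dot_le _ _)); apply: ler_wpM2r; first exact: enorm_ge0.
  by rewrite mulr_natl mulr2n; apply: (le_trans b2); rewrite lerD2r.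
move: h; move: (bar x y) (u - y i) => b v h.
have h' : - (l i * dot b v) <= l i * `|dot b v|.
  rewrite -mulrN; apply: ler_wpM2l; first exact: ltW (bs_gt0 bs _).
  by rewrite -normrN ler_norm.
rewrite !(dotDl, dotDr, dotZl, dotZr) (dotC v b).
have := mulr_ge0 (sqr_ge0 (l i)) (dot_ge0 v); lra.
Qed.

(** By construction of [ctrans] the conjugate does not increase on [S], and by
    [ctrans_le_id] the potential decreases on [Y]. *)
Lemma dual_value_ctrans : rho S = 1%E -> dual_value (updf f i ctrans) <= dual_value f.
Proof.
move=> rS; have nc : admissible (updf f i ctrans).
  apply: admissible_updf => //; first exact: elip_bounded ctrans_lip (lip_cst_ge0 i).
  exact: continuous_measurable_rV (elip_continuous ctrans_lip).
have := @dual_value_le _ f 0 (fun=> 0) nc nf rS.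
rewrite big1_eq !addr0; apply => [x Sx|j u Yu]; rewrite addr0.
  have [[B fB] _] := nc; apply: (pconj_le bs fB) => y Yy.
  rewrite sum_updf; have := ctrans_ge (y i) Sx Yy; rewrite subrr enorm0 mulr0.
  rewrite /dual_gap; lra.
by rewrite /updf; case: eqP => // ->; exact: ctrans_le_id.
Qed.

End transform.

(** Lowering a potential by [c] raises the conjugate by [c], and all the measures
    have mass one. *)
Lemma dual_value_shift f i (c : R) : admissible f -> rho S = 1%E ->
  dual_value (updf f i (fun u => f i u - c)) <= dual_value f.
Proof.
move=> nf rS; have nc : admissible (updf f i (fun u => f i u - c)).
  have [[B fB] mf] := nf; apply: admissible_updf => //.
    exists (B + `|c|) => u Yu; apply: (le_trans (ler_normB _ _)).
    by rewrite lerD2r; exact: fB.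
  exact: measurable_funB.
have := @dual_value_le _ f c (fun j => if j == i then - c else 0) nc nf rS.
rewrite -big_mkcond/= big_pred1_eq subrr addr0; apply => [x Sx|j u Yu].
  have [[B fB] _] := nf; have [[B' cB] _] := nc.
  apply: (pconj_mono bs); [by exists B|by exists B'|].
  by move=> y Yy; rewrite sum_updf; lra.
by rewrite /updf; case: eqP => [->//|_]; rewrite addr0.
Qed.

End dual.

(** * Minimizers of the dual functional *)

Section nets.
Context (R : realType) (n : nat).
Local Notation E := 'rV[R]_n.

Lemma compact_net (Y : set E) (eta : R) : compact Y -> 0 < eta ->
  exists2 s : seq E, forall w, w \in s -> Y w &
    forall v, Y v -> exists2 w, w \in s & enorm (v - w) < eta.
Proof.
rewrite compact_cover => cY eta0.
have [||D' sD' cov] := cY E Y (fun w => [set v | enorm (v - w) < eta]).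
- move=> w _; rewrite (_ : mkset _ = (fun v : E => enorm (v - w)) @^-1` `]-oo, eta[).
    apply: open_comp; last exact: interval_open.
    move=> v _; apply: (@elip_continuous _ _ 1) => a b.
    rewrite mul1r ler_norml; have := ler_enorm_dist a b w.
    have := ler_enorm_dist b a w; rewrite (enormB b a) => h1 h2.
    by apply/andP; split; lra.
  by apply/seteqP; split=> v /=; rewrite in_itv.
- by move=> v Yv; exists v => //=; rewrite subrr enorm0.
exists (finmap.enum_fset D') => [w /sD'|v /cov[w wD vw]]; first by rewrite inE.
by exists w.
Qed.

Lemma nbhs_fin (I : eqType) (phi : {ptws I -> R}) (s : seq I) (d : R) : 0 < d ->
  nbhs phi [set g : I -> R | forall j, j \in s -> `|g j - phi j| < d].
Proof.
move=> d0; have FF : Filter (nbhs phi) by exact: (@nbhs_filter {ptws I -> R}).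
elim: s => [|j s IH]; first by apply: filterS filterT => g _ j.
have hj : nbhs phi [set g : I -> R | `|g j - phi j| < d].
  have := @proj_continuous I (fun=> R) j phi.
  move/cvgrPdist_lt => /(_ _ d0); apply: filterS => g /=.
  by rewrite distrC.
apply: filterS2 IH hj => g gs gj i; rewrite inE => /orP[/eqP ->//|]; exact: gs.
Qed.

End nets.

Section minimizer.
Context (R : realType) (n m : nat).
Local Notation E := 'rV[R]_n.
Variables (lam : 'I_m.+1 -> R) (p : E) (D : R) (S Y : set E).
Variables (rho : probability E R) (mu : 'I_m -> probability E R).
Hypothesis bs : bary_setting lam p D Y.
Hypothesis SD : forall v, S v -> enorm (v - p) <= D.
Hypothesis mS : measurable S.
Hypothesis rS : rho S = 1%E.
Hypothesis cY : compact Y.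
Hypothesis muY : forall i, mu i Y = 1%E.
Implicit Types (x u v : E) (y : 'I_m -> E) (f g : 'I_m -> E -> R).
Local Notation J := (dual_value lam p S Y rho mu).
Local Notation admissible := (admissible Y).
Variable q : E.
Hypothesis Yq : Y q.
Let D_ge0 := bs_D bs.

(** The Lipschitz constants are those produced by [ctrans]; the normalization at
    [q], harmless by [dual_value_shift], makes the class compact for pointwise
    convergence. *)
Definition lipclass : set ('I_m -> E -> R) :=
  [set f | forall i, elip (lip_cst lam D i) (f i) /\ f i q = 0].

Lemma lip_cst_le i : lip_cst lam D i <= 2 * D.
Proof.
rewrite /lip_cst ler_piMl ?mulr_ge0// -(bs_sum bs) (bigD1 (lift ord0 i))//= lerDl.
by apply: sumr_ge0 => j _; exact: ltW (bs_gt0 bs _).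
Qed.

Lemma lipclass_le f i u : lipclass f -> `|f i u| <= 2 * D * enorm (u - q).
Proof.
move=> /(_ i)[fL fq]; rewrite -[f i u]subr0 -fq; apply: (le_trans (fL _ _)).
by apply: ler_wpM2r; [exact: enorm_ge0|exact: lip_cst_le].
Qed.

Lemma lipclass_bounded f : lipclass f -> bounded_on Y f (2 * D * (2 * D)).
Proof.
move=> Kf i u Yu; apply: (le_trans (lipclass_le i u Kf)).
apply: ler_wpM2l; first exact: mulr_ge0.
apply: (le_trans (ler_enorm_dist _ p _)); rewrite (enormB p).
by have := bs_Y bs Yu; have := bs_Y bs Yq; lra.
Qed.

Lemma lipclass_admissible f : lipclass f -> admissible f.
Proof.
move=> Kf; split; first by exists (2 * D * (2 * D)); exact: lipclass_bounded.
move=> i; apply: continuous_measurable_rV; exact: elip_continuous (Kf i).1.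
Qed.

Lemma dual_value_close f g e : admissible f -> admissible g ->
  (forall i u, Y u -> `|f i u - g i u| <= e) ->
  J f <= J g + 2 * m%:R * e.
Proof.
move=> nf ng fg; have sE : \sum_(i < m) e = m%:R * e.
  by rewrite sumr_const card_ord mulr_natl.
apply: le_trans (dual_value_le bs SD mS cY muY (a := m%:R * e) (c := fun=> e) nf ng rS _ _) _.
- move=> x Sx; have [[B fB] _] := nf; have [[B' gB] _] := ng.
  apply: (pconj_mono bs); [by exists B'|by exists B|] => y Yy.
  rewrite -sE -big_split/=; apply: ler_sum => i _.
  by have := fg i _ (Yy i); rewrite ler_norml => /andP[]; lra.
- by move=> i u /(fg i); rewrite ler_norml => /andP[]; lra.
- by rewrite sE lerD2l; lra.
Qed.

(** A minimizing sequence has a pointwise cluster point by Tychonoff's theorem.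
    The product topology controls finitely many values only, but equi-Lipschitz
    potentials that are close on a finite net of [Y] are close on [Y]. *)
Lemma dual_minimizer : exists2 f, lipclass f & forall g, lipclass g -> J f <= J g.
Proof.
pose V := [set J f | f in lipclass].
have K0 : lipclass (fun _ _ => 0).
  by move=> i; split=> // u v; rewrite subrr normr0 mulr_ge0 ?enorm_ge0 ?(lip_cst_ge0 bs).
have Vinf : has_inf V.
  split; first by exists (J (fun _ _ => 0)); exists (fun _ _ => 0).
  exists (J (fun _ _ => 0) - 2 * m%:R * (2 * D * (2 * D))) => _ [f Kf <-].
  rewrite lerBlDr; apply: dual_value_close; [exact: lipclass_admissible|exact: lipclass_admissible|].
  by move=> i u Yu; rewrite sub0r normrN; exact: lipclass_bounded.
have /choice[u_ hu] : forall k : nat, exists f, lipclass f /\ J f < inf V + k.+1%:R^-1.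
  move=> k; have [|_ [f Kf <-] h] := @inf_adherent _ V k.+1%:R^-1 _ Vinf.
    by rewrite invr_gt0.
  by exists f.
pose I : eqType := ('I_m * E)%type.
pose v (k : nat) : {ptws I -> R} := fun j => u_ k j.1 j.2.
pose A (j : I) : set R := `[- (2 * D * enorm (j.2 - q)), 2 * D * enorm (j.2 - q)]%classic.
have cA : compact [set g : {ptws I -> R} | forall j, A j (g j)].
  by apply: tychonoff => j; exact: segment_compact.
have [|phi [_ clphi]] := cA (v @ \oo) _.
  exists 0%N => // k _ j; rewrite /A /= in_itv/= -ler_norml.
  exact: lipclass_le (hu k).1.
pose f : 'I_m -> E -> R := fun i u => phi (i, u).
have near (s : seq I) d k0 : 0 < d -> exists2 k, (k0 <= k)%N &
    forall j, j \in s -> `|u_ k j.1 j.2 - f j.1 j.2| < d.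
  move=> d0; have := clphi [set g | exists2 k, (k0 <= k)%N & g = v k] _ _ (nbhs_fin phi s d0).
  move=> [|_ [[k k0k ->] h]].
    by exists k0 => // k /= k0k; exists k.
  by exists k => // -[i w] js; exact: h js.
have Kf : lipclass f.
  move=> i; split.
    move=> a b; apply/ler_addgt0Pr => e e0.
    have [|k _ hk] := near [:: (i, a); (i, b)] (e / 2) 0%N; first by rewrite divr_gt0.
    have := hk (i, a); rewrite !inE eqxx => /(_ isT) /=.
    have := hk (i, b); rewrite !inE eqxx orbT => /(_ isT) /=.
    have := ((hu k).1 i).1 a b; rewrite !ler_norml !ltr_norml.
    by move=> /andP[? ?] /andP[? ?] /andP[? ?]; apply/andP; split; lra.
  apply/eqP; rewrite -normr_le0; apply/ler_addgt0Pl => e e0.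
  have [|k _ hk] := near [:: (i, q)] e 0%N; first by [].
  have := hk (i, q); rewrite inE eqxx => /(_ isT) /=.
  by rewrite ((hu k).1 i).2 sub0r normrN addr0 => /ltW.
exists f => // g Kg; apply: (@le_trans _ _ (inf V)); last first.
  by apply: ge_inf; [exact: Vinf.2|exists g].
apply/ler_addgt0Pr => e e0.
(* values [a]-close on [Y] change the dual value by at most [2 m a <= e / 2]; the net
   of mesh [eta] costs [2 * (2 D) * eta <= a / 2] and the values on it [a / 2] *)
pose a := e / (4 * m.+1%:R); pose eta := a / (8 * (D + 1)).
have m0 : 0 < 4 * m.+1%:R :> R by rewrite mulr_gt0.
have D0 : 0 < 8 * (D + 1) by rewrite mulr_gt0// ltr_wpDl.
have a0 : 0 < a by rewrite divr_gt0.
have eta0 : 0 < eta by rewrite divr_gt0.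
have [s sY net] := compact_net cY eta0.
have [k0 _ hk0] : exists2 k0 : nat, True & k0.+1%:R^-1 <= e / 2.
  have e20 : 0 < e / 2 by rewrite divr_gt0.
  have [k0 _ /(_ k0 (leqnn k0)) h] := near_infty_natSinv_lt (PosNum e20).
  by exists k0 => //; exact: ltW.
have [|k k0k hk] := near [seq (i, w) | i <- enum 'I_m, w <- s] (a / 2) k0.
  by rewrite divr_gt0.
have close i u : Y u -> `|f i u - u_ k i u| <= a.
  move=> Yu; have [w ws uw] := net _ Yu.
  have := hk (i, w); rewrite allpairs_f ?mem_enum// => /(_ isT) /= h1.
  have h2 : `|f i u - f i w| <= 2 * D * eta.
    apply: (le_trans ((Kf i).1 u w)).
    by apply: ler_pM; rewrite ?(lip_cst_ge0 bs) ?enorm_ge0 ?lip_cst_le// ltW.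
  have h3 : `|u_ k i u - u_ k i w| <= 2 * D * eta.
    apply: (le_trans (((hu k).1 i).1 u w)).
    by apply: ler_pM; rewrite ?(lip_cst_ge0 bs) ?enorm_ge0 ?lip_cst_le// ltW.
  have h4 : 4 * D * eta <= a / 2.
    have : 8 * (D + 1) * eta = a by rewrite mulrC divfK// gt_eqF.
    by have := mulr_ge0 D_ge0 (ltW eta0); lra.
  move: h1 h2 h3; rewrite ltr_norml !ler_norml.
  by move=> /andP[? ?] /andP[? ?] /andP[? ?]; apply/andP; split; lra.
apply: (le_trans (dual_value_close (lipclass_admissible Kf) (lipclass_admissible (hu k).1) close)).
have h1 := ltW (hu k).2.
have h2 : k.+1%:R^-1 <= e / 2.
  by apply: le_trans hk0; rewrite lef_pV2 ?posrE// ler_nat.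
have h3 : 4 * m.+1%:R * a = e by rewrite mulrC divfK// gt_eqF.
have mE : m.+1%:R = m%:R + 1 :> R by rewrite natr1.
have h4 : 2 * m%:R * a <= e / 2.
  by rewrite -h3 mE; have := ltW a0; move: (a) (m%:R) => a' m'; nra.
apply: (le_trans (lerD h1 h4)).
by move: h2; move: (k.+1%:R^-1) => c; lra.
Qed.

End minimizer.

(** * Perturbed potentials and almost maximal families *)

Section pos.
Context (R : realType).

Lemma common_lower_bound (I : finType) (d : I -> R) : (forall i, 0 < d i) ->
  exists2 e, 0 < e & forall i, e <= d i.
Proof.
move=> d0; have s0 : 0 < 1 + \sum_i (d i)^-1.
  by rewrite ltr_wpDr// sumr_ge0// => i _; rewrite invr_ge0 ltW.
exists (1 + \sum_i (d i)^-1)^-1; first by rewrite invr_gt0.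
move=> i; rewrite -[leRHS]invrK lef_pV2 ?posrE ?invr_gt0// (bigD1 i)//=.
rewrite addrCA lerDl addr_ge0// sumr_ge0// => j _.
by rewrite invr_ge0 ltW.
Qed.

End pos.

Section first_order.
Context (R : realType) (n m : nat).
Local Notation E := 'rV[R]_n.
Variables (lam : 'I_m.+1 -> R) (p : E) (D : R) (S Y : set E).
Variables (rho : probability E R) (mu : 'I_m -> probability E R).
Hypothesis bs : bary_setting lam p D Y.
Hypothesis SD : forall v, S v -> enorm (v - p) <= D.
Hypothesis mS : measurable S.
Hypothesis rS : rho S = 1%E.
Hypothesis S_neq0 : S !=set0.
Hypothesis cY : compact Y.
Hypothesis muY : forall i, mu i Y = 1%E.
Implicit Types (x u v : E) (y z : 'I_m -> E) (f g : 'I_m -> E -> R).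
Local Notation l i := (lam (lift ord0 i)).
Local Notation J := (dual_value lam p S Y rho mu).
Local Notation admissible := (admissible Y).
Local Notation bar := (bary_sum lam p).
Local Notation gap := (dual_gap lam p).
Local Notation pconj := (pconj lam p Y).
Local Notation lipc := (lip_cst lam D).
Variable q : E.
Hypothesis Yq : Y q.

Definition perturb f i (h : E -> R) (e : R) := updf f i (fun u => f i u + e * h u).

Lemma admissible_perturb f i h L e : admissible f -> elip L h -> 0 <= L -> admissible (perturb f i h e).
Proof.
move=> nf hL L0; have [[B fB] mf] := nf; have [B' hB] := elip_bounded bs hL L0.
apply: admissible_updf => //.
  exists (B + `|e| * B') => u Yu; apply: (le_trans (ler_normD _ _)); apply: lerD.
    exact: fB.
  by rewrite normrM; apply: ler_wpM2l => //; exact: hB.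
apply: measurable_funD => //; apply: measurable_funM => //.
by apply: continuous_measurable_rV; exact: elip_continuous hL.
Qed.

(** The perturbed potential may leave the class over which [f] is minimal; [ctrans]
    and a shift lead back into the class without increasing the dual value. *)
Lemma perturb_ge f i h L e : lipclass lam D q f ->
  (forall g, lipclass lam D q g -> J f <= J g) ->
  elip L h -> 0 <= L -> J f <= J (perturb f i h e).
Proof.
move=> Kf fmin hL L0; have nf := lipclass_admissible bs Yq Kf.
have np : admissible (perturb f i h e) by exact: admissible_perturb hL L0.
set fe := perturb f i h e in np *.
apply: le_trans (dual_value_ctrans bs SD mS S_neq0 cY muY i np rS).
set g := ctrans _ _ _ _ _ _ _.
have gL : elip (lipc i) g by exact: (ctrans_lip bs S_neq0).
have ng : admissible (updf fe i g).
  apply: admissible_updf => //; first exact: (elip_bounded bs gL (lip_cst_ge0 bs i)).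
  exact: continuous_measurable_rV (elip_continuous gL).
apply: le_trans (dual_value_shift bs SD mS cY muY i (g q) ng rS).
apply: fmin => j; rewrite /updf; case: eqP => [->|/eqP jn].
  rewrite eqxx subrr; split=> // a b; rewrite opprB addrA subrK; exact: gL.
by rewrite /fe /perturb /updf (negbTE jn); exact: Kf.
Qed.

Section argmax.
Variable f : 'I_m -> E -> R.
Hypothesis nf : admissible f.
Hypothesis cf : forall i, continuous (f i).

Let fe x y : (forall j, Y (y j)) -> 0 <= gap (pconj f) f x y.
Proof. by case: nf => [[B fB] _]; exact: (pconj_feasible bs fB). Qed.

Lemma argmax_exists x : exists2 y, (forall i, Y (y i)) & gap (pconj f) f x y = 0.
Proof.
pose A := [set y : {ptws 'I_m -> E} | forall i, Y (y i)].
have cA : compact A by exact: (@tychonoff 'I_m (fun=> E) (fun=> Y) (fun=> cY)).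
have A0 : A !=set0 by exists (fun=> q).
pose psi (y : {ptws 'I_m -> E}) := gap (pconj f) f x y.
have cpr (i : 'I_m) : continuous (fun y : {ptws 'I_m -> E} => y i).
  exact: (@proj_continuous 'I_m (fun=> E) i).
have csum (I : finType) (F : I -> {ptws 'I_m -> E} -> R) :
    (forall i, continuous (F i)) -> continuous (fun y : {ptws 'I_m -> E} => \sum_i F i y).
  move=> cF; apply: continuous_big => // => -[a b]; exact: add_continuous.
pose PT := {ptws 'I_m -> E}.
have cS : continuous (fun y : PT => \sum_i f i (y i)).
  apply: csum => i y.
  by apply: (@continuous_comp PT E R (fun y => y i) (f i)); [exact: cpr|exact: cf].
have cb k : continuous (fun y : PT => bar x y ord0 k).
  rewrite (_ : (fun _ => _) = (fun y : PT =>
    lam ord0 * (x ord0 k - p ord0 k) +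
    \sum_i l i * (y i ord0 k - p ord0 k))); last first.
    apply/funext => z; rewrite /bary_sum !mxE summxE; congr (_ + _).
    by apply: eq_bigr => i _; rewrite !mxE.
  have cs : continuous (fun y : PT => \sum_i l i * (y i ord0 k - p ord0 k)).
    apply: csum => i z.
    have ci : y i ord0 k @[y --> nbhs (z : PT)] --> z i ord0 k.
      apply: (@continuous_comp PT E R (fun y => y i) (fun u => u ord0 k)).
        exact: cpr.
      exact: coord_continuous.
    exact: (cvgM (cvg_cst (l i)) (cvgB ci (cvg_cst (p ord0 k)))).
  by move=> z; exact: (cvgD (cvg_cst _) (cs z)).
have cQ : continuous (fun y : PT => dot (bar x y) (bar x y)).
  apply: (csum _ (fun k (y : PT) => bar x y ord0 k * bar x y ord0 k)) => k z.
  exact: (cvgM (cb k z) (cb k z)).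
have cpsi : continuous psi.
  move=> z; exact: (cvgB (cvgD (cvg_cst _) (cS z)) (cvgM (cvg_cst _) (cQ z))).
have [y yA ymin] := compact_EVT_min A0 cA (continuous_subspaceT cpsi).
rewrite inE in yA; exists y => //.
apply/eqP; rewrite eq_le fe// andbT; apply/ler_addgt0Pl => e e0; rewrite addr0.
have [[B fB] _] := nf; have [z Yz ze] := pconj_near bs fB x e0.
by apply: le_trans ze; apply: ymin; rewrite inE.
Qed.

(** For a convex function the quotient [sdiff F t k x / t] is nondecreasing in [t],
    so this is differentiability at [x] along each axis. *)
Definition regular x := forall (k : 'I_n) (a : R), 0 < a ->
  exists2 t, 0 < t & sdiff (pconj f) t k x < a * t.

(** At a regular point [gap_sdiff] forces families of small gap to have nearly the
    same barycentre, and [gap_swap] then forces nearly the same entries. *)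
Lemma near_argmax x y i eta : regular x -> (forall j, Y (y j)) ->
  gap (pconj f) f x y = 0 -> 0 < eta ->
  exists2 d, 0 < d & forall z, (forall j, Y (z j)) ->
    gap (pconj f) f x z <= d -> enorm (z i - y i) <= eta.
Proof.
move=> rx Yy y0 eta0; set c := 4 * n%:R + 2 : R.
have c0 : 0 < c by rewrite ltr_wpDl ?mulr_ge0.
have c1 : 1 <= c by rewrite /c; have : 0 <= n%:R :> R by []; lra.
have li := bs_gt0 bs (lift ord0 i); have l0 := bs_gt0 bs ord0.
(* [c] collects the [n] coordinates of the barycentre, each at most [2 eta'], and the
   gaps, at most [eta' ^+ 2] *)
pose eta' := l i * eta / c.
have eta'0 : 0 < eta' by rewrite divr_gt0// mulr_gt0.
have /choice[t_ ht] k : exists t, 0 < t /\ sdiff (pconj f) t k x < (lam ord0 * eta') * t.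
  by have [|t t0 h] := rx k (lam ord0 * eta'); [rewrite mulr_gt0|exists t].
have [d1 d10 hd1] := @common_lower_bound R 'I_n (fun k => lam ord0 * eta' * t_ k)
  (fun k => mulr_gt0 (mulr_gt0 l0 eta'0) (ht k).1).
exists (Num.min d1 (eta' ^+ 2)); first by rewrite lt_min d10 exprn_gt0.
move=> z Yz; rewrite le_min => /andP[zd1 zd2].
have fef : feasible lam p Y (pconj f) f by case: nf => [[B fB] _]; exact: (pconj_feasible bs fB).
have sw := @gap_swap _ _ _ lam p (pconj f) f x z y i
    (fef _ _ (upd_in i Yz Yy)) (fef _ _ (upd_in i Yy Yz)).
have bk k : `|(bar x z - bar x y) ord0 k| <= 2 * eta'.
  have hk := gap_sdiff x (t_ k) k fef Yz Yy; have [tk0 hs] := ht k.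
  have := le_trans zd1 (hd1 k); rewrite y0 addr0 in hk => h2.
  have lt0 : 0 < lam ord0 * t_ k by rewrite mulr_gt0.
  rewrite -(ler_pM2l lt0); apply: (le_trans hk); lra.
have hb : dot (bar x z - bar x y) (bar x z - bar x y) <= n%:R * (4 * eta' ^+ 2).
  rewrite -sum_cst; apply: ler_sum => k _.
  have : `|(bar x z - bar x y) ord0 k| ^+ 2 <= (2 * eta') ^+ 2.
    have e20 : 0 <= 2 * eta' by rewrite mulr_ge0// ltW.
    by apply: lerXn2r; rewrite ?nnegrE//; exact: bk.
  by rewrite real_normK ?num_real// expr2 exprMn -natrX.
rewrite enorm_le ?(ltW eta0)// -(ler_pM2l (exprn_gt0 2 li)); apply: (le_trans sw).
have e1 : l i ^+ 2 * eta ^+ 2 = (eta' * c) ^+ 2 by rewrite /eta' divfK ?gt_eqF// exprMn.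
rewrite e1 y0 addr0 exprMn.
have : eta' ^+ 2 * c <= eta' ^+ 2 * c ^+ 2.
  by rewrite ler_pM2l ?exprn_gt0// expr2 ler_peMl// ltW.
rewrite {1}/c; lra.
Qed.

End argmax.
End first_order.

(** * Lipschitz test functions *)

Section bounded_cvg.
Context d (T : measurableType d) (R : realType).
Variable mu : {measure set T -> \bar R}.

Lemma Rintegral_bounded_cvg (A : set T) (u_ : nat -> T -> R) (u : T -> R) (B : R) :
  measurable A -> (mu A < +oo)%E -> (forall j, measurable_fun A (u_ j)) ->
  (forall j x, A x -> `|u_ j x| <= B) ->
  (forall x, A x -> u_ ^~ x @ \oo --> u x) ->
  \int[mu]_(x in A) u_ j x @[j --> \oo] --> \int[mu]_(x in A) u x.
Proof.
move=> mA Aoo mu_ uB uu; apply: fine_cvg.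
have uB' x : A x -> `|u x| <= B.
  move=> Ax; apply: (cvgr_to_le (cvg_norm (uu _ Ax))).
  by apply: nearW => j; exact: uB.
have iu := le_bound_integrable mA Aoo (measurable_fun_cvg mu_ uu) uB'.
rewrite fineK; last exact: (integrable_fin_num mA iu).
apply: (@dominated_cvg _ _ _ mu A mA (fun j x => (u_ j x)%:E) _ (cst B%:E)) => //.
- by move=> j; apply/measurable_EFinP.
- by move=> x Ax; apply: cvg_EFin; [exact: nearW|exact: uu].
- exact: (@le_bound_integrable _ _ _ _ _ (cst B) `|B|).
Qed.
End bounded_cvg.

Section full_measure.
Context d (T : measurableType d) (R : realType) (P : probability T R) (S : set T).
Hypothesis mS : measurable S.
Hypothesis PS : P S = 1%E.

Let PSC : P (~` S) = 0%E.
Proof. by rewrite probability_setC// PS subee. Qed.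

Lemma prob_setI A : measurable A -> P (S `&` A) = P A.
Proof.
move=> mA; rewrite [RHS](measureDI _ mA mS) setIC.
rewrite [X in (X + _)%E](_ : _ = 0%E) ?add0e//.
by apply: (subset_measure0 _ _ _ PSC); [exact: measurableD|exact: measurableC|move=> x []].
Qed.

Lemma Rintegral_full (g : T -> R) : P.-integrable setT (EFin \o g) ->
  \int[P]_x g x = \int[P]_(x in S) g x.
Proof.
move=> ig; rewrite /Rintegral.
rewrite (negligible_integral (measurableC mS) measurableT ig PSC).
by rewrite setDE setCK setTI.
Qed.

End full_measure.

Section lipschitz_tests.
Context (R : realType) (n : nat).
Local Notation E := 'rV[R]_n.

Definition cdist (A : set E) (u : E) : R := inf [set enorm (u - c) | c in ~` A].

Section cdist.
Variable A : set E.
Hypothesis oA : open A.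
Hypothesis A_neqT : ~` A !=set0.

Let lb u : has_inf [set enorm (u - c) | c in ~` A].
Proof.
have [c Ac] := A_neqT; split; first by exists (enorm (u - c)); exists c.
by exists 0 => _ [d _ <-]; exact: enorm_ge0.
Qed.

Lemma cdist_ge0 u : 0 <= cdist A u.
Proof.
apply: lb_le_inf; first exact: (lb u).1.
by move=> _ [d _ <-]; exact: enorm_ge0.
Qed.

Lemma cdist_lip : elip 1 (cdist A).
Proof.
suff H u v : cdist A u <= cdist A v + enorm (u - v).
  move=> u v; rewrite mul1r ler_norml; have := H u v; have := H v u.
  by rewrite (enormB v u) => h1 h2; apply/andP; split; lra.
rewrite -lerBlDr; apply: lb_le_inf; first exact: (lb v).1.
move=> _ [c Ac <-]; rewrite lerBlDr; apply: (@le_trans _ _ (enorm (u - c))).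
  by apply: ge_inf; [exact: (lb u).2|exists c].
by rewrite [leRHS]addrC; exact: ler_enorm_dist.
Qed.

Lemma cdist_eq0 u : ~ A u -> cdist A u = 0.
Proof.
move=> Au; apply/eqP; rewrite eq_le cdist_ge0 andbT.
by apply: ge_inf; [exact: (lb u).2|exists u => //; rewrite subrr enorm0].
Qed.

Lemma cdist_gt0 u : A u -> 0 < cdist A u.
Proof.
move=> Au; have /nbhs_ballP[e /= e0 eA] : nbhs u A by apply: open_nbhs_nbhs.
apply: (lt_le_trans e0); apply: lb_le_inf; first exact: (lb u).1.
move=> _ [c Ac <-]; rewrite leNgt; apply/negP => h; apply: Ac; apply: eA.
split=> // i j; rewrite [i]ord1 /ball/=.
apply: le_lt_trans h; have := coord_le_enorm (u - c) j.
by rewrite !mxE.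
Qed.

End cdist.

Definition ramp (A : set E) (j : nat) (u : E) : R := Num.min 1 (j.+1%:R * cdist A u).

Lemma ramp_lip A j : ~` A !=set0 -> elip j.+1%:R (ramp A j).
Proof.
move=> A0 u v; rewrite /ramp.
have h : `|j.+1%:R * cdist A u - j.+1%:R * cdist A v| <= j.+1%:R * enorm (u - v).
  rewrite -mulrBr normrM ger0_norm// ler_wpM2l//.
  by have := cdist_lip A0 u v; rewrite mul1r.
have H (a b : R) : Num.min 1 a - Num.min 1 b <= `|a - b|.
  have := ler_norm (a - b); have := normr_ge0 (a - b).
  by rewrite /Num.min; case: (ltP 1 a); case: (ltP 1 b); lra.
by apply: le_trans h; rewrite ler_norml lerNl opprB distrC H distrC H.
Qed.

Lemma ramp_ge0 A j u : ~` A !=set0 -> 0 <= ramp A j u.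
Proof. by move=> A0; rewrite le_min ler01 mulr_ge0// cdist_ge0. Qed.

Lemma ramp_le1 A j u : ramp A j u <= 1.
Proof. by rewrite ge_min lexx. Qed.

Lemma ramp_cvg A u : open A -> ~` A !=set0 -> ramp A ^~ u @ \oo --> (\1_A u : R).
Proof.
move=> oA A0; have [Au|nAu] := pselect (A u).
  rewrite indicE mem_set//; apply: cvg_near_cst.
  have [k kd] : exists k : nat, k.+1%:R^-1 < cdist A u.
    have [k0 _ /(_ k0 (leqnn k0)) h] := near_infty_natSinv_lt (PosNum (cdist_gt0 oA A0 Au)).
    by exists k0.
  exists k => // j /= kj; apply/min_l.
  have : k.+1%:R^-1 * k.+1%:R <= cdist A u * j.+1%:R.
    by apply: ler_pM => //; [exact: ltW|rewrite ler_nat].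
  by rewrite mulVf ?gt_eqF// mulrC.
rewrite indicE memNset//.
rewrite (_ : ramp A ^~ u = cst 0); first exact: cvg_cst.
by apply/funext => j; rewrite /ramp cdist_eq0// mulr0 min_r.
Qed.

(** The ramps are Lipschitz and converge boundedly to the indicator of an open set;
    open sets form a pi-system that generates the Borel sets. *)
Lemma eq_measure_elip (P Q : {measure set E -> \bar R}) :
  P setT = 1%E -> Q setT = 1%E ->
  (forall (h : E -> R) L, elip L h -> 0 <= L -> (forall u, `|h u| <= 1) ->
    \int[P]_u h u = \int[Q]_u h u) ->
  forall A, measurable A -> P A = Q A.
Proof.
move=> P1 Q1 PQ A mA.
apply: (measure_unique (@open (matrix R 1 n)) (fun=> setT)) => //.
- by move=> B C; exact: openI.
- by move=> _; exact: openT.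
- by rewrite bigcup_const.
- move=> B oB; have mB : measurable B by apply: sub_sigma_algebra.
  have [B0|/set0P B0] := eqVneq (~` B) set0.
    have -> : B = setT by rewrite -(setCK B) B0 setC0.
    by rewrite P1.
  have cvgB (m : {measure set E -> \bar R}) : m setT = 1%E ->
      \int[m]_u ramp B j u @[j --> \oo] --> fine (m B).
    move=> m1.
    have -> : fine (m B) = \int[m]_u \1_B u.
      by rewrite /Rintegral integral_indic// setIT.
    apply: (@Rintegral_bounded_cvg _ _ _ _ _ _ _ 1) => //.
    - by rewrite m1 ltry.
    - move=> j; apply: continuous_measurable_rV; exact: elip_continuous (ramp_lip j B0).
    - by move=> j u _; rewrite ger0_norm ?ramp_ge0// ramp_le1.
    - by move=> u _; exact: ramp_cvg.
  have fin (m : {measure set E -> \bar R}) : m setT = 1%E -> m B \is a fin_num.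
    move=> m1; rewrite ge0_fin_numE//; apply: (@le_lt_trans _ _ (m setT)).
      by apply: le_measure => //; rewrite inE.
    by rewrite m1 ltry.
  rewrite -(fineK (fin P P1)) -(fineK (fin Q Q1)); congr EFin.
  have cQ := cvgB _ Q1.
  have cP : \int[Q]_u ramp B j u @[j --> \oo] --> fine (P B).
    rewrite (_ : (fun j => \int[Q]_u ramp B j u) = (fun j => \int[P]_u ramp B j u)).
      exact: cvgB.
    apply/funext => j; apply/esym/(PQ _ j.+1%:R) => //; first exact: ramp_lip.
    by move=> u; rewrite ger0_norm ?ramp_ge0// ramp_le1.
  exact: (cvg_unique _ cP cQ).
- by move=> _; rewrite P1 ltry.
Qed.

End lipschitz_tests.

(** * Transport maps from optimal potentials *)

Section optimal_map.
Context (R : realType) (n m : nat).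
Local Notation E := 'rV[R]_n.
Variables (lam : 'I_m.+1 -> R) (p : E) (D : R) (S Y : set E).
Variables (rho : probability E R) (mu : 'I_m -> probability E R) (M : R).
Hypothesis bs : bary_setting lam p D Y.
Hypothesis SD : forall v, S v -> enorm (v - p) <= D.
Hypothesis mS : measurable S.
Hypothesis rS : rho S = 1%E.
Hypothesis S_neq0 : S !=set0.
Hypothesis cY : compact Y.
Hypothesis muY : forall i, mu i Y = 1%E.
Hypothesis M_ge0 : 0 <= M.
Hypothesis rhoM : forall A, measurable A -> (rho A <= M%:E * lebesgue_rV R n A)%E.
Implicit Types (x u v : E) (y z : 'I_m -> E) (f g : 'I_m -> E -> R).
Local Notation J := (dual_value lam p S Y rho mu).
Local Notation gap := (dual_gap lam p).
Local Notation pconj := (pconj lam p Y).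
Variable q : E.
Hypothesis Yq : Y q.
Variable f : 'I_m -> E -> R.
Hypothesis Kf : lipclass lam D q f.
Hypothesis fmin : forall g, lipclass lam D q g -> J f <= J g.
Let D_ge0 := bs_D bs.
Let mY : measurable Y := compact_measurable_rV cY.
Let nf := lipclass_admissible bs Yq Kf.
Let B := 2 * D * (2 * D).
Let fB : bounded_on Y f B := lipclass_bounded bs Yq Kf.
Let cf i : continuous (f i) := elip_continuous (Kf i).1.
Let F := pconj f.

Let fe x y : (forall j, Y (y j)) -> 0 <= gap F f x y.
Proof. exact: (pconj_feasible bs fB). Qed.

Let sd_ge0 t k x : 0 <= sdiff F t k x.
Proof.
by apply: (sdiff_ge0 _ _ (pconj_feasible bs fB)); exact: (pconj_near bs fB).
Qed.

Let t_ (j : nat) : R := j.+1%:R^-1.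

Let t_gt0 j : 0 < t_ j. Proof. by rewrite invr_gt0. Qed.
Let t_le1 j : t_ j <= 1. Proof. by rewrite invf_le1// ler1n. Qed.
Let t_small (e : R) : 0 < e -> exists j, t_ j < e.
Proof.
move=> e0; have [k0 _ /(_ k0 (leqnn k0)) h] := near_infty_natSinv_lt (PosNum e0).
by exists k0.
Qed.

Let sdsum j x := \sum_k sdiff F (t_ j) k x.
(** [N] contains the points of [S] where [pconj f] is not regular: there, for some
    [a], the second differences are at least [t_ a] times the step for all the
    steps [t_ j]. *)
Let bad (a : nat) := S `&` \bigcap_j [set x | t_ j * t_ a <= sdsum j x].
Let N := \bigcup_a bad a.

Let m_sdsum j : measurable_fun setT (sdsum j).
Proof. by apply: measurable_sum => k; exact: (measurable_sdiff bs fB). Qed.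

Let m_bad a : measurable (bad a).
Proof.
apply: measurableI => //; apply: bigcapT_measurable => j.
rewrite (_ : mkset _ = sdsum j @^-1` `[t_ j * t_ a, +oo[); last first.
  by apply/seteqP; split=> x /=; rewrite in_itv/= andbT.
by rewrite -[X in measurable X]setTI; apply: m_sdsum.
Qed.

Let mN : measurable N. Proof. exact: bigcupT_measurable. Qed.

(** Markov's inequality: on [bad a] the second differences at step [t_ j] add up to
    at least [t_ j * t_ a], whereas their integral is [O(t_ j ^+ 2)]. *)
Let rho_bad a : rho (bad a) = 0%E.
Proof.
apply/eqP; rewrite eq_le measure_ge0 andbT; apply/lee_addgt0Pr => e e0.
rewrite add0e.
set C := (t_ a)^-1 * (n%:R * sd_cst n D M).
have C0 : 0 <= C.
  by rewrite mulr_ge0 ?invr_ge0 ?(ltW (t_gt0 a))// mulr_ge0// (sd_cst_ge0 bs M_ge0).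
have [j hj] := t_small (divr_gt0 e0 (ltr_wpDl C0 ltr01)).
have ij : rho.-integrable S (EFin \o sdsum j).
  apply: integrable_sum_EFin => // k.
  exact: (integrable_sdiff bs SD mS M_ge0 rhoM fB k (ltW (t_gt0 j)) (t_le1 j)).
have h1 : \int[rho]_(x in S) sdsum j x <= n%:R * (sd_cst n D M * t_ j ^+ 2).
  rewrite Rintegral_sum//; last first.
    by move=> k; exact: (integrable_sdiff bs SD mS M_ge0 rhoM fB k (ltW (t_gt0 j)) (t_le1 j)).
  rewrite -sum_cst; apply: ler_sum => k _.
  exact: (Rintegral_sdiff bs SD mS M_ge0 rhoM fB k (ltW (t_gt0 j)) (t_le1 j)).
have h2 : t_ j * t_ a * fine (rho (bad a)) <= \int[rho]_(x in S) sdsum j x.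
  rewrite -Rintegral_cst//.
  apply: (@le_trans _ _ (\int[rho]_(x in bad a) sdsum j x)).
    apply: le_Rintegral => //.
    - apply: (@le_bound_integrable _ _ _ _ _ _ `|t_ j * t_ a|) => //.
      exact: prob_lty.
    - by apply: integrableS ij => // x [].
    - by move=> x [_ /(_ j I)].
  rewrite [leRHS](Rintegral_split mS (m_bad a) ij).
  have -> : S `&` bad a = bad a by apply/seteqP; split=> [x []|x []].
  by rewrite lerDl; apply: Rintegral_ge0 => x _; apply: sumr_ge0.
have rf : rho (bad a) \is a fin_num by rewrite ge0_fin_numE// (le_lt_trans (probability_le1 _ _)) ?ltry.
rewrite -(fineK rf) lee_fin.
have ta := t_gt0 a; have tj := t_gt0 j.
have h3 : fine (rho (bad a)) <= C * t_ j.
  rewrite -(ler_pM2l (mulr_gt0 tj ta)); apply: (le_trans h2); apply: (le_trans h1).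
  rewrite /C le_eqVlt; apply/orP; left; apply/eqP.
  by rewrite !mulrA [_ * t_ a]mulrC; field; rewrite !gt_eqF.
apply: (le_trans h3); have := ltW hj; rewrite (ler_pdivlMr _ _ (ltr_wpDl C0 ltr01)).
by have := ltW tj; move: (t_ j) C0 => s; lra.
Qed.

Let rhoN : rho N = 0%E.
Proof.
apply: measure_negligible; first exact: mN.
apply: (@negligible_bigcup _ _ _ rho bad) => a; exists (bad a); split.
- exact: m_bad.
- exact: rho_bad.
- by [].
Qed.

Let Om := S `\` N.

Let Om_regular x : Om x -> regular lam p Y f x.
Proof.
move=> [Sx nN] k a a0; have [b hb] := t_small a0.
have : ~ bad b x by move=> h; apply: nN; exists b.
move=> /not_andP[//|]; move=> /existsNP[j /not_implyP[_ /negP]].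
rewrite -ltNge => h; exists (t_ j) => //.
apply: (@le_lt_trans _ _ (sdsum j x)).
  by rewrite /sdsum (bigD1 k)//= lerDl sumr_ge0.
by apply: (lt_trans h); rewrite mulrC ltr_pM2r.
Qed.

(** The difference quotients of the conjugate when the [i]-th potential is
    perturbed in the direction [h]; the factor is [(t_ j)^-1]. *)
Let dq i (h : E -> R) j x := j.+1%:R * (F x - pconj (perturb f i h (t_ j)) x).

Let tK j : j.+1%:R * t_ j = 1.
Proof. by rewrite /t_ divff// gt_eqF. Qed.

Let dq_bounds x y i h L j : elip L h -> 0 <= L -> (forall j, Y (y j)) ->
  gap F f x y = 0 -> dq i h j x <= h (y i).
Proof.
move=> hL L0 Yy y0; have [[B' fB'] _] := admissible_perturb bs i (t_ j) nf hL L0.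
have := pconj_feasible bs fB' x Yy.
move=> gy; suff : F x - pconj (perturb f i h (t_ j)) x <= t_ j * h (y i).
  by rewrite -(ler_pM2l (ltr0Sn R j)) mulrA tK mul1r.
move: y0 gy; rewrite /dual_gap /perturb sum_updf -/F; lra.
Qed.

(** An envelope theorem: an almost maximal family [z] of the perturbed problem has
    a gap of order [t_ j], so it is close to [y] by [near_argmax], and the quotient
    lies between [h (z i) - t_ j] and [h (y i)]. *)
Let dq_cvg x y i h L : elip L h -> 0 <= L -> regular lam p Y f x ->
  (forall j, Y (y j)) -> gap F f x y = 0 -> dq i h ^~ x @ \oo --> h (y i).
Proof.
move=> hL L0 rx Yy y0; apply/cvgrPdist_le => /= e e0.
have [Bh hB] := elip_bounded bs hL L0.
have Bh0 : 0 <= Bh := le_trans (normr_ge0 _) (hB _ Yq).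
have eta0 : 0 < e / (2 * (L + 1)) by rewrite divr_gt0// mulr_gt0// ltr_wpDl.
have [d d0 near] := near_argmax bs nf i rx Yy y0 eta0.
have [j1 hj1] := t_small (divr_gt0 d0 (ltr_wpDl (mulr_ge0 (ler0n R 2) Bh0) ltr01)).
have [j2 hj2] : exists j, t_ j < e / 2 by apply: t_small; rewrite divr_gt0.
exists (maxn j1 j2) => // j /=; rewrite geq_max => /andP[j1j j2j].
have t1 : t_ j <= t_ j1 by rewrite lef_pV2 ?posrE// ler_nat.
have t2 : t_ j <= t_ j2 by rewrite lef_pV2 ?posrE// ler_nat.
have tj := t_gt0 j.
have up := dq_bounds i j hL L0 Yy y0.
rewrite ler_norml; apply/andP; split; first by move: up; have := ltW e0; lra.
have [[B' fB'] _] := admissible_perturb bs i (t_ j) nf hL L0.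
have [z Yz zle] := pconj_near bs fB' x (exprn_gt0 2 tj).
have fz := pconj_feasible bs fB' x Yy.
have hz := hB _ (Yz i); have hy := hB _ (Yy i).
have gz : gap F f x z <= d.
  have : t_ j * (2 * Bh + 1) <= d.
    move: (le_trans t1 (ltW hj1)); rewrite ler_pdivlMr// ltr_wpDl// mulr_ge0//.
  move: zle fz y0; rewrite /dual_gap /perturb !sum_updf -/F.
  have tt : t_ j ^+ 2 <= t_ j by rewrite expr2 ler_piMl// ?ltW// t_le1.
  have h1 : t_ j * (h (y i) - h (z i)) <= t_ j * (2 * Bh).
    rewrite ler_pM2l//; move: hz hy; rewrite !ler_norml.
    by move=> /andP[? ?] /andP[? ?]; lra.
  lra.
have zy := near _ Yz gz.
have hzy : h (y i) - h (z i) <= e / 2.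
  apply: (le_trans (ler_norm _)); apply: (le_trans (hL _ _)); rewrite enormB.
  apply: (le_trans (ler_wpM2l L0 zy)).
  have -> : L * (e / (2 * (L + 1))) = (L / (L + 1)) * (e / 2).
    by field; rewrite gt_eqF// ltr_wpDl.
  apply: ler_piMl; first by rewrite divr_ge0// ltW.
  have L1 : 0 < L + 1 by rewrite ltr_wpDl.
  by rewrite (ler_pdivrMr _ _ L1) mul1r lerDl.
have dql : h (z i) - t_ j <= dq i h j x.
  suff : t_ j * (h (z i) - t_ j) <= F x - pconj (perturb f i h (t_ j)) x.
    by rewrite -(ler_pM2l (ltr0Sn R j)) mulrA tK mul1r.
  have := fe x Yz; move: zle; rewrite /dual_gap /perturb sum_updf -/F expr2; lra.
have := le_trans t2 (ltW hj2); lra.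
Qed.

Let m_dq i h L j : elip L h -> 0 <= L -> measurable_fun setT (dq i h j).
Proof.
move=> hL L0; have [[B' fB'] _] := admissible_perturb bs i (t_ j) nf hL L0.
apply: measurable_funM => //; apply: measurable_funB.
  exact: (measurable_pconj bs fB).
exact: (measurable_pconj bs fB').
Qed.

Let dq_norm i h L Bh j x : elip L h -> 0 <= L -> (forall u, Y u -> `|h u| <= Bh) ->
  `|dq i h j x| <= Bh.
Proof.
move=> hL L0 hB; have np := admissible_perturb bs i (t_ j) nf hL L0.
have tj := t_gt0 j.
have bnd u : Y u -> - (t_ j * Bh) <= t_ j * h u <= t_ j * Bh.
  move=> Yu; rewrite -mulrN !ler_pM2l// -ler_norml; exact: hB.
have h1 : F x <= pconj (perturb f i h (t_ j)) x + t_ j * Bh.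
  apply: (pconj_mono bs np.1 nf.1) => y Yy; rewrite /perturb sum_updf.
  by have /andP[] := bnd _ (Yy i); lra.
have h2 : pconj (perturb f i h (t_ j)) x <= F x + t_ j * Bh.
  apply: (pconj_mono bs nf.1 np.1) => y Yy; rewrite /perturb sum_updf.
  by have /andP[] := bnd _ (Yy i); lra.
rewrite /dq normrM ger0_norm// -[leRHS]mul1r -[X in _ <= X * _](tK j) -mulrA.
by rewrite ler_pM2l// ler_norml; apply/andP; split; lra.
Qed.

Let mOm : measurable Om. Proof. exact: measurableD. Qed.

(** The map of maximizers is measurable as the limit of the difference quotients
    for the coordinate functions.  In the limit, minimality of [f] says that the
    integral of [h (T i x)] is at most that of [h] against [mu i]; with [- h]
    this is an equality, and Lipschitz functions determine the image measure. *)
Lemma optimal_map_exists : exists T : 'I_m -> E -> E,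
  (forall i, transport_map S Y rho (mu i) (T i)) /\
  \int[rho]_(x in S) gap F f x (T ^~ x) = 0.
Proof.
have /choice[T0 hT0] x : exists y, (forall i, Y (y i)) /\ gap F f x y = 0.
  by have [y Yy y0] := argmax_exists bs cY Yq nf cf x; exists y.
(* [Om] is the set of regular points of [S], of full measure *)
pose T i x := if x \in Om then T0 x i else q.
have TY i x : Y (T i x) by rewrite /T; case: ifP => // _; exact: (hT0 x).1.
have TE x : Om x -> T ^~ x = T0 x.
  by move=> Ox; apply/funext => i; rewrite /T mem_set.
have SOm : S `&` Om = Om by apply/seteqP; split=> [x []|x []].
have OmS : Om `<=` S by move=> x [].
have cvgT i h L x : elip L h -> 0 <= L -> Om x -> dq i h ^~ x @ \oo --> h (T i x).
  move=> hL L0 Ox; have -> : T i x = T0 x i by rewrite /T mem_set.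
  exact: (dq_cvg hL L0 (Om_regular Ox) (hT0 x).1 (hT0 x).2).
have mTO i : measurable_fun Om (T i).
  apply: measurable_rV_on => // k.
  have eL : elip 1 (fun u : E => u ord0 k).
    by move=> u v; rewrite mul1r; have := coord_le_enorm (u - v) k; rewrite !mxE.
  apply: (@measurable_fun_cvg _ _ _ _ (dq i (fun u => u ord0 k))).
    by move=> j; apply: measurable_funTS; exact: m_dq eL _.
  by move=> x Ox; exact: (cvgT _ _ _ _ eL).
have mT i : measurable_fun setT (T i).
  apply: measurable_extend => //; apply: (eq_measurable_fun (T i)) => // x xO.
  by rewrite /T xO.
have intOm (h : E -> R) : rho.-integrable S (EFin \o h) ->
    \int[rho]_(x in S) h x = \int[rho]_(x in Om) h x.
  by move=> ih; rewrite /Rintegral (negligible_integral mN mS ih rhoN).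
have test i h L : elip L h -> 0 <= L ->
    \int[rho]_(x in Om) h (T i x) <= \int[mu i]_(u in Y) h u.
  move=> hL L0; have [Bh hB] := elip_bounded bs hL L0.
  have mh := continuous_measurable_rV (elip_continuous hL).
  have bd j : forall x, Om x -> `|dq i h j x| <= Bh.
    by move=> x _; exact: dq_norm hL L0 hB.
  have cv : \int[rho]_(x in Om) dq i h j x @[j --> \oo] --> \int[rho]_(x in Om) h (T i x).
    apply: (@Rintegral_bounded_cvg _ _ _ _ _ _ _ Bh) => //.
    - exact: prob_lty.
    - by move=> j; apply: measurable_funTS; exact: m_dq hL L0.
    - by move=> x Ox; exact: cvgT hL L0 Ox.
  apply: (cvgr_to_le cv); apply: nearW => j.
  have np := admissible_perturb bs i (t_ j) nf hL L0.
  have iF := admissible_pconj rho bs SD mS nf; have iP := admissible_pconj rho bs SD mS np.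
  have idq : rho.-integrable S (EFin \o dq i h j).
    apply: integrableZl_EFin => //.
    by have := integrableB mS iF iP; apply: eq_integrable.
  rewrite -intOm// /dq RintegralZl//; last first.
    by have := integrableB mS iF iP; apply: eq_integrable.
  rewrite RintegralB//.
  have := perturb_ge bs SD mS rS S_neq0 cY muY Yq i (t_ j) Kf fmin hL L0.
  rewrite /dual_value.
  have ih : (mu i).-integrable Y (EFin \o h).
    apply: (@le_bound_integrable _ _ _ _ _ _ Bh) => //.
    - exact: prob_lty.
    - exact: measurable_funTS.
  have -> : \sum_i0 \int[mu i0]_(u in Y) perturb f i h (t_ j) i0 u =
      \sum_i0 \int[mu i0]_(u in Y) f i0 u + t_ j * \int[mu i]_(u in Y) h u.
    rewrite (bigD1 i)//= [in RHS](bigD1 i)//= {1}/perturb /updf eqxx.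
    rewrite RintegralD//; last 2 first.
    - exact: (admissible_integrable mu cY i nf).
    - exact: integrableZl_EFin.
    rewrite RintegralZl// -!addrA; congr (_ + _); rewrite addrC; congr (_ + _).
    by apply: eq_bigr => k /negbTE ki; rewrite /perturb /updf ki.
  move=> H; rewrite -[leRHS]mul1r -[X in _ <= X * _](tK j) -mulrA ler_pM2l//.
  move: H; rewrite -/F; lra.
have testE i h L : elip L h -> 0 <= L ->
    \int[rho]_(x in Om) h (T i x) = \int[mu i]_(u in Y) h u.
  move=> hL L0; apply/eqP; rewrite eq_le (test i h L)//=.
  have hN : elip L (fun u => -1 * h u).
    by move=> u v; rewrite -mulrBr normrM normrN1 mul1r.
  have [Bh hB] := elip_bounded bs hL L0.
  have mh := continuous_measurable_rV (elip_continuous hL).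
  have := test i _ _ hN L0.
  rewrite RintegralZl//; last first.
    apply: (@le_bound_integrable _ _ _ _ _ _ Bh) => //.
    - exact: prob_lty.
    - exact: measurableT_comp.
    - by move=> x _; exact: hB.
  rewrite RintegralZl//; last first.
    apply: (@le_bound_integrable _ _ _ _ _ _ Bh) => //.
    - exact: prob_lty.
    - exact: measurable_funTS.
  lra.
exists T; split; last first.
  rewrite intOm; last first.
    apply: (integrable_gap rho bs SD mS fB nf.2) => //.
    by move=> i; exact: measurable_funTS.
  rewrite (@eq_Rintegral _ _ _ rho Om (fun=> 0)); last first.
    by move=> x; rewrite inE => Ox; rewrite TE// (hT0 x).2.
  by rewrite Rintegral_cst// mul0r.
move=> i; split.
- exact: measurable_funTS.
- by move=> _ [x _ <-]; exact: TY.
- move=> A mA.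
  pose P := measure_function_pushforward__canonical__measure_function_Measure rho (mT i).
  have -> : rho (S `&` T i @^-1` A) = P A.
    by rewrite (prob_setI mS rS)// -[X in measurable X]setTI; exact: (mT i).
  apply: eq_measure_elip => //.
  - exact: probability_setT.
  - exact: probability_setT.
  - move=> h L hL L0 h1.
    have mh := continuous_measurable_rV (elip_continuous hL).
    have hi (Q : probability E R) (v : E -> E) : measurable_fun setT v ->
        Q.-integrable setT (EFin \o (h \o v)).
      move=> mv; apply: (@le_bound_integrable _ _ _ _ _ _ 1) => //.
      - exact: prob_lty.
      - exact: measurableT_comp.
      - by move=> x _; exact: h1.
    rewrite (Rintegral_full mY (muY i) (hi _ id _))// -(testE i h L hL L0).
    rewrite {2}/Rintegral (integral_pushforward (mT i) (f := EFin \o h))//.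
    + by rewrite preimage_setT [RHS](Rintegral_full mS rS (hi _ _ (mT i))) intOm//;
        apply: integrableS (hi _ _ (mT i)).
    + exact/measurable_EFinP.
    + exact: (hi _ _ (mT i)).
Qed.

End optimal_map.

(** * Transport maps, couplings and Lipschitz functions *)

Section transport.
Context (R : realType) (n : nat).
Local Notation E := 'rV[R]_n.
Variables (S Y : set E) (rho : probability E R).
Hypothesis mS : measurable S.
Hypothesis rS : rho S = 1%E.
Hypothesis mY : measurable Y.

Lemma transport_integral (mu : probability E R) (T : E -> E) (q : E) (h : E -> R) B :
  Y q -> transport_map S Y rho mu T -> measurable_fun setT h ->
  (forall u, Y u -> `|h u| <= B) ->
  \int[rho]_(x in S) h (T x) = \int[mu]_(u in Y) h u.
Proof.
move=> Yq [mT TY muT] mh hB.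
pose T' x := if x \in S then T x else q.
have TS x : S x -> T' x = T x by move=> Sx; rewrite /T' mem_set.
have T'Y x : Y (T' x).
  by rewrite /T'; case: ifPn => // /set_mem Sx; apply: TY; exists x.
have mT' : measurable_fun setT T' by exact: measurable_extend.
pose P := measure_function_pushforward__canonical__measure_function_Measure rho mT'.
have T'V : T' @^-1` Y = setT by apply/seteqP; split=> // x _; exact: T'Y.
have ih : rho.-integrable setT (EFin \o (h \o T')).
  apply: (@le_bound_integrable _ _ _ _ _ _ B) => //.
  - exact: prob_lty.
  - exact: measurableT_comp.
  - by move=> x _; exact: hB.
transitivity (\int[rho]_(x in S) (h \o T') x).
  by apply: eq_Rintegral => x; rewrite inE => Sx /=; rewrite TS.
rewrite -(Rintegral_full mS rS ih) /Rintegral; congr fine.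
transitivity (\int[P]_(u in Y) (h u)%:E)%E.
  rewrite (integral_pushforward mT' (f := EFin \o h))//.
  - by rewrite T'V.
  - exact/measurable_EFinP.
  - by rewrite T'V.
apply: eq_measure_integral => A mA AY; rewrite /P /= /pushforward muT//.
rewrite -(prob_setI mS rS); last by rewrite -[X in measurable X]setTI; apply: (mT' measurableT _ mA).
by congr (rho _); apply/seteqP; split=> x [Sx]; rewrite /= ?TS// => h'; split=> //; rewrite TS.
Qed.

End transport.

Section kantorovich.
Context (R : realType) (n : nat).
Local Notation E := 'rV[R]_n.

Lemma wasserstein1_ge0 (mu nu : probability E R) : (0 <= wasserstein1 mu nu)%E.
Proof.
apply: le_ereal_inf_tmp => _ [g _ <-]; apply: integral_ge0 => z _.
by rewrite lee_fin enorm_ge0.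
Qed.

(** The easy half of the Kantorovich duality: integrate [h z.1 - h z.2] against a
    coupling, which is carried by the product of [Y] with itself. *)
Lemma wasserstein1_dual (Y : set E) (mu nu : probability E R) (h : E -> R) (L B : R) :
  measurable Y -> mu Y = 1%E -> nu Y = 1%E -> elip L h -> 0 < L ->
  (forall u, Y u -> `|h u| <= B) ->
  ((\int[mu]_(u in Y) h u - \int[nu]_(u in Y) h u)%:E <= L%:E * wasserstein1 mu nu)%E.
Proof.
move=> mY muY nuY hL L0 hB; rewrite muleC -lee_pdivrMr//.
apply: le_ereal_inf_tmp => _ [g [g1 g2] <-]; rewrite lee_pdivrMr// muleC.
have mh := continuous_measurable_rV (elip_continuous hL).
have m1 : measurable_fun setT (fst : E * E -> E) by exact: measurable_fst.
have m2 : measurable_fun setT (snd : E * E -> E) by exact: measurable_snd.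
have mY1 : measurable ((fst : E * E -> E) @^-1` Y).
  by rewrite -[X in measurable X]setTI; exact: m1.
have mY2 : measurable ((snd : E * E -> E) @^-1` Y).
  by rewrite -[X in measurable X]setTI; exact: m2.
pose Z := (fst : E * E -> E) @^-1` Y `&` (snd : E * E -> E) @^-1` Y.
have mZ : measurable Z by exact: measurableI.
have bi (phi : E * E -> E) : measurable_fun setT phi -> forall D, measurable D ->
    D `<=` phi @^-1` Y -> g.-integrable D (EFin \o (h \o phi)).
  move=> mphi D mD DY; apply: (@le_bound_integrable _ _ _ _ _ _ B) => //.
  - exact: prob_lty.
  - by apply: measurable_funTS; exact: measurableT_comp.
  - by move=> x Dx; apply: hB; exact: DY.
have push (m : probability E R) (phi psi : E * E -> E) : measurable_fun setT phi ->
    measurable (phi @^-1` Y) -> measurable (psi @^-1` Y) ->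
    (forall A, measurable A -> g (phi @^-1` A) = m A) ->
    g (psi @^-1` Y) = 1%E -> Z = phi @^-1` Y `\` ~` (psi @^-1` Y) ->
    \int[m]_(u in Y) h u = \int[g]_(z in Z) h (phi z).
  move=> mphi mY1' mY2' gm gpsi ZE.
  pose P := measure_function_pushforward__canonical__measure_function_Measure g mphi.
  rewrite /Rintegral; congr fine.
  transitivity (\int[P]_(u in Y) (h u)%:E)%E.
    by apply: eq_measure_integral => A mA _; rewrite /P /= /pushforward gm.
  have i1 := bi phi mphi _ mY1' (@subset_refl _ _).
  rewrite (integral_pushforward mphi (f := EFin \o h))//; last exact/measurable_EFinP.
  have g0 : g (~` (psi @^-1` Y)) = 0%E by rewrite probability_setC// gpsi subee.
  by rewrite ZE (negligible_integral (measurableC mY2') mY1' i1 g0).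
rewrite (push mu fst snd)//; last 2 first.
- by rewrite g2.
- by rewrite setDE setCK.
rewrite (push nu snd fst)//; last 2 first.
- by rewrite g1.
- by rewrite setDE setCK setIC.
have i1 := bi fst m1 Z mZ (@subIsetl _ _ _).
have i2 := bi snd m2 Z mZ (@subIsetr _ _ _).
rewrite -RintegralB// -[leLHS]fineK//.
have i12 : g.-integrable Z (EFin \o (fun z => h z.1 - h z.2)).
  by have := integrableB mZ i1 i2; apply: eq_integrable.
rewrite /= fineK; last exact: (integrable_fin_num mZ i12).
have me : measurable_fun setT (fun z : E * E => (enorm (z.1 - z.2))%:E).
  apply/measurable_EFinP; apply: measurableT_comp.
    by apply: continuous_measurable_rV; exact: continuous_enorm.
  apply: measurable_rV => k; under eq_fun do rewrite !mxE.
  apply: measurable_funB.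
    exact: measurableT_comp (measurable_coord k) m1.
  exact: measurableT_comp (measurable_coord k) m2.
rewrite -ge0_integralZl//; last 2 first.
- by move=> z _; rewrite lee_fin enorm_ge0.
- by rewrite lee_fin ltW.
apply: (@le_trans _ _ (\int[g]_(z in Z) (L%:E * (enorm (z.1 - z.2))%:E))%E).
  apply: (le_trans (lee_abs _)).
  apply: (le_trans (le_abse_integral g mZ (measurable_int _ i12))).
  apply: ge0_le_integral => //.
  - by apply: measurableT_comp => //; exact: measurable_int i12.
  - by apply: measurable_funTS; exact: measurable_funeM.
  - by move=> z _ /=; rewrite -EFinM lee_fin.
apply: ge0_subset_integral => //.
- exact: measurable_funeM.
- by move=> z _; rewrite mule_ge0 ?lee_fin ?enorm_ge0// ltW.
Qed.

End kantorovich.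

(** * The gaps of optimal families *)

Section stability.
Context (R : realType) (n m : nat).
Local Notation E := 'rV[R]_n.
Variables (lam : 'I_m.+1 -> R) (p : E) (D : R) (S Y : set E).
Variables (rho : probability E R) (M : R).
Hypothesis bs : bary_setting lam p D Y.
Hypothesis SD : forall v, S v -> enorm (v - p) <= D.
Hypothesis mS : measurable S.
Hypothesis rS : rho S = 1%E.
Hypothesis S_neq0 : S !=set0.
Hypothesis cY : compact Y.
Hypothesis M_ge0 : 0 <= M.
Hypothesis rhoM : forall A, measurable A -> (rho A <= M%:E * lebesgue_rV R n A)%E.
Implicit Types (x u v q : E) (f : 'I_m -> E -> R) (T : 'I_m -> E -> E)
  (mu : 'I_m -> probability E R).
Local Notation l i := (lam (lift ord0 i)).
Local Notation J := (dual_value lam p S Y rho).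
Local Notation admissible := (admissible Y).
Local Notation bar := (bary_sum lam p).
Local Notation gap := (dual_gap lam p).
Local Notation pconj := (pconj lam p Y).
Local Notation lipc := (lip_cst lam D).
Local Notation I2 T := (\int[rho]_(x in S) dot (bar x (T ^~ x)) (bar x (T ^~ x))).
Local Notation gapint f T := (\int[rho]_(x in S) gap (pconj f) f x (T ^~ x)).
Let D_ge0 := bs_D bs.
Let mY : measurable Y := compact_measurable_rV cY.

Definition transports (mu : 'I_m -> probability E R) T :=
  forall i, transport_map S Y rho (mu i) (T i).

Lemma transports_in mu T x i : transports mu T -> S x -> Y (T i x).
Proof. by move=> h Sx; have [_ TY _] := h i; apply: TY; exists x. Qed.

Lemma transports_meas mu T i : transports mu T -> measurable_fun S (T i).
Proof. by move=> h; have [] := h i. Qed.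

Lemma measurable_sqdist : measurable_fun setT (fun u : E => dot (u - p) (u - p)).
Proof.
apply: measurable_dot; apply: measurable_rV => k; under eq_fun do rewrite !mxE;
  by apply: measurable_funB => //; exact: measurable_coord.
Qed.

Lemma sqdist_le u : enorm (u - p) <= D -> `|dot (u - p) (u - p)| <= D ^+ 2.
Proof. by move=> uD; rewrite ger0_norm ?dot_ge0// -enorm_le. Qed.

Let int_sqS : rho.-integrable S (EFin \o (fun x => dot (x - p) (x - p))).
Proof.
apply: (@le_bound_integrable _ _ _ _ _ _ (D ^+ 2)) => //.
- exact: prob_lty.
- by apply: measurable_funTS; exact: measurable_sqdist.
- by move=> x Sx; apply: sqdist_le; exact: SD.
Qed.

Let int_sqT mu T i : transports mu T ->
  rho.-integrable S (EFin \o (fun x => dot (T i x - p) (T i x - p))).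
Proof.
move=> hT; apply: (@le_bound_integrable _ _ _ _ _ _ (D ^+ 2)) => //.
- exact: prob_lty.
- apply: (measurableT_comp measurable_sqdist); exact: transports_meas hT.
- by move=> x Sx; apply: sqdist_le; apply: (bs_Y bs); exact: transports_in hT Sx.
Qed.

Let int_bar mu T : transports mu T ->
  rho.-integrable S (EFin \o (fun x => dot (bar x (T ^~ x)) (bar x (T ^~ x)))).
Proof.
move=> hT; apply: (integrable_dot_bar rho bs SD mS).
  by move=> i; exact: transports_meas hT.
by move=> x Sx i; exact: transports_in hT Sx.
Qed.

(** The maps enter only through the last term of [bary_costE]; the others integrate
    against the marginals. *)
Lemma multi_costE mu T : transports mu T ->
  multi_cost lam S rho T =
  (2^-1 * (lam ord0 * \int[rho]_(x in S) dot (x - p) (x - p) +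
    \sum_i l i * \int[mu i]_(u in Y) dot (u - p) (u - p)) - 2^-1 * I2 T)%:E.
Proof.
move=> hT; rewrite /multi_cost.
under eq_integral do rewrite (bary_costE p _ _ (bs_sum bs)).
have iT i := int_sqT i hT.
have i1 : rho.-integrable S (EFin \o (fun x =>
    \sum_i l i * dot (T i x - p) (T i x - p))).
  apply: (integrable_sum_EFin _ mS (f := fun i x => l i * dot (T i x - p) (T i x - p))) => i.
  exact: integrableZl_EFin.
have i2 := integrableZl_EFin (lam ord0) mS int_sqS.
have i3 := integrableZl_EFin 2^-1 mS (integrableD_EFin mS i2 i1).
have i4 := integrableZl_EFin 2^-1 mS (int_bar hT).
have i5 : rho.-integrable S (EFin \o (fun x =>
   2^-1 * (lam ord0 * dot (x - p) (x - p) + \sum_i l i * dot (T i x - p) (T i x - p))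
   - 2^-1 * dot (bar x (T ^~ x)) (bar x (T ^~ x)))).
  by have := integrableB mS i3 i4; apply: eq_integrable.
rewrite -[LHS]fineK; last exact: (integrable_fin_num mS i5).
congr EFin; transitivity (\int[rho]_(x in S) (2^-1 * (lam ord0 * dot (x - p) (x - p) +
   \sum_i l i * dot (T i x - p) (T i x - p)) -
   2^-1 * dot (bar x (T ^~ x)) (bar x (T ^~ x)))) => //.
rewrite RintegralB//.
rewrite RintegralZl//; last exact: integrableD_EFin.
rewrite RintegralZl//; last exact: int_bar.
rewrite RintegralD// RintegralZl//.
rewrite (Rintegral_sum _ mS (f := fun i x => l i * dot (T i x - p) (T i x - p))); last first.
  by move=> i; exact: integrableZl_EFin.
congr (_ * (_ + _) - _); apply: eq_bigr => i _; rewrite RintegralZl//; congr (_ * _).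
have [q Yq] := bs_neq0 bs.
apply: (@transport_integral _ _ _ _ _ mS rS mY (mu i) (T i) q (fun u => dot (u - p) (u - p)) (D ^+ 2)) => //.
  exact: measurable_sqdist.
by move=> u Yu; apply: sqdist_le; exact: (bs_Y bs).
Qed.

Lemma gapintE f mu T : admissible f -> transports mu T ->
  gapint f T = J mu f - 2^-1 * I2 T.
Proof.
move=> nf hT; have [[B fB] mf] := nf.
rewrite (Rintegral_gap rho bs SD mS fB mf); last 2 first.
- by move=> i; exact: transports_meas hT.
- by move=> x Sx i; exact: transports_in hT Sx.
congr (_ + _ - _); apply: eq_bigr => i _.
have [q Yq] := bs_neq0 bs.
exact: (transport_integral mS rS mY Yq (hT i) (mf i) (fB i)).
Qed.

Lemma gapint_ge0 f mu T : admissible f -> transports mu T -> 0 <= gapint f T.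
Proof.
move=> [[B fB] mf] hT; apply: Rintegral_ge0 => x Sx.
by apply: (pconj_feasible bs fB) => i; exact: transports_in hT Sx.
Qed.

(** Among families with the same marginals, the cost and the integrated gap differ by
    a constant, and [optimal_map_exists] provides a competitor of zero gap. *)
Lemma optimal_gap0 q mu T : Y q -> (forall i, mu i Y = 1%E) ->
  multi_ot_maps lam S Y rho mu T ->
  exists2 f, lipclass lam D q f & gapint f T = 0.
Proof.
move=> Yq muY [hT optT].
have [f Kf fmin] := dual_minimizer bs SD mS rS cY muY Yq.
exists f => //; have nf := lipclass_admissible bs Yq Kf.
have [T' [hT' gT']] := optimal_map_exists bs SD mS rS S_neq0 cY muY M_ge0 rhoM Yq Kf fmin.
have := optT T' hT'; rewrite (multi_costE hT) (multi_costE hT') lee_fin.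
have := gapint_ge0 nf hT; rewrite (gapintE nf hT); move: gT'; rewrite (gapintE nf hT').
by move=> h1 h2 h3; lra.
Qed.

(** In the sum of the two crossed gaps the conjugates and the squares cancel, as
    each family has zero gap for its own potentials.  What remains is the integral
    of [f' i - f i] against [mu i - mu' i]. *)
Lemma gap_sum_le q mu mu' T T' : 0 < D -> Y q ->
  (forall i, mu i Y = 1%E) -> (forall i, mu' i Y = 1%E) ->
  multi_ot_maps lam S Y rho mu T -> multi_ot_maps lam S Y rho mu' T' ->
  exists f, [/\ lipclass lam D q f, gapint f T = 0 &
   ((gapint f T')%:E <= (4 * D)%:E * \sum_i (l i)%:E * wasserstein1 (mu i) (mu' i))%E].
Proof.
move=> D0 Yq muY muY' oT oT'.
have [f Kf f0] := optimal_gap0 Yq muY oT; have [f' Kf' f0'] := optimal_gap0 Yq muY' oT'.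
exists f; split => //.
have nf := lipclass_admissible bs Yq Kf; have nf' := lipclass_admissible bs Yq Kf'.
have [hT _] := oT; have [hT' _] := oT'.
have g'0 := gapint_ge0 nf' hT.
apply: (@le_trans _ _ (gapint f T' + gapint f' T)%:E); first by rewrite lee_fin lerDl.
have -> : gapint f T' + gapint f' T =
    \sum_i ((\int[mu i]_(u in Y) (-1 * f i u) - \int[mu' i]_(u in Y) (-1 * f i u)) +
     (\int[mu i]_(u in Y) f' i u - \int[mu' i]_(u in Y) f' i u)).
  move: f0 f0'; rewrite (gapintE nf hT) (gapintE nf' hT') (gapintE nf hT') (gapintE nf' hT).
  rewrite /dual_value !big_split/= !sumrN.
  have h (P : 'I_m -> probability E R) : \sum_i \int[P i]_(u in Y) (-1 * f i u) =
      - \sum_i \int[P i]_(u in Y) f i u.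
    rewrite -sumrN; apply: eq_bigr => i _.
    by rewrite RintegralZl ?mulN1r//; exact: (admissible_integrable P cY i nf).
  rewrite !h; lra.
rewrite -sumEFin ge0_sume_distrr; last first.
  by move=> i _; rewrite mule_ge0 ?wasserstein1_ge0// lee_fin ltW// (bs_gt0 bs).
apply: lee_sum => i _.
have L0 : 0 < lipc i by rewrite !mulr_gt0// (bs_gt0 bs).
have fBi := lipclass_bounded bs Yq Kf i; have fBi' := lipclass_bounded bs Yq Kf' i.
have e1 : elip (lipc i) (fun u => -1 * f i u).
  by move=> u v; rewrite -mulrBr normrM normrN1 mul1r; exact: (Kf i).1.
have fBN u : Y u -> `|-1 * f i u| <= 2 * D * (2 * D).
  by move=> Yu; rewrite mulN1r normrN; exact: fBi.
have w1 := wasserstein1_dual mY (muY i) (muY' i) e1 L0 fBN.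
have w2 := wasserstein1_dual mY (muY i) (muY' i) (Kf' i).1 L0 fBi'.
rewrite EFinD.
have -> : ((4 * D)%:E * ((l i)%:E * wasserstein1 (mu i) (mu' i)) =
   (lipc i)%:E * wasserstein1 (mu i) (mu' i) + (lipc i)%:E * wasserstein1 (mu i) (mu' i))%E.
  rewrite -ge0_muleDl ?lee_fin ?ltW// -EFinD muleA -EFinM; congr (_%:E * _)%E.
  by rewrite /lip_cst; ring.
exact: leeD.
Qed.

End stability.

(** * Stability with exponent one quarter *)

Section L2.
Context (R : realType) (n : nat).
Local Notation E := 'rV[R]_n.

Lemma L2_distE (S : set E) (rho : probability E R) (T T' : E -> E) :
  rho.-integrable S (EFin \o (fun x => dot (T x - T' x) (T x - T' x))) ->
  measurable S ->
  L2_dist S rho T T' =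
  (Num.sqrt (\int[rho]_(x in S) dot (T x - T' x) (T x - T' x)))%:E.
Proof.
move=> iT mS; rewrite /L2_dist unlock.
set I := Rintegral _ _ _; have -> : (\int[rho]_x `|((fun x => (enorm (T x - T' x))%:E) \_ S) x| `^ 2)%E = I%:E.
  rewrite /I /Rintegral fineK; last exact: (integrable_fin_num mS iT).
  rewrite [RHS]integral_mkcond; apply: eq_integral => x _.
  rewrite /patch; case: ifPn => _.
    by rewrite /= ger0_norm ?enorm_ge0// powR_mulrn ?enorm_ge0// sqr_enorm.
  by rewrite abse0 poweRE /= powR0// pnatr_eq0.
rewrite poweR_EFin powR12_sqrt//.
by apply: Rintegral_ge0 => x _; exact: dot_ge0.
Qed.

Lemma compact_enorm_bounded (A : set E) (p : E) : compact A ->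
  exists B, forall x, A x -> enorm (x - p) <= B.
Proof.
move=> cA; have [->|/set0P A0] := eqVneq A set0; first by exists 0.
have cE : continuous (fun x : E => enorm (x - p)).
  apply: (@elip_continuous _ _ 1) => a b.
  rewrite mul1r ler_norml; have := ler_enorm_dist a b p.
  by have := ler_enorm_dist b a p; rewrite (enormB b a) => h1 h2; apply/andP; split; lra.
have [c _ hc] := compact_EVT_max A0 cA (continuous_subspaceT cE).
by exists (enorm (c - p)) => x Ax; apply: hc; rewrite inE.
Qed.

Lemma enorm_le_ediam (A : set E) (p x : E) : A p -> A x ->
  (exists B, forall x, A x -> enorm (x - p) <= B) -> enorm (x - p) <= ediam A.
Proof.
move=> Ap Ax [B AB]; apply: ub_le_sup; last by exists x => //; exists p.
exists (B + B) => _ [u Au] [v Av <-].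
by apply: (le_trans (ler_enorm_dist _ p _)); rewrite (enormB p) lerD// AB.
Qed.

End L2.

Section positive.
Context (R : realType).

(** The last term is a trivial bound by the diameter, for marginals that are far
    apart: the step [t] of [gap_stability] is at most 1. *)
Definition stab_cst (n m : nat) (l D M : R) : R :=
  let A := 4 * D * n%:R * sd_cst n D M in
  let B := 4 * D * n%:R + 2 in
  (A + B * (4 * D)) / l + (2 * D) ^+ 2.

Lemma root4 (W : R) : 0 <= W -> (W `^ 4^-1) ^+ 4 = W.
Proof. by move=> W0; rewrite -powR_mulrn ?powR_ge0// -powRrM mulVf// powRr1. Qed.

(** The step [t = sqrt W] balances the two error terms of [gap_stability]. *)
Lemma map_stability (n m : nat) (lam : 'I_m.+1 -> R) (p q : 'rV[R]_n) (D : R)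
    (S Y : set 'rV[R]_n) (rho : probability 'rV[R]_n R) (M W : R)
    (mu mu' : 'I_m -> probability 'rV[R]_n R) T T' i :
  bary_setting lam p D Y -> (forall v, S v -> enorm (v - p) <= D) ->
  measurable S -> rho S = 1%E -> S !=set0 -> compact Y -> 0 <= M ->
  (forall A, measurable A -> (rho A <= M%:E * lebesgue_rV R n A)%E) ->
  0 < D -> Y q -> (forall i, mu i Y = 1%E) -> (forall i, mu' i Y = 1%E) ->
  multi_ot_maps lam S Y rho mu T -> multi_ot_maps lam S Y rho mu' T' ->
  (\sum_i (lam (lift ord0 i))%:E * wasserstein1 (mu i) (mu' i))%E = W%:E ->
  ((lam (lift ord0 i))%:E * L2_dist S rho (T i) (T' i) <=
   (Num.sqrt (stab_cst n m (lam ord0) D M) * W `^ 4^-1)%:E)%E.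
Proof.
move=> bs SD mS rS S0 cY M0 rhoM D0 Yq muY muY' oT oT' WE.
have [f [Kf f0 fle]] := gap_sum_le bs SD mS rS S0 cY M0 rhoM D0 Yq muY muY' oT oT'.
rewrite WE -EFinM lee_fin in fle.
have W0 : 0 <= W.
  rewrite -lee_fin -WE; apply: sume_ge0 => j _.
  by rewrite mule_ge0 ?wasserstein1_ge0// lee_fin ltW// (bs_gt0 bs).
have [hT _] := oT; have [hT' _] := oT'.
have [[B fB] mf] := lipclass_admissible bs Yq Kf.
set li := lam (lift ord0 i); set l0 := lam ord0.
have li0 : 0 < li := bs_gt0 bs _; have l00 : 0 < l0 := bs_gt0 bs _.
pose I := \int[rho]_(x in S) dot (T i x - T' i x) (T i x - T' i x).
have dTT x : S x -> `|dot (T i x - T' i x) (T i x - T' i x)| <= (2 * D) ^+ 2.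
  move=> Sx; rewrite ger0_norm ?dot_ge0// -enorm_le; last by rewrite mulr_ge0// ltW.
  apply: (le_trans (ler_enorm_dist _ p _)); rewrite (enormB p).
  have := bs_Y bs (@transports_in _ _ _ _ _ _ mu T x i hT Sx).
  by have := bs_Y bs (@transports_in _ _ _ _ _ _ mu' T' x i hT' Sx); lra.
have mTT : measurable_fun S (fun x => dot (T i x - T' i x) (T i x - T' i x)).
  apply: measurable_dot; apply: measurable_rV_on => // k; under eq_fun do rewrite !mxE;
  by apply: measurable_funB; apply: measurable_coord_comp; [have [] := hT i|have [] := hT' i].
have rSoo : (rho S < +oo)%E by rewrite rS ltry.
have iI : rho.-integrable S (EFin \o (fun x => dot (T i x - T' i x) (T i x - T' i x))).
  exact: le_bound_integrable dTT.
rewrite (L2_distE iI mS) -/I -EFinM lee_fin.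
have I0 : 0 <= I by apply: Rintegral_ge0 => x _; exact: dot_ge0.
have IB : I <= (2 * D) ^+ 2.
  apply: (le_trans (ler_norm _)); rewrite -[leRHS]mulr1.
  apply: normr_Rintegral_le => //; [exact: probability_le1|exact: sqr_ge0].
set s := W `^ 4^-1; have s0 : 0 <= s by exact: powR_ge0.
have sW : s ^+ 4 = W by exact: root4.
set A := 4 * D * n%:R * sd_cst n D M; set C := 4 * D * n%:R + 2.
have A0 : 0 <= A.
  by rewrite mulr_ge0 ?(sd_cst_ge0 bs M0)// !mulr_ge0// ltW.
have C0 : 0 <= C by rewrite addr_ge0// !mulr_ge0// ltW.
have st t : 0 <= t -> t <= 1 -> l0 * t * (li ^+ 2 * I) <= A * t ^+ 2 + C * (4 * D * W).
  move=> t0 t1; rewrite mulrA.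
  have := gap_stability bs SD mS M0 rhoM fB mf (U := fun x => T ^~ x) (V := fun x => T' ^~ x)
    (t := t) i _ _ _ _ t0 t1.
  rewrite f0 add0r => H; apply: (le_trans (H _ _ _ _)).
  - by move=> j; exact: transports_meas hT.
  - by move=> x Sx j; exact: transports_in hT Sx.
  - by move=> j; exact: transports_meas hT'.
  - by move=> x Sx j; exact: transports_in hT' Sx.
  - by rewrite lerD2l; apply: ler_wpM2l.
have goal2 : li ^+ 2 * I <= stab_cst n m l0 D M * s ^+ 2.
  have X0 : 0 <= (A + C * (4 * D)) / l0.
    by rewrite divr_ge0 ?(ltW l00)// addr_ge0// mulr_ge0// mulr_ge0// (ltW D0).
  have D20 : 0 <= (2 * D) ^+ 2 by exact: sqr_ge0.
  rewrite /stab_cst -/A -/C; have [s1|s1] := leP s 1; last first.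
    apply: (@le_trans _ _ ((2 * D) ^+ 2 * 1)).
      rewrite mulr1 -[leRHS]mul1r; apply: ler_pM => //; first exact: sqr_ge0.
      rewrite expr_le1 ?(ltW li0)// -(bs_sum bs) (bigD1 (lift ord0 i))//= lerDl.
      by apply: sumr_ge0 => j _; exact: ltW (bs_gt0 bs _).
    apply: ler_pM => //; first by rewrite lerDr.
    by apply: exprn_ege1; exact: ltW.
  (* for [W = 0] there is no positive step to balance with: let [t] tend to 0 *)
  have [s00|spos] := leP s 0.
    have s_eq : s = 0 by apply/eqP; rewrite eq_le s00 s0.
    have W00 : W = 0 by rewrite -sW s_eq expr0n.
    rewrite s_eq expr0n mulr0; apply/ler_addgt0Pr => e e0; rewrite add0r.
    pose t := Num.min 1 (l0 * e / (A + 1)).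
    have A1 : 0 < A + 1 by rewrite ltr_wpDl.
    have t0 : 0 < t by rewrite lt_min ltr01 divr_gt0// mulr_gt0.
    have t1 : t <= 1 by rewrite ge_min lexx.
    have tA : t * (A + 1) <= l0 * e by rewrite -ler_pdivlMr// ge_min lexx orbT.
    have := st t (ltW t0) t1; rewrite W00 !mulr0 addr0 => h.
    rewrite -(ler_pM2l (mulr_gt0 l00 t0)); apply: (le_trans h).
    by have := ler_wpM2l (ltW t0) tA; have := sqr_ge0 t; lra.
  have s2 : 0 < s ^+ 2 by rewrite exprn_gt0.
  have := st (s ^+ 2) (ltW s2) (exprn_ile1 _ s0 s1).
  have -> : A * (s ^+ 2) ^+ 2 + C * (4 * D * W) = l0 * s ^+ 2 * ((A + C * (4 * D)) / l0 * s ^+ 2).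
    by rewrite -sW; field; rewrite gt_eqF.
  rewrite ler_pM2l ?mulr_gt0// => /le_trans; apply.
  by rewrite ler_wpM2r ?(ltW s2)// lerDl.
have Z0 : 0 <= stab_cst n m l0 D M.
  by rewrite addr_ge0 ?sqr_ge0// divr_ge0 ?(ltW l00)// addr_ge0// mulr_ge0// mulr_ge0// (ltW D0).
rewrite -(@ler_pXn2r _ 2) ?nnegrE ?mulr_ge0 ?sqrtr_ge0// ?(ltW li0)//.
by rewrite !exprMn !sqr_sqrtr.
Qed.

Theorem stability_quarter (n m : nat) : (1 < m)%N -> @uniform_stability R n m 4^-1.
Proof.
(* the diameter may be zero, whereas [map_stability] asks for a positive scale *)
move=> m1 l D M; pose D1 := D + 1.
exists (m%:R * Num.sqrt (stab_cst n m l D1 M) + 1).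
  by rewrite ltr_wpDl// mulr_ge0// sqrtr_ge0.
move=> lam S Y rho lam0 lam1 laml cS cY diamD rS rL rM mu mu' muY muY' T T' oT oT'.
have mS := compact_measurable_rV cS.
have [p Sp] : S !=set0.
  by apply/set0P/eqP => S0; move: rS; rewrite /carried_by S0 measure0 => /eqP; rewrite eq_sym onee_eq0.
pose i0 : 'I_m := Ordinal (ltnW m1).
have [q Yq] : Y !=set0.
  apply/set0P/eqP => Y0; move: (muY i0).
  by rewrite /carried_by Y0 measure0 => /eqP; rewrite eq_sym onee_eq0.
have bdd x : (S `|` Y) x -> enorm (x - p) <= D1.
  move=> SYx; apply: (@le_trans _ _ D); last by rewrite lerDl.
  rewrite -diamD; apply: enorm_le_ediam => //; first by left.
  exact: compact_enorm_bounded (compactU cS cY).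
have D0 : 0 < D1.
  rewrite ltr_wpDl// -diamD; apply: (@le_trans _ _ (enorm (p - p))); first exact: enorm_ge0.
  apply: enorm_le_ediam; [by left|by left|].
  exact: compact_enorm_bounded (compactU cS cY).
have M0 : 0 <= M by rewrite -lee_fin -rM; exact: Lnorm_ge0.
have bs : bary_setting lam p D1 Y.
  split => //; [exact: ltW|by move=> v Yv; apply: bdd; right|by exists q].
have rhoM A : measurable A -> (rho A <= M%:E * lebesgue_rV R n A)%E.
  exact: Linf_norm_le.
set w := (\sum_(i < m) (lam (lift ord0 i))%:E * wasserstein1 (mu i) (mu' i))%E.
have w0 : (0 <= w)%E.
  by apply: sume_ge0 => j _; rewrite mule_ge0 ?wasserstein1_ge0// lee_fin ltW.
case wE : w w0 => [W| |//] w0; last first.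
  (* infinite right-hand side *)
  rewrite poweRyr ?gt_eqF ?invr_gt0// gt0_muley ?leey// lte_fin ltr_wpDl//.
have key i := @map_stability n m lam p q D1 S Y rho M W mu mu' T T' i bs
  (fun v Sv => bdd v (or_introl Sv)) mS rS (ex_intro _ p Sp) cY M0 rhoM D0 Yq muY muY' oT oT' wE.
apply: (@le_trans _ _ (\sum_(i < m) (Num.sqrt (stab_cst n m l D1 M) * W `^ 4^-1)%:E)%E).
  by apply: lee_sum => i _; rewrite -laml; exact: key.
rewrite sumEFin sum_cst poweR_EFin -EFinM lee_fin.
by rewrite mulrA ler_wpM2r ?powR_ge0// lerDl.
Qed.

End positive.

(** * Image measures, uniform measures and a certificate of optimality *)

Section law.
Context d1 d2 (X : measurableType d1) (Z : measurableType d2) (R : realType).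
Variables (rho : probability X R) (T : X -> Z) (mT : measurable_fun setT T).

(** The proof that [T] is measurable is an argument, so that [law] can carry a
    canonical probability structure; likewise for [uniform_on]. *)
Definition law (_ : measurable_fun setT T) : set Z -> \bar R := pushforward rho T.
Local Notation lawT := (law mT).

HB.instance Definition _ := Measure.copy lawT
  (measure_function_pushforward__canonical__measure_function_Measure rho mT).

Let law_setT : lawT setT = 1%E.
Proof. by rewrite /law /pushforward preimage_setT probability_setT. Qed.

HB.instance Definition _ := Measure_isProbability.Build _ _ _ lawT law_setT.

End law.

Section uniform.
Context (R : realType) (n : nat).
Local Notation E := 'rV[R]_n.
Local Notation L := (lebesgue_rV R n).
Variables (S : set E) (mS : measurable S) (S1 : L S = 1%E).

Definition uniform_on (_ : L S = 1%E) := mrestr L mS.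
Local Notation unif := (uniform_on S1).

HB.instance Definition _ := Measure.on unif.

Let unif_setT : unif setT = 1%E.
Proof. by rewrite /uniform_on /mrestr setTI. Qed.

HB.instance Definition _ := Measure_isProbability.Build _ _ _ unif unif_setT.

Lemma uniform_onS : unif S = 1%E.
Proof. by rewrite /uniform_on /mrestr setIid. Qed.

Lemma uniform_on_dominated : unif `<< L.
Proof.
apply/null_content_dominatesP => A mA A0; rewrite /uniform_on /mrestr.
by apply: (subset_measure0 _ _ _ A0) => //; exact: measurableI.
Qed.

(** The density is almost everywhere the indicator of [S]. *)
Lemma uniform_on_Linf : exists M, Linf_norm unif = M%:E.
Proof.
suff h : (Linf_norm unif <= 1)%E.
  exists (fine (Linf_norm unif)); rewrite fineK// ge0_fin_numE; last exact: Lnorm_ge0.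
  by apply: le_lt_trans h (ltry _).
have rL : charge_of_finite_measure unif `<< L by exact: uniform_on_dominated.
set g := Radon_Nikodym (charge_of_finite_measure unif) L.
have ig : L.-integrable setT g by exact: Radon_Nikodym_integrable.
have gE : ae_eq L setT g (EFin \o \1_S).
  apply: integral_ae_eq => //.
    by apply/measurable_EFinP; exact: measurable_indic.
  move=> A _ mA; rewrite -(Radon_Nikodym_integral rL)//.
  by rewrite integral_indic//= setIC.
rewrite /Linf_norm unlock; case: ifPn => _ //.
apply: ereal_inf_lbound => /=; apply: filterS gE => x /(_ I) gx.
rewrite /= [Radon_Nikodym _ _ x]gx /= lee_fin indicE.
by case: (x \in S); rewrite ?normr1 ?normr0.
Qed.

End uniform.

Section zero_gap.
Context (R : realType) (n m : nat).
Local Notation E := 'rV[R]_n.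
Variables (lam : 'I_m.+1 -> R) (p : E) (D : R) (S Y : set E).
Variables (rho : probability E R) (mu : 'I_m -> probability E R).
Hypothesis bs : bary_setting lam p D Y.
Hypothesis SD : forall v, S v -> enorm (v - p) <= D.
Hypothesis mS : measurable S.
Hypothesis rS : rho S = 1%E.
Hypothesis cY : compact Y.
Local Notation bar := (bary_sum lam p).

(** The hypothesis says that the supremum [pconj f x] is attained at [T ^~ x], that
    is, that the gap vanishes along [T]; for any competitor it is nonnegative. *)
Lemma zero_gap_optimal (f : 'I_m -> E -> R) (T : 'I_m -> E -> E) :
  admissible Y f -> transports S Y rho mu T ->
  (forall x y, S x -> (forall i, Y (y i)) ->
    2^-1 * dot (bar x y) (bar x y) - \sum_i f i (y i) <=
    2^-1 * dot (bar x (T ^~ x)) (bar x (T ^~ x)) - \sum_i f i (T i x)) ->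
  multi_ot_maps lam S Y rho mu T.
Proof.
move=> nf hT Tmax; split; first exact: hT.
move=> T' hT'; have [[B fB] mf] := nf.
have g0 : \int[rho]_(x in S) dual_gap lam p (pconj lam p Y f) f x (T ^~ x) = 0.
  rewrite (@eq_Rintegral _ _ _ rho S (fun=> 0)).
    by rewrite Rintegral_cst// mul0r.
  move=> x; rewrite inE => Sx; have YT i := transports_in i hT Sx.
  apply/eqP; rewrite eq_le (pconj_feasible bs fB x YT) andbT.
  have := pconj_le bs fB (fun y => Tmax x y Sx); rewrite /dual_gap; lra.
have g0' := gapint_ge0 bs nf hT'.
move: g0 g0'; rewrite (gapintE bs SD mS rS cY nf hT) (gapintE bs SD mS rS cY nf hT').
rewrite (multi_costE bs SD mS rS cY hT) (multi_costE bs SD mS rS cY hT') lee_fin.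
by move=> h1 h2; lra.
Qed.

End zero_gap.

Section coupled_maps.
Context (R : realType) (n : nat).
Local Notation E := 'rV[R]_n.
Variables (rho : probability E R) (mu nu : probability E R).

(** The joint law of [T] and [U] is a coupling. *)
Lemma wasserstein1_le_maps (T U : E -> E) :
  measurable_fun setT T -> measurable_fun setT U ->
  (forall A, measurable A -> mu A = rho (T @^-1` A)) ->
  (forall A, measurable A -> nu A = rho (U @^-1` A)) ->
  (wasserstein1 mu nu <= \int[rho]_x (enorm (T x - U x))%:E)%E.
Proof.
move=> mT mU muT nuU.
have mTU : measurable_fun setT (fun x => (T x, U x)) by exact: measurable_fun_pair.
apply: ereal_inf_lbound; exists (law rho mTU).
  by split=> A mA; rewrite ?muT ?nuU.
have me : measurable_fun setT (fun z : E * E => (enorm (z.1 - z.2))%:E).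
  apply/measurable_EFinP; apply: measurableT_comp.
    by apply: continuous_measurable_rV; exact: continuous_enorm.
  apply: measurable_rV => k; under eq_fun do rewrite !mxE.
  apply: measurable_funB.
    exact: measurableT_comp (measurable_coord k) measurable_fst.
  exact: measurableT_comp (measurable_coord k) measurable_snd.
rewrite ge0_integral_pushforward// => z _.
by rewrite lee_fin enorm_ge0.
Qed.

End coupled_maps.

(** * Two rows of boxes and the switching maps *)

Section side.
Context (R : realType).

(** A sign that takes no third value. *)
Definition side (r : R) : R := if 0 <= r then 1 else -1.

Lemma measurable_side : measurable_fun setT side.
Proof.
apply: measurable_fun_ifT => //.
exact: measurable_fun_ler.
Qed.

Lemma sideM r : side r * r = `|r|.
Proof.
rewrite /side; case: ifPn => [r0|]; first by rewrite mul1r ger0_norm.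
by rewrite -ltNge => r0; rewrite mulN1r ltr0_norm.
Qed.

Lemma sideE r : side r = 1 \/ side r = -1.
Proof. by rewrite /side; case: ifP; [left|right]. Qed.

Lemma sqr_side r : side r ^+ 2 = 1.
Proof. by case: (sideE r) => ->; rewrite ?sqrrN expr1n. Qed.

Lemma normr_side r : `|side r| = 1.
Proof. by case: (sideE r) => ->; rewrite ?normrN normr1. Qed.

End side.

Section two_rows.
Context (R : realType) (n : nat) (i0 i1 : 'I_n).
Hypothesis i01 : i1 != i0.
Local Notation E := 'rV[R]_n.
Local Notation L := (lebesgue_rV R n).

Definition pt (a b : R) : E := \row_i (if i == i0 then a else if i == i1 then b else 0).

Lemma pt0 a b : pt a b ord0 i0 = a. Proof. by rewrite mxE eqxx. Qed.
Lemma pt1 a b : pt a b ord0 i1 = b. Proof. by rewrite mxE (negbTE i01) eqxx. Qed.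

Lemma dot_pt x a b : dot x (pt a b) = x ord0 i0 * a + x ord0 i1 * b.
Proof.
rewrite /dot (bigD1 i0)//= (bigD1 i1)//= pt0 pt1 big1 ?addr0// => i /andP[h0 h1].
by rewrite mxE (negbTE h0) (negbTE h1) mulr0.
Qed.

Lemma ptB a b a' b' : pt a b - pt a' b' = pt (a - a') (b - b').
Proof. by apply/rowP => i; rewrite !mxE; do 2 case: ifP => // _; rewrite subr0. Qed.

Lemma enorm_pt a b : enorm (pt a b) = Num.sqrt (a ^+ 2 + b ^+ 2).
Proof.
apply/eqP; rewrite -(@eqrXn2 _ 2)// ?enorm_ge0 ?sqrtr_ge0//.
by rewrite sqr_enorm dot_pt pt0 pt1 sqr_sqrtr ?addr_ge0 ?sqr_ge0// !expr2.
Qed.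

Lemma measurable_pt d (T : measurableType d) (a b : T -> R) :
  measurable_fun setT a -> measurable_fun setT b ->
  measurable_fun setT (fun x => pt (a x) (b x)).
Proof.
move=> ma mb; apply: measurable_rV => i; under eq_fun do rewrite mxE.
by case: (i == i0) => //; case: (i == i1) => //; exact: measurable_cst.
Qed.

(** Two boxes, of width 1/2 and height 1, on either side of the hyperplane where the
    coordinate [i1] vanishes; the total volume is 1. *)
Definition rows_itv (i : 'I_n) : set R :=
  (if i == i0 then `[- 4^-1, 4^-1]
   else if i == i1 then `[-2, -1] `|` `[1, 2] else `[0, 1])%classic.

Definition two_rows : set E := [set x | forall i, rows_itv i (x ord0 i)].

Lemma measurable_two_rows : measurable two_rows.
Proof.
apply: (@measurable_box _ _ rows_itv) => i; rewrite /rows_itv.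
by case: ifP => // _; case: ifP => // _; apply: measurableU.
Qed.

Lemma compact_two_rows : compact two_rows.
Proof.
apply: (@rV_compact R n rows_itv) => i; rewrite /rows_itv.
case: ifP => _; first exact: segment_compact.
case: ifP => _; last exact: segment_compact.
by apply: compactU; exact: segment_compact.
Qed.

Lemma prod_boxE (A : 'I_n -> set R) : (forall i, measurable (A i)) ->
  (forall i, i != i0 -> i != i1 -> lebesgue_measure (A i) = 1%E) ->
  L [set x | forall i, A i (x ord0 i)] =
  (lebesgue_measure (A i0) * lebesgue_measure (A i1))%E.
Proof.
move=> mA A1; rewrite lebesgue_rV_box// (bigD1 i0)//= (bigD1 i1)//= big1 ?mule1//.
by move=> i /andP[h0 h1]; exact: A1.
Qed.

Lemma itv_len (a b : R) (ba bb : bool) : a < b ->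
  lebesgue_measure [set` Interval (BSide ba a) (BSide bb b)] = (b - a)%:E.
Proof. by move=> ab; rewrite lebesgue_measure_itv/= lte_fin ab EFinB. Qed.

Lemma lebesgue_two_rows : L two_rows = 1%E.
Proof.
rewrite prod_boxE.
- pose A1 : set R := `[-2, -1]%classic; pose A2 : set R := `[1, 2]%classic.
  have hU : lebesgue_measure (A1 `|` A2) = (lebesgue_measure A1 + lebesgue_measure A2)%E.
    apply: measureU; [exact: measurable_itv|exact: measurable_itv|].
    apply/seteqP; split=> // x [].
    by rewrite /A1 /A2 /= !in_itv/= => /andP[_ h1] /andP[h2 _]; lra.
  rewrite /rows_itv eqxx (negbTE i01) eqxx hU !itv_len; [|lra|lra|lra].
  by rewrite -EFinD -EFinM; congr EFin; lra.
- by move=> i; rewrite /rows_itv; case: ifP => // _; case: ifP => // _; apply: measurableU.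
- move=> i /negbTE h0 /negbTE h1; rewrite /rows_itv h0 h1 itv_len//.
  by rewrite subr0.
Qed.

Definition unit_box : set E := [set y | forall i, `[-1, 1]%classic (y ord0 i)].

Lemma compact_unit_box : compact unit_box.
Proof. by apply: (@rV_compact R n (fun=> `[-1, 1]%classic)) => i; exact: segment_compact. Qed.

Lemma two_rows_le x : two_rows x -> enorm x <= 2 * n%:R.
Proof.
move=> Sx; apply: (le_trans (enorm_le_sum _)); rewrite mulrC -sum_cst.
apply: ler_sum => i _; have := Sx i; rewrite /rows_itv ler_norml.
case: ifP => _; last case: ifP => _; rewrite /= ?in_itv/=.
- by move=> /andP[? ?]; apply/andP; split; lra.
- by move=> -[|] /andP[? ?]; apply/andP; split; lra.
- by move=> /andP[? ?]; apply/andP; split; lra.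
Qed.

Lemma unit_box_le x : unit_box x -> enorm x <= 2 * n%:R.
Proof.
move=> Sx; apply: (le_trans (enorm_le_sum _)); rewrite mulrC -sum_cst.
apply: ler_sum => i _; have := Sx i; rewrite /= in_itv/= ler_norml.
by move=> /andP[? ?]; apply/andP; split; lra.
Qed.

Local Notation rho := (uniform_on measurable_two_rows lebesgue_two_rows).

Section strips.
Variable eps : R.
Hypothesis eps_gt0 : 0 < eps.
Hypothesis eps_le : eps <= 4^-1.

(** The image is one of four points.  The threshold for the first sign is [th * eps]
    in the upper row and [- th * eps] in the lower one. *)
Definition switch (th : R) (x : E) : E :=
  pt (side (x ord0 i0 - th * eps * side (x ord0 i1))) (eps * side (x ord0 i1)).

(** Where [switch 0] and [switch 1] differ. *)
Definition strip : set E :=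
  [set x | side (x ord0 i0) <> side (x ord0 i0 - eps * side (x ord0 i1))].

(** On the strip, [switch 1] changes the first sign of [switch 0] and [rearranged] the
    second one, at a much smaller distance. *)
Definition rearranged (x : E) : E :=
  pt (side (x ord0 i0))
     (eps * (if x \in strip then - side (x ord0 i1) else side (x ord0 i1))).

Let ms0 : measurable_fun setT (fun x : E => x ord0 i0) := @measurable_coord R n i0.
Let ms1 : measurable_fun setT (fun x : E => side (x ord0 i1)).
Proof. exact: measurableT_comp (@measurable_side R) (@measurable_coord R n i1). Qed.

Lemma measurable_switch th : measurable_fun setT (switch th).
Proof.
apply: measurable_pt; last exact: measurable_funM.
apply: measurableT_comp (@measurable_side R) _.
by apply: measurable_funB => //; exact: measurable_funM.
Qed.

Lemma measurable_strip : measurable strip.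
Proof.
pose h (x : E) := side (x ord0 i0) - side (x ord0 i0 - eps * side (x ord0 i1)).
have mh : measurable_fun setT h.
  apply: measurable_funB; first exact: measurableT_comp (@measurable_side R) ms0.
  apply: measurableT_comp (@measurable_side R) _.
  by apply: measurable_funB => //; exact: measurable_funM.
rewrite (_ : strip = h @^-1` (~` [set 0])); last first.
  apply/seteqP; split=> x /= H; first by move=> /eqP; rewrite subr_eq0 => /eqP.
  by move=> H'; apply: H; rewrite /h H' subrr.
rewrite -[X in measurable X]setTI; apply: mh => //.
exact: measurableC.
Qed.

Lemma measurable_rearranged : measurable_fun setT rearranged.
Proof.
apply: measurable_pt; first exact: measurableT_comp (@measurable_side R) ms0.
apply: measurable_funM => //; apply: measurable_fun_ifT => //.
  exact: measurable_mem_set measurable_strip.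
exact: measurableT_comp.
Qed.

Definition half_strip (s : R) : set E := strip `&` [set x | side (x ord0 i1) = s].

Lemma half_strip_posP (x : E) : half_strip 1 x <->
  [/\ 0 <= x ord0 i1, 0 <= x ord0 i0 & x ord0 i0 < eps].
Proof.
have e0 := eps_gt0; rewrite /half_strip /strip /=.
move: (x ord0 i0) (x ord0 i1) => a b; rewrite /side.
case: (leP 0 b) => hb; case: (leP 0 a) => ha; last 2 first.
- by split=> [[_ ?]|[]]; lra.
- by split=> [[_ ?]|[]]; lra.
- case: (leP 0 (a - eps * 1)) => h; first by split=> [[]//|[]]; lra.
  by split=> [_|_]; split => //; [lra|move=> ?; lra].
- case: (leP 0 (a - eps * 1)) => h; first by lra.
  by split=> [[]//|[]]; lra.
Qed.

Lemma half_strip_negP (x : E) : half_strip (-1) x <->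
  [/\ x ord0 i1 < 0, - eps <= x ord0 i0 & x ord0 i0 < 0].
Proof.
have e0 := eps_gt0; rewrite /half_strip /strip /=.
move: (x ord0 i0) (x ord0 i1) => a b; rewrite /side.
case: (leP 0 b) => hb; first by split=> [[_ ?]|[]]; lra.
case: (leP 0 a) => ha.
- case: (leP 0 (a - eps * -1)) => h; last by lra.
  by split=> [[]//|[]]; lra.
- case: (leP 0 (a - eps * -1)) => h.
    by split=> [_|_]; split => //; [lra|move=> ?; lra].
  by split=> [[]//|[]]; lra.
Qed.

Lemma rho_half_strip (s : R) : s = 1 \/ s = -1 -> rho (half_strip s) = eps%:E.
Proof.
have e0 := eps_gt0; have e4 := eps_le.
move=> ss.
pose A (i : 'I_n) : set R := (if i == i0 then
   (if s == 1 then `[0, eps[ else `[- eps, 0[) else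
   if i == i1 then (if s == 1 then `[1, 2] else `[-2, -1]) else `[0, 1])%classic.
have mA i : measurable (A i).
  by rewrite /A; case: ifP => _; [case: ifP|case: ifP => _; [case: ifP|]].
rewrite /uniform_on /mrestr.
have n1 : (-1 == 1 :> R) = false by apply/eqP => h; lra.
have -> : half_strip s `&` two_rows = [set x | forall i, A i (x ord0 i)].
  apply/seteqP; split=> x.
    move=> [hs Sx] i; have := Sx i; rewrite /rows_itv /A.
    case: ss hs => -> ; rewrite ?eqxx ?n1.
      move=> /half_strip_posP[h1 h2 h3]; case: eqP => [->|_].
        by rewrite /= !in_itv/= => _; apply/andP.
      case: eqP => [->|_//]; rewrite /= !in_itv/= => -[/andP[? ?]|//]; lra.
    move=> /half_strip_negP[h1 h2 h3]; case: eqP => [->|_].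
      by rewrite /= !in_itv/= => _; apply/andP.
    case: eqP => [->|_//]; rewrite /= !in_itv/= => -[//|/andP[? ?]]; lra.
  move=> Ax; have := Ax i0; have := Ax i1.
  rewrite /A eqxx (negbTE i01) eqxx => H1 H0; split.
    case: ss H1 H0 => ->; rewrite ?eqxx ?n1 /= !in_itv/= => /andP[? ?] /andP[? ?].
      by apply/half_strip_posP; split=> //; lra.
    by apply/half_strip_negP; split=> //; lra.
  move=> i; have := Ax i; rewrite /A /rows_itv.
  case: eqP => _.
    by case: ifP => _; rewrite /= !in_itv/= => /andP[? ?]; apply/andP; split; lra.
  by case: eqP => _ //; case: ifP => _ ?; [right|left].
rewrite prod_boxE//; last first.
  move=> i /negbTE h0 /negbTE h1; rewrite /A h0 h1 itv_len//.
  by rewrite subr0.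
have l1 : 1 < 2 :> R by lra.
have l2 : -2 < -1 :> R by lra.
have l3 : - eps < 0 by lra.
rewrite /A eqxx (negbTE i01) eqxx; case: ifP => _.
  by rewrite (itv_len _ _ e0) (itv_len _ _ l1) -EFinM; congr EFin; lra.
by rewrite (itv_len _ _ l3) (itv_len _ _ l2) -EFinM; congr EFin; lra.
Qed.

Lemma side_strip x : strip x -> half_strip (side (x ord0 i1)) x.
Proof. by []. Qed.

Lemma half_strip_side (s : R) x : s = 1 \/ s = -1 -> half_strip s x ->
  side (x ord0 i0) = s /\ side (x ord0 i0 - eps * s) = - s.
Proof.
have e0 := eps_gt0; case=> ->.
  move=> /half_strip_posP[h1 h2 h3]; rewrite /side h2.
  by case: (leP 0 (x ord0 i0 - eps * 1)) => h; split => //; lra.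
move=> /half_strip_negP[h1 h2 h3]; rewrite /side.
case: (leP 0 (x ord0 i0)) => h; first by lra.
by case: (leP 0 (x ord0 i0 - eps * -1)) => h'; split => //; lra.
Qed.

Lemma switch0E x : switch 0 x = pt (side (x ord0 i0)) (eps * side (x ord0 i1)).
Proof. by rewrite /switch !mul0r subr0. Qed.

Lemma switch_half (s : R) x : s = 1 \/ s = -1 -> half_strip s x ->
  [/\ switch 0 x = pt s (eps * s), switch 1 x = pt (- s) (eps * s) &
      rearranged x = pt s (eps * - s)].
Proof.
move=> ss hx; have [h0 h1] := half_strip_side ss hx; have [sx xs] := hx.
rewrite switch0E /switch /rearranged mem_set// mul1r xs h0 h1.
by split.
Qed.

Lemma switch_off x : ~ strip x -> switch 1 x = switch 0 x /\ rearranged x = switch 0 x.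
Proof.
move=> nx; rewrite switch0E /switch /rearranged memNset// mul1r.
have -> // : side (x ord0 i0 - eps * side (x ord0 i1)) = side (x ord0 i0).
by apply: contra_notP nx => h h'; apply: h.
Qed.

Lemma measurable_half_strip (s : R) : measurable (half_strip s).
Proof.
apply: measurableI; first exact: measurable_strip.
have := ms1 measurableT (measurable_set1 s).
by rewrite setTI.
Qed.

Lemma strip_halves : strip = half_strip 1 `|` half_strip (-1).
Proof.
apply/seteqP; split=> [x sx|x [] []//].
by have := side_strip sx; case: (sideE (x ord0 i1)) => ->; [left|right].
Qed.

Lemma rho_split (B : set E) : measurable B ->
  rho B = (rho (B `\` strip) + (rho (B `&` half_strip 1) + rho (B `&` half_strip (-1))))%E.
Proof.
move=> mB; rewrite (measureDI rho mB measurable_strip); congr (_ + _)%E.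
rewrite strip_halves setIUr measureU//.
- by apply: measurableI => //; exact: measurable_half_strip.
- by apply: measurableI => //; exact: measurable_half_strip.
- by apply/seteqP; split=> // x [[_ [_ /= h]] [_ [_ /= h']]]; move: h'; rewrite h => h'; lra.
Qed.

Lemma rho_strip : rho strip = (2 * eps)%:E.
Proof.
rewrite rho_split; last exact: measurable_strip.
rewrite setDv measure0 add0e.
have sub (s : R) : strip `&` half_strip s = half_strip s by apply/setIidr => x [].
rewrite !sub !rho_half_strip; [|by right|by left].
by rewrite -EFinD; congr EFin; ring.
Qed.

Lemma rho_preimage_const (T : E -> E) (A H : set E) (y : E) :
  (forall x, H x -> T x = y) ->
  rho (T @^-1` A `&` H) = if y \in A then rho H else 0%E.
Proof.
move=> Hy; case: ifPn => [/set_mem Ay|/negP nAy].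
  have -> // : T @^-1` A `&` H = H.
    by apply/setIidr => x Hx; rewrite /preimage /= (Hy _ Hx).
rewrite (_ : _ `&` _ = set0) ?measure0//.
by apply/seteqP; split=> // x [/= + Hx]; rewrite Hy// => /mem_set.
Qed.

(** On the two halves of the strip, of equal mass, [switch 1] takes the values
    [(-1, eps)] and [(1, - eps)], and [rearranged] the same ones in the other order. *)
Lemma rearranged_law A : measurable A ->
  rho (switch 1 @^-1` A) = rho (rearranged @^-1` A).
Proof.
move=> mA.
have mp (T : E -> E) : measurable_fun setT T -> measurable (T @^-1` A).
  by move=> mT; rewrite -[X in measurable X]setTI; exact: mT.
rewrite (rho_split (mp _ (measurable_switch 1))) (rho_split (mp _ measurable_rearranged)).
have p1 : (1 : R) = 1 \/ (1 : R) = -1 by left.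
have p2 : (-1 : R) = 1 \/ (-1 : R) = -1 by right.
rewrite (rho_preimage_const _ (y := pt (- 1) (eps * 1))); last first.
  by move=> x /(switch_half p1)[].
rewrite (rho_preimage_const _ (y := pt (- -1) (eps * -1))); last first.
  by move=> x /(switch_half p2)[].
rewrite (rho_preimage_const _ (y := pt 1 (eps * -1))); last first.
  by move=> x /(switch_half p1)[].
rewrite (rho_preimage_const _ (y := pt (-1) (eps * - -1))); last first.
  by move=> x /(switch_half p2)[].
rewrite !rho_half_strip// !opprK; congr (_ + _)%E; last by rewrite addeC.
congr (rho _); apply/seteqP; split=> x [/= h nx]; split=> //=;
by have [e1 e2] := switch_off nx; move: h; rewrite e1 e2.
Qed.

Lemma integral_rearranged :
  (\int[rho]_x (enorm (switch 0 x - rearranged x))%:E = (4 * eps ^+ 2)%:E)%E.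
Proof.
have e0 := eps_gt0.
transitivity (\int[rho]_x ((2 * eps)%:E * (\1_strip x)%:E))%E.
  apply: eq_integral => x _; rewrite -EFinM; congr EFin; rewrite indicE.
  have [sx|nx] := pselect (strip x); last first.
    by rewrite memNset// (switch_off nx).2 subrr enorm0 mulr0.
  have [-> _ ->] := switch_half (sideE _) (side_strip sx).
  rewrite mem_set// mulr1 ptB enorm_pt subrr expr0n add0r.
  have -> : (eps * side (x ord0 i1) - eps * - side (x ord0 i1)) ^+ 2 =
    (2 * eps) ^+ 2 * side (x ord0 i1) ^+ 2 by ring.
  rewrite sqr_side mulr1 sqrtr_sqr.
  by rewrite ger0_norm// mulr_ge0// ltW.
rewrite ge0_integralZl//; last by rewrite lee_fin mulr_ge0// ltW.
  rewrite integral_indic//; last exact: measurable_strip.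
  by rewrite setIT [X in (_ * X)%E]rho_strip -EFinM; congr EFin; ring.
by apply/measurable_EFinP; exact: measurable_indic measurable_strip.
Qed.

Lemma Rintegral_switch :
  \int[rho]_(x in two_rows) dot (switch 0 x - switch 1 x) (switch 0 x - switch 1 x)
  = 8 * eps.
Proof.
have mS := measurable_two_rows; have mst := measurable_strip.
transitivity (\int[rho]_(x in two_rows) (4 * \1_strip x)).
  apply: eq_Rintegral => x _; rewrite indicE.
  have [sx|nx] := pselect (strip x); last first.
    by rewrite memNset// (switch_off nx).1 subrr dot0l mulr0.
  have [-> -> _] := switch_half (sideE _) (side_strip sx).
  rewrite mem_set// mulr1 ptB dot_pt pt0 pt1 subrr mulr0 addr0 opprK.
  by have := sqr_side (x ord0 i1); rewrite expr2; move: (side _) => s; lra.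
rewrite RintegralZl//; last first.
  apply: (@le_bound_integrable _ _ _ _ _ _ 1) => //.
  - exact: prob_lty.
  - by move=> x _; rewrite indicE; case: (x \in strip); rewrite ?normr1 ?normr0.
have h : rho (strip `&` two_rows) = (2 * eps)%:E.
  by rewrite setIC; exact: (etrans (prob_setI mS (uniform_onS _ _) mst) rho_strip).
by rewrite /Rintegral integral_indic// [fine _](congr1 fine h) /=; ring.
Qed.

End strips.

End two_rows.

(** * Optimality of the switching maps *)

Section sharpness.
Context (R : realType) (n m : nat) (i0 i1 : 'I_n) (j0 : 'I_m).
Hypothesis i01 : i1 != i0.
Local Notation E := 'rV[R]_n.
Local Notation S := (@two_rows R n i0 i1).
Local Notation Y := (@unit_box R n).
Local Notation rho := (uniform_on (@measurable_two_rows R n i0 i1) (lebesgue_two_rows R i01)).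
Local Notation pt := (@pt R n i0 i1).
Local Notation c := (m.+1%:R^-1 : R).
Local Notation lam := (fun=> m.+1%:R^-1 : R).
Variable eps : R.
Hypothesis eps_gt0 : 0 < eps.
Hypothesis eps_le : eps <= 4^-1.
Local Notation switch := (@switch R n i0 i1 eps).
Let D : R := 2 * n%:R.

Let c_gt0 : 0 < c. Proof. by rewrite invr_gt0. Qed.
Let c_le1 : c <= 1. Proof. by rewrite invf_le1// ler1n. Qed.

Lemma lam_bary : bary_setting (lam : 'I_m.+1 -> R) (0 : E) D Y.
Proof.
split=> //.
- by rewrite sumr_const card_ord -[RHS](@mulVf _ m.+1%:R)// mulr_natr.
- exact: mulr_ge0.
- by move=> v Yv; rewrite subr0; exact: unit_box_le.
- by exists 0 => i; rewrite /= mxE in_itv/=; apply/andP; split; lra.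
Qed.

Definition switch_family (th : R) (j : 'I_m) (x : E) : E :=
  if j == j0 then switch th x else 0.

Lemma measurable_switch_family th j : measurable_fun setT (switch_family th j).
Proof.
rewrite /switch_family; case: (j == j0); last exact: measurable_cst.
exact: measurable_switch.
Qed.

Definition switch_law th j : probability E R := law rho (measurable_switch_family th j).

Lemma unit_box_pt a b : `|a| <= 1 -> `|b| <= 1 -> Y (pt a b).
Proof.
rewrite !ler_norml => ha hb i; rewrite /= mxE in_itv/=.
by case: ifP => // _; case: ifP => // _; apply/andP; split; lra.
Qed.

Lemma unit_box_switch th j x : Y (switch_family th j x).
Proof.
have e0 := eps_gt0; have e4 := eps_le.
rewrite /switch_family; case: ifP => _.
  apply: unit_box_pt; first by rewrite normr_side.
  by rewrite normrM normr_side mulr1 ger0_norm ?ltW//; lra.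
by move=> i; rewrite /= mxE in_itv/=; apply/andP; split; lra.
Qed.

Lemma switch_transports th : transports S Y rho (switch_law th) (switch_family th).
Proof.
move=> j; split.
- exact: measurable_funTS (measurable_switch_family th j).
- by move=> _ [x _ <-]; exact: unit_box_switch.
- move=> A mA; apply/esym.
  apply: (prob_setI (@measurable_two_rows R n i0 i1) (uniform_onS _ _)).
  by rewrite -[X in measurable X]setTI; exact: measurable_switch_family.
Qed.

Lemma switch_law_carried th j : carried_by (switch_law th j) Y.
Proof.
rewrite /carried_by /switch_law /= /law /pushforward.
rewrite (_ : _ @^-1` _ = setT); first exact: probability_setT.
by apply/seteqP; split=> // x _; exact: unit_box_switch.
Qed.

Definition target_itv (i : 'I_n) : set R :=
  if i == i0 then [set 1; -1] else if i == i1 then [set eps; - eps] else [set 0].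

Definition targets : set E := [set y | forall i, target_itv i (y ord0 i)].

(** Written as a box, like [targets], so that [measurable_box] applies. *)
Definition origin : set E := [set y | forall i, [set 0] (y ord0 i)].

Lemma measurable_targets : measurable targets.
Proof.
apply: (@measurable_box _ _ target_itv) => i; rewrite /target_itv.
by case: ifP => // _; [apply: measurableU|case: ifP => // _; apply: measurableU].
Qed.

Lemma measurable_origin : measurable origin.
Proof. exact: (@measurable_box _ _ (fun=> [set 0])). Qed.

Lemma originE y : origin y -> y = 0.
Proof. by move=> h; apply/rowP => i; rewrite mxE; exact: h. Qed.

Lemma targetsP y : targets y -> exists s s' : R,
  [/\ s = 1 \/ s = -1, s' = 1 \/ s' = -1 & y = pt s (eps * s')].
Proof.
move=> ty; exists (y ord0 i0), (y ord0 i1 / eps).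
have e0 := eps_gt0; have en0 : eps != 0 by rewrite gt_eqF.
have := ty i0; have := ty i1; rewrite /target_itv eqxx (negbTE i01) eqxx /= => h1 h0.
split => //.
  by case: h1 => ->; [left; rewrite divff|right; rewrite mulNr divff].
apply/rowP => i; rewrite mxE mulrC divfK//; have := ty i; rewrite /target_itv.
by case: eqP => [->//|_]; case: eqP => [->//|_].
Qed.

Definition big_value : R := 2 * D ^+ 2 + 1.

(** The quadratic part compensates the one of [2^-1 |b|^2], so that over the targets
    one maximizes a linear function of [y] plus the term in [th], which moves the
    threshold between the targets.  [big_value] rules out all other points, and
    the summand [eps] keeps the potential nonnegative. *)
Definition switch_potential (th : R) (j : 'I_m) (y : E) : R :=
  if j == j0 then
    (if y \in targets then
       c ^+ 2 * (2^-1 * dot y y + th * (y ord0 i0 * y ord0 i1 + eps))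
     else big_value)
  else (if y \in origin then 0 else big_value).

Lemma measurable_switch_potential th j : measurable_fun setT (switch_potential th j).
Proof.
rewrite /switch_potential; case: (j == j0).
  apply: measurable_fun_ifT => //; first exact: measurable_mem_set measurable_targets.
  apply: measurable_funM => //; apply: measurable_funD.
    by apply: measurable_funM => //; exact: measurable_dot.
  apply: measurable_funM => //; apply: measurable_funD => //.
  by apply: measurable_funM; exact: measurable_coord.
by apply: measurable_fun_ifT => //; exact: measurable_mem_set measurable_origin.
Qed.

Lemma switch_potential_ge0 th j y : 0 <= th -> 0 <= switch_potential th j y.
Proof.
have e0 := eps_gt0; move=> th0.
have b0 : 0 <= big_value by rewrite addr_ge0// mulr_ge0// sqr_ge0.
rewrite /switch_potential; case: ifP => _; case: ifPn => // /set_mem /targetsP[s [s' [ss ss' ->]]].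
rewrite mulr_ge0 ?sqr_ge0// addr_ge0 ?mulr_ge0 ?dot_ge0 ?invr_ge0//.
by rewrite pt0 pt1//; case: ss => ->; case: ss' => ->; lra.
Qed.

Lemma switch_potential_le th j y : 0 <= th -> th <= 1 -> Y y ->
  switch_potential th j y <= big_value + D ^+ 2 + 2.
Proof.
have e0 := eps_gt0; have e4 := eps_le; move=> th0 th1 Yy.
have D20 := sqr_ge0 D.
have b0 : 0 <= big_value by rewrite addr_ge0// mulr_ge0.
rewrite /switch_potential; case: ifP => _; case: ifPn => [/set_mem|] h; try lra.
have dy : dot y y <= D ^+ 2 by rewrite -enorm_le ?mulr_ge0//; exact: unit_box_le.
have [s [s' [ss ss' yE]]] := targetsP h.
have yy : th * (y ord0 i0 * y ord0 i1 + eps) <= 1.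
  rewrite yE pt0 pt1//; have : th * eps <= eps by rewrite ler_piMl// ltW.
  by case: ss => ->; case: ss' => ->; have := mulr_ge0 th0 (ltW e0); lra.
have yy0 : 0 <= th * (y ord0 i0 * y ord0 i1 + eps).
  by rewrite yE pt0 pt1// mulr_ge0//; case: ss => ->; case: ss' => ->; lra.
have c2 : c ^+ 2 <= 1 by rewrite expr_le1 ?(ltW c_gt0).
apply: (@le_trans _ _ (1 * (2^-1 * dot y y + th * (y ord0 i0 * y ord0 i1 + eps)))).
  apply: ler_wpM2r => //; rewrite addr_ge0//.
  by rewrite mulr_ge0 ?dot_ge0// invr_ge0.
lra.
Qed.

Lemma admissible_switch_potential th : 0 <= th -> th <= 1 -> admissible Y (switch_potential th).
Proof.
move=> th0 th1; split; last by move=> j; exact: measurable_switch_potential.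
exists (big_value + D ^+ 2 + 2) => j y Yy.
by rewrite ger0_norm ?switch_potential_ge0// switch_potential_le.
Qed.

Lemma bar_single x (y : 'I_m -> E) : (forall j, j != j0 -> y j = 0) ->
  bary_sum (lam : 'I_m.+1 -> R) 0 x y = c *: (x + y j0).
Proof.
move=> y0; rewrite /bary_sum (bigD1 j0)//= big1 ?addr0 => [|j /y0 ->]; last first.
  by rewrite subr0 scaler0.
by rewrite !subr0 scalerDr.
Qed.

(** Over the targets [(s, eps s')] one maximizes
    [s x_0 + eps s' x_1 - th eps s s'], up to constants.  As [|x_1| >= 1 >= th], a best
    [s'] is the sign of [x_1], and then a best [s] is that of [x_0 - th eps s']. *)
Lemma switch_optimal th : 0 <= th -> th <= 1 ->
  multi_ot_maps lam S Y rho (switch_law th) (switch_family th).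
Proof.
move=> th0 th1; have e0 := eps_gt0; have e4 := eps_le.
have SD v : S v -> enorm (v - 0) <= D by move=> Sv; rewrite subr0; exact: two_rows_le.
apply: (zero_gap_optimal lam_bary SD (@measurable_two_rows R n i0 i1) (uniform_onS _ _)
  (@compact_unit_box R n) (admissible_switch_potential th0 th1) (switch_transports th)).
move=> x y Sx Yy.
set V := (X in _ <= X).
have value z : targets z -> 2^-1 * dot (c *: (x + z)) (c *: (x + z)) - switch_potential th j0 z =
    c ^+ 2 * (2^-1 * dot x x + (dot x z - th * (z ord0 i0 * z ord0 i1 + eps))).
  move=> tz; rewrite /switch_potential eqxx mem_set//.
  by rewrite dotZl dotZr dotDl !dotDr (dotC z x); field.
have tT : targets (switch th x).
  move=> i; rewrite /switch /target_itv mxE; case: ifP => _.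
    by case: (sideE (x ord0 i0 - th * eps * side (x ord0 i1))) => ->; [left|right].
  case: ifP => _ //.
  by case: (sideE (x ord0 i1)) => ->; [left; rewrite mulr1|right; rewrite mulrN1].
have VE : V = c ^+ 2 * (2^-1 * dot x x + (dot x (switch th x) -
    th * (switch th x ord0 i0 * switch th x ord0 i1 + eps))).
  rewrite /V bar_single; last by move=> j /negbTE jn; rewrite /switch_family jn.
  rewrite {1 2}/switch_family eqxx -value//; congr (_ - _).
  rewrite (bigD1 j0)//= big1 ?addr0; first by rewrite /switch_family eqxx.
  move=> j /negbTE jn; rewrite /switch_potential /switch_family jn mem_set//.
  by move=> i; rewrite /= mxE.
have Tdot : dot x (switch th x) - th * (switch th x ord0 i0 * switch th x ord0 i1 + eps) =
    `|x ord0 i0 - th * eps * side (x ord0 i1)| + eps * `|x ord0 i1| - th * eps.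
  rewrite /switch dot_pt// pt0 pt1// -!sideM; ring.
have x1 : 1 <= `|x ord0 i1|.
  have := Sx i1; rewrite /rows_itv (negbTE i01) eqxx /= !in_itv/= => -[] /andP[h1 h2].
    by rewrite ler0_norm; lra.
  by rewrite ger0_norm; lra.
have the : th * eps <= eps by rewrite ler_piMl// ltW.
have the0 : 0 <= th * eps by rewrite mulr_ge0// ltW.
have V0 : 0 <= V.
  rewrite VE Tdot; have := normr_ge0 (x ord0 i0 - th * eps * side (x ord0 i1)).
  have xx := dot_ge0 x; have ex : eps <= eps * `|x ord0 i1| by rewrite ler_peMr// ltW.
  by move=> ab; apply: mulr_ge0; [exact: sqr_ge0|lra].
(* a point off the targets loses more than the square can gain *)
have [adm|/existsNP[j /= nj]] := pselect (forall j,
    if j == j0 then targets (y j) else origin (y j)); last first.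
  have pot_ge i : 0 <= switch_potential th i (y i) by exact: switch_potential_ge0.
  have K : switch_potential th j (y j) = big_value.
    by move: nj; rewrite /switch_potential; case: ifP => _ nj; rewrite memNset.
  have sumK : big_value <= \sum_i switch_potential th i (y i).
    by rewrite (bigD1 j)//= K lerDl sumr_ge0.
  have bb : dot (bary_sum (lam : 'I_m.+1 -> R) 0 x y) (bary_sum (lam : 'I_m.+1 -> R) 0 x y) <= (2 * D) ^+ 2.
    rewrite -enorm_le; last by rewrite mulr_ge0// mulr_ge0.
    apply: (le_trans (enorm_bar lam_bary x Yy)).
    by have := SD _ Sx; lra.
  move: sumK; rewrite /big_value; move: bb V0; rewrite exprMn; lra.
have y0 j : j != j0 -> y j = 0.
  by move=> /negbTE jn; apply: originE; have := adm j; rewrite jn.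
have ty : targets (y j0) by have := adm j0; rewrite eqxx.
rewrite bar_single// (bigD1 j0)//= big1 ?addr0; last first.
  by move=> j jn; rewrite /switch_potential (negbTE jn) mem_set//; have := adm j; rewrite (negbTE jn).
rewrite value// VE ler_pM2l ?exprn_gt0// lerD2l Tdot.
have [s [s' [ss ss' ->]]] := targetsP ty.
rewrite dot_pt// pt0 pt1//.
have n1 := ler_norm (x ord0 i0 - th * eps * side (x ord0 i1)).
have n2 := ler_norm (- (x ord0 i0 - th * eps * side (x ord0 i1))); rewrite normrN in n2.
have ex : eps <= eps * `|x ord0 i1| by rewrite ler_peMr// ltW.
have sx := sideM (x ord0 i1); move: n1 n2 ex; rewrite -sx.
by case: (sideE (x ord0 i1)) => ->; case: ss => ->; case: ss' => -> n1 n2 ex; lra.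
Qed.

End sharpness.

(** * Failure of the larger exponents *)

Section failure.
Context (R : realType) (n m : nat) (i0 i1 : 'I_n) (j0 : 'I_m).
Hypothesis i01 : i1 != i0.
Local Notation E := 'rV[R]_n.
Local Notation S := (@two_rows R n i0 i1).
Local Notation Y := (@unit_box R n).
Local Notation rho := (uniform_on (@measurable_two_rows R n i0 i1) (lebesgue_two_rows R i01)).
Local Notation c := (m.+1%:R^-1 : R).
Variable eps : R.
Hypothesis eps_gt0 : 0 < eps.
Hypothesis eps_le : eps <= 4^-1.
Local Notation family := (switch_family i0 i1 j0 eps).
Local Notation claw := (switch_law j0 i01 eps).

Lemma switch_L2 : L2_dist S rho (family 0 j0) (family 1 j0) = (Num.sqrt (8 * eps))%:E.
Proof.
have mS := @measurable_two_rows R n i0 i1.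
rewrite L2_distE//.
  rewrite -(Rintegral_switch i01 eps_gt0 eps_le); congr (Num.sqrt _)%:E.
  by rewrite /switch_family eqxx.
have bs := lam_bary R n m.
apply: (@le_bound_integrable _ _ _ _ _ _ ((2 * (2 * n%:R)) ^+ 2)) => //.
- exact: prob_lty.
- apply: measurable_dot; apply: measurable_rV_on => // k; under eq_fun do rewrite !mxE;
  by apply: measurable_funB; apply: measurable_coord_comp; apply: measurable_funTS;
    exact: measurable_switch_family.
- move=> x _; rewrite ger0_norm ?dot_ge0// -enorm_le; last by rewrite !mulr_ge0.
  apply: (le_trans (ler_enorm_dist _ 0 _)); rewrite (enormB 0).
  have := bs_Y bs (unit_box_switch i0 i1 j0 eps_gt0 eps_le 0 j0 x).
  by have := bs_Y bs (unit_box_switch i0 i1 j0 eps_gt0 eps_le 1 j0 x); lra.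
Qed.

Lemma switch_W1 j :
  (wasserstein1 (claw 0 j) (claw 1 j) <= if j == j0 then (4 * eps ^+ 2)%:E else 0)%E.
Proof.
case: ifPn => [/eqP ->|jn].
  rewrite -(integral_rearranged i01 eps_gt0 eps_le).
  apply: wasserstein1_le_maps.
  - exact: measurable_switch.
  - exact: measurable_rearranged.
  - by move=> A mA; rewrite /switch_law /= /law /pushforward /switch_family eqxx.
  - move=> A mA; apply: etrans (rearranged_law i01 eps_gt0 eps_le mA).
    by rewrite /switch_law /= /law /pushforward /switch_family eqxx.
have -> : (0 = \int[rho]_x (enorm (cst (0 : E) x - cst (0 : E) x))%:E)%E.
  by apply/esym/integral0_eq => x _; rewrite subrr enorm0.
apply: wasserstein1_le_maps => // A mA;
by rewrite /switch_law /= /law /pushforward /switch_family (negbTE jn).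
Qed.

Lemma switch_lower_bound (alpha C : R) : 0 < alpha -> 0 < C ->
  stability_estimate ((fun=> c) : 'I_m.+1 -> R) S Y rho alpha C ->
  c * Num.sqrt (8 * eps) <= C * (4 * eps ^+ 2) `^ alpha.
Proof.
move=> a0 C0 /(_ (claw 0) (claw 1) (switch_law_carried j0 i01 eps_gt0 eps_le 0)
  (switch_law_carried j0 i01 eps_gt0 eps_le 1) (family 0) (family 1)).
move=> /(_ (switch_optimal j0 i01 eps_gt0 eps_le (lexx 0) ler01)
  (switch_optimal j0 i01 eps_gt0 eps_le ler01 (lexx 1))) H.
have c0 : 0 < c by rewrite invr_gt0.
have c1 : c <= 1 by rewrite invf_le1// ler1n.
rewrite -lee_fin EFinM -switch_L2; apply: (@le_trans _ _
  (\sum_(i < m) c%:E * L2_dist S rho (family 0 i) (family 1 i))%E).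
  rewrite (bigD1 j0)//= leeDl//; apply: sume_ge0 => i _.
  by rewrite mule_ge0 ?lee_fin ?(ltW c0)//; exact: Lnorm_ge0.
apply: (le_trans H); rewrite EFinM; apply: lee_wpmul2l; first by rewrite lee_fin ltW.
rewrite -poweR_EFin; apply: gt0_ler_poweR; first exact: ltW.
- rewrite in_itv/= leey andbT; apply: sume_ge0 => i _.
  by rewrite mule_ge0 ?wasserstein1_ge0 ?lee_fin ?(ltW c0).
- by rewrite in_itv/= leey andbT lee_fin mulr_ge0// sqr_ge0.
apply: (@le_trans _ _ (\sum_(i < m) (if i == j0 then (4 * eps ^+ 2)%:E else 0))%E).
  apply: lee_sum => i _; apply: le_trans (switch_W1 i).
  by rewrite gee_pMl ?wasserstein1_ge0 ?lee_fin.
by rewrite -big_mkcond/= big_pred1_eq.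
Qed.

End failure.

(** For [eps = r ^+ 2] the bound of [switch_lower_bound] implies
    [c r <= K r^(4 alpha)], which fails for small [r] because [4 alpha > 1]. *)
Theorem no_better_exponent (R : realType) (n m : nat) (alpha : R) :
  (2 <= n)%N -> (0 < m)%N -> 4^-1 < alpha -> ~ @uniform_stability R n m alpha.
Proof.
move=> n2 m0 a4 US.
pose i0 : 'I_n := Ordinal (ltnW n2); pose i1 : 'I_n := Ordinal n2.
pose j0 : 'I_m := Ordinal m0.
have i01 : i1 != i0 by [].
pose S := @two_rows R n i0 i1; pose Y := @unit_box R n.
have [M rM] := uniform_on_Linf (@measurable_two_rows R n i0 i1) (lebesgue_two_rows R i01).
pose c : R := m.+1%:R^-1; have c0 : 0 < c by rewrite invr_gt0.
have [C C0 HC] := US c (ediam (S `|` Y)) M.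
have bs := lam_bary R n m.
have est := HC (fun=> c) S Y _ (bs_gt0 bs) (bs_sum bs) erefl
  (@compact_two_rows R n i0 i1) (@compact_unit_box R n) erefl
  (uniform_onS _ (lebesgue_two_rows R i01)) (uniform_on_dominated _ _) rM.
have alpha0 : 0 < alpha by apply: lt_trans a4; rewrite invr_gt0.
pose beta := 4 * alpha - 1; have b0 : 0 < beta by rewrite /beta; lra.
pose K := C * 4 `^ alpha; have K0 : 0 < K by rewrite mulr_gt0// powR_gt0.
have cK : 0 < c / (2 * K) by rewrite divr_gt0// mulr_gt0.
pose r := Num.min 2^-1 ((c / (2 * K)) `^ beta^-1).
have r0 : 0 < r by rewrite lt_min invr_gt0 ltr0n powR_gt0.
have r2 : r <= 2^-1 by rewrite ge_min lexx.
have rb : r `^ beta <= c / (2 * K).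
  have -> : c / (2 * K) = ((c / (2 * K)) `^ beta^-1) `^ beta.
    by rewrite -powRrM mulVf ?gt_eqF// powRr1// ltW.
  apply: ge0_ler_powR; rewrite ?nnegrE; [exact: ltW|exact: ltW|exact: powR_ge0|].
  by rewrite ge_min lexx orbT.
have e4 : r ^+ 2 <= 4^-1.
  have -> : 4^-1 = 2^-1 ^+ 2 :> R by field.
  by rewrite lerXn2r ?nnegrE ?(ltW r0)// invr_ge0.
have H := @switch_lower_bound R n m i0 i1 j0 i01 (r ^+ 2) (exprn_gt0 2 r0) e4 alpha C alpha0 C0 est.
have s8 : r <= Num.sqrt (8 * r ^+ 2).
  have r20 := sqr_ge0 r; have r00 := ltW r0.
  have -> : r = Num.sqrt (r ^+ 2) by rewrite sqrtr_sqr ger0_norm.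
  by rewrite sqr_sqrtr// ler_sqrt; lra.
have rE : (4 * (r ^+ 2) ^+ 2) `^ alpha = 4 `^ alpha * (r * r `^ beta).
  have -> : (r ^+ 2) ^+ 2 = r `^ 4%:R by rewrite -exprM powR_mulrn ?(ltW r0).
  rewrite powRM; [|by []|exact: powR_ge0].
  have -> : (r `^ 4%:R) `^ alpha = r `^ (1 + beta).
    by rewrite -powRrM; congr (_ `^ _); rewrite /beta; lra.
  by rewrite powRD ?powRr1 ?(ltW r0)//; rewrite (gt_eqF r0) implybT.
have : c * r <= K * (r * r `^ beta).
  rewrite /K -mulrA -rE; apply: le_trans H; apply: ler_wpM2l => //; exact: ltW.
rewrite mulrC [leRHS]mulrCA ler_pM2l// => h.
have : K * r `^ beta <= K * (c / (2 * K)) by rewrite ler_pM2l.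
have -> : K * (c / (2 * K)) = c / 2 by field; rewrite gt_eqF.
by move=> h'; have := le_trans h h'; lra.
Qed.

Theorem theorem1p3 (R : realType) :
  (forall n m : nat, (1 <= n)%N -> (3 <= m.+1)%N ->
     @uniform_stability R n m 4^-1) /\
  (forall (n m : nat) (alpha : R), (2 <= n)%N -> (3 <= m.+1)%N ->
     4^-1 < alpha -> ~ @uniform_stability R n m alpha).
Proof.
split=> [n m _ m2|n m alpha n2 m2]; first exact: stability_quarter.
by apply: no_better_exponent => //; exact: ltnW.
Qed.
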